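(* The tables below record the correspondence between the almost positive roots of $D_4$, $E_6$, $E_8$ and the cluster variables of $\mathbb{C}[\mathbb{G}(3,6)]$, $\mathbb{C}[\mathbb{G}(3,7)]$, $\mathbb{C}[\mathbb{G}(3,8)]$ respectively: in each case the map $\alpha\mapsto X[\alpha]$ given by the table is a bijection from the almost positive roots to the cluster variables (up to sign); the functions $x_i=X[-\alpha_i]$ form a Dynkin cluster; and for each almost positive root $\alpha=\sum c_i\alpha_i$ the vector $(c_1,c_2,\dots)$ is the vector of exponents of the monomial denominator of $X[\alpha]$ expressed as a Laurent polynomial in the Dynkin cluster, i.e. $X[\alpha]=P/\prod_i x_i^{c_i}$ with $P$ a polynomial in the $x_i$ and the coefficients (boundary Plücker coordinates), not divisible by any $x_i$. Positive roots are written as strings of coefficients $c_1c_2c_3\cdots$. $D_4$, $\mathbb{G}(3,6)$. $-\alpha_1,\dots,-\alpha_4$: $\Delta^{145}$, $Y^{123456}$, $\Delta^{136}$, $\Delta^{235}$. $1000:\Delta^{236}$; $1100:\Delta^{356}$; $0111:\Delta^{124}$; $0100:\Delta^{135}$; $1111:\Delta^{246}$; $1211:X^{123456}$; $0010:\Delta^{245}$; $0110:\Delta^{125}$; $1101:\Delta^{346}$; $0001:\Delta^{146}$; $0101:\Delta^{134}$; $1110:\Delta^{256}$. $E_6$, $\mathbb{G}(3,7)$. $-\alpha_1,\dots,-\alpha_6$: $\Delta^{237}$, $\Delta^{147}$, $Y^{123567}$, $Y^{124567}$, $\Delta^{246}$, $\Delta^{346}$. $100000:\Delta^{156}$; $101000:\Delta^{124}$;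 $001100:\Delta^{467}$; $010110:\Delta^{356}$; $010111:\Delta^{235}$; $001111:\Delta^{457}$; $101110:\Delta^{134}$; $111100:\Delta^{126}$; $011100:\Delta^{267}$; $000110:\Delta^{137}$; $000011:\Delta^{157}$; $000001:\Delta^{245}$; $001000:\Delta^{247}$; $101100:\Delta^{146}$; $111110:X^{123456}$; $011211:X^{234567}$; $011221:\Delta^{357}$; $111221:\Delta^{135}$; $112211:X^{124567}$; $112210:X^{123467}$; $111210:\Delta^{136}$; $011111:\Delta^{257}$; $000111:Y^{123457}$; $000010:Y^{134567}$; $010000:\Delta^{256}$; $010100:\Delta^{236}$; $001110:\Delta^{347}$; $101111:\Delta^{145}$; $111111:\Delta^{125}$; $011210:\Delta^{367}$; $000100:Y^{123467}$; $011110:Y^{234567}$; $111211:Y^{123456}$; $112221:X^{123457}$; $112321:X^{134567}$; $122321:X^{123567}$. $E_8$, $\mathbb{G}(3,8)$. $-\alpha_1,\dots,-\alpha_8$: $\Delta^{348}$, $\Delta^{258}$, $Y^{234678}$, $B$, $A$, $Y^{135678}$, $\Delta^{357}$, $\Delta^{457}$. (1) $10000000:\Delta^{267}$; $10100000:\Delta^{125}$; $00110000:\Delta^{158}$; $01011000:\Delta^{367}$; $01011100:\Delta^{347}$; $00111110:\Delta^{458}$; $10111111:\Delta^{256}$; $11111111:\Delta^{126}$; $01121110:\Delta^{148}$; $01122100:\Delta^{378}$; $11122100:\Delta^{237}$; $11221110:\Delta^{145}$; $11221111:\Delta^{156}$; $11122111:\Delta^{236}$; $01122210:\Delta^{478}$.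 (2) $01000000:X^{123467}$; $01010000:Y^{134678}$; $00111000:\Delta^{358}$; $10111100:\Delta^{257}$; $11111110:X^{124567}$; $01121111:Y^{134568}$; $01122111:\Delta^{368}$; $11122210:\Delta^{247}$; $11222210:X^{124578}$; $11232111:Y^{123568}$; $12232111:\Delta^{136}$; $12232210:\Delta^{147}$; $11233210:X^{234578}$; $11233211:X^{235678}$; $12232221:\Delta^{146}$. (3) $00100000:X^{123458}$; $10110000:Y^{125678}$; $11111000:X^{123567}$; $01121100:Y^{134578}$; $01122110:Y^{345678}$; $11122211:Y^{234567}$; $11222221:X^{124568}$; $11232221:Y^{124568}$; $12233211:X^{123678}$; $12243210:Y^{123478}$; $12343210:X^{134578}$; $22343211:Y^{123567}$; $22343221:Y^{123456}$; $12343321:X^{145678}$; $12244321:X^{234678}$. (4) $00010000:B^{\sigma}$; $01111000:B^{\sigma\rho^5}$; $11121100:B^{\rho^5}$; $11222110:B^{\rho^3}$; $11232211:B^{\sigma\rho^3}$; $12233221:B^{\sigma\rho^2}$; $12243321:B^{\rho^2}$; $12344321:B^{\rho^6}$; $22354321:B^{\sigma\rho^6}$; $23454321:B^{\sigma\rho^7}$; $23464321:B^{\rho^7}$; $23465321:B^{\rho}$; $23465421:B^{\sigma\rho}$; $23465431:B^{\sigma\rho^4}$; $23465432:B^{\rho^4}$. (5) $00001000:Y^{235678}$; $00011100:Y^{234578}$; $01111110:A^{\rho^3}$; $11121111:A^{\rho^5}$; $11222111:X^{123568}$; $11232210:Y^{124578}$; $12233210:A^{\rho^6}$; $12243211:A^{\rho^2}$;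 $12343221:X^{134568}$; $22343321:Y^{124567}$; $22344321:A^{\rho}$; $12354321:A^{\rho^7}$; $13354321:X^{134678}$; $23354321:Y^{123467}$; $22454321:A^{\rho^4}$. (6) $00000100:X^{123457}$; $00001110:Y^{245678}$; $00011111:Y^{234568}$; $01111111:X^{123468}$; $11121110:Y^{124678}$; $11222100:X^{123578}$; $11232100:Y^{123578}$; $12232110:X^{134567}$; $12232211:Y^{134567}$; $11233221:X^{234568}$; $11233321:X^{245678}$; $12233321:X^{124678}$; $12243221:Y^{123468}$; $12343211:X^{135678}$; $22343210:Y^{123457}$. (7) $00000010:Y^{145678}$; $00000111:X^{123456}$; $00001111:\Delta^{268}$; $00011110:\Delta^{248}$; $01111100:X^{123478}$; $11121000:Y^{123678}$; $11221000:\Delta^{135}$; $11221100:\Delta^{157}$; $11122110:X^{234567}$; $01122211:X^{345678}$; $01122221:\Delta^{468}$; $11122221:\Delta^{246}$; $11222211:X^{125678}$; $11232110:Y^{123458}$; $12232100:\Delta^{137}$. (8) $00000001:\Delta^{356}$; $00000011:\Delta^{168}$; $00000110:\Delta^{124}$; $00001100:\Delta^{278}$; $00011000:\Delta^{238}$; $01110000:\Delta^{134}$; $11110000:\Delta^{167}$; $10111000:\Delta^{235}$; $00111100:\Delta^{578}$; $01011110:\Delta^{467}$; $01011111:\Delta^{346}$; $00111111:\Delta^{568}$; $10111110:\Delta^{245}$; $11111100:\Delta^{127}$; $01121000:\Delta^{138}$.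
   Context: Roots. Almost positive roots are the positive roots together with the negative simple roots $-\alpha_i$. Dynkin graphs: $D_4$ has central node $2$ joined to $1,3,4$; $E_6$ is the chain $1-3-4-5-6$ with $2$ joined to $4$; $E_8$ is the chain $1-3-4-5-6-7-8$ with $2$ joined to $4$. A Dynkin cluster is a cluster whose seed has a principal exchange submatrix $B$ such that the graph with an edge $\{x_i,x_j\}$ whenever $b_{x_i,x_j}\neq0$ is the Dynkin graph of the corresponding type, $x_i$ being attached to node $i$. Grassmannian. $X(k,n)\subset\bigwedge^k\mathbb{C}^n$ is the affine cone of decomposable $k$-forms, with Plücker coordinates $\Delta^K$ indexed by $k$-subsets $K\subset\{1,\dots,n\}$; $\mathbb{C}[\mathbb{G}(k,n)]$ is the coordinate ring of $X(k,n)$. Points of the cone are represented by $3\times n$ matrices with columns $v_1,\dots,v_n$, $\Delta^{abc}=\det(v_a\ v_b\ v_c)$ for $a<b<c$. Functions. $X^{123456}=\Delta^{134}\Delta^{256}-\Delta^{156}\Delta^{234}$, $Y^{123456}=\Delta^{145}\Delta^{236}-\Delta^{123}\Delta^{456}$; for $a_1<\dots<a_6$, $X^{a_1\dots a_6}$ and $Y^{a_1\dots a_6}$ are obtained by replacing the index $r$ by $a_r$. $A=\Delta^{134}\big(\Delta^{258}\Delta^{167}-\Delta^{678}\Delta^{125}\big)-\Delta^{158}\Delta^{234}\Delta^{167}$, $B=\Delta^{258}\Delta^{134}\Delta^{267}-\Delta^{234}\big(\Delta^{128}\Delta^{567}+\Delta^{258}\Delta^{167}\big)$. For $g$ in the dihedral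 group $D_8$ acting on $\{1,\dots,8\}$, $f^g$ is obtained from $f$ by substituting $v_{g(i)}$ for $v_i$; $\rho(i)=i+1$ (mod 8), $\sigma(i)=10-i$ (mod 8), and $\sigma\rho^m=\sigma\circ\rho^m$. Cluster variables are taken up to sign. Seeds and mutation. A seed in a field $\mathcal{F}$ of rational functions over $\mathbb{C}$ in $M$ variables is a triple $(\mathbf{x},\mathbf{c},\tilde B)$ where $\tilde{\mathbf{x}}=\mathbf{x}\sqcup\mathbf{c}$ is a transcendence basis of $\mathcal{F}$ ($M$ algebraically independent elements) and $\tilde B=(b_{x,y})$ is an integer matrix with rows indexed by $\tilde{\mathbf x}$ and columns by $\mathbf{x}$ whose square submatrix $B$ with rows in $\mathbf{x}$ is skew-symmetrizable. For $z\in\mathbf{x}$, $\mu_z(\mathbf{x},\mathbf{c},\tilde B)=(\mathbf{x}-\{z\}\cup\{z'\},\mathbf{c},\tilde B')$, where $zz'=\prod_{b_{x,z}>0}x^{b_{x,z}}+\prod_{b_{x,z}<0}x^{-b_{x,z}}$ and $b'_{x,y}=-b_{x,y}$ if $x=z$ or $y=z$, $b'_{x,y}=b_{x,y}+\frac{|b_{x,z}|b_{z,y}+b_{x,z}|b_{z,y}|}{2}$ otherwise (index $z$ renamed $z'$). Clusters are the sets $\mathbf{x}$ in seeds obtained from an initial seed by iterated mutation; their elements are the cluster variables. Cluster structure on $\mathbb{C}[\mathbb{G}(k,n)]$ (here $k=3$, $n\in\{6,7,8\}$). $\mathcal{F}$ is the fraction field of $\mathbb{C}[\mathbb{G}(k,n)]$.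 For $0\le i\le k$, $0\le j\le n-k$ put $p_{ij}=n-k-\lfloor\frac{i+j-2}{2}\rfloor$, $p'_{ij}=n-k+2+\lfloor\frac{i+j-1}{2}\rfloor$ and $I_{ij}=\{p_{ij},\dots,p_{ij}+i-1\}\sqcup\{p'_{ij},\dots,p'_{ij}+k-i-1\}$ (mod $n$; only non-corner pairs $(i,j)$ are used). The initial cluster is $\{\Delta^{I_{ij}}: 1\le i\le k-1,\ 1\le j\le n-k-1\}$; the coefficients $\mathbf{c}$ are the boundary Plücker coordinates $\Delta^{K}$ for the $n$ cyclic intervals $K$ of length $k$ (these are the $I_{ij}$ with $i\in\{0,k\}$ or $j\in\{0,n-k\}$). In the column of $\tilde B$ indexed by $I_{ij}$ the entries in rows $I_{i\pm1,j}$ equal $(-1)^{i+j}$, the entries in rows $I_{i,j\pm1}$ equal $-(-1)^{i+j}$, and all other entries are $0$. *)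

(* Defs.v *)
From HB Require Import structures.
From mathcomp Require Import all_boot all_order all_algebra all_fingroup.
From mathcomp Require Import ring_quotient fraction boolp.
From mathcomp.multinomials Require Import mpoly.

Set Implicit Arguments.
Unset Strict Implicit.
Unset Printing Implicit Defensive.

Import Order.TTheory GRing.Theory Num.Theory.

Local Open Scope ring_scope.
Local Open Scope quotient_scope.

Notation ksubset k n := {K : {set 'I_n} | #|K| == k}.

(* The elements of K in increasing order. *)
Definition kelt k n (K : ksubset k n) (j : 'I_k) : 'I_n :=
  enum_val (cast_ord (esym (eqP (valP K))) j).

(* w is the coordinate vector, in the basis (e_K)_K of the k-th exterior
   power, of a decomposable k-form: the wedge product of the rows of v is the
   sum of the det (v_K) e_K, where v_K is the k x k submatrix with columns K. *)
Definition decomposable (C : nzRingType) k n (w : ksubset k n -> C) : Prop :=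
  exists v : 'M[C]_(k, n), forall K, w K = \det (colsub (kelt K) v).

Notation pluckerPoly C k n := {mpoly C[#|[the finType of ksubset k n]|]}.

Definition vanishing_ideal (C : comNzRingType) (k n : nat) :
    {pred pluckerPoly C k n} :=
  fun p => `[< forall w : ksubset k n -> C, decomposable w ->
                 p.@[fun i => w (enum_val i)] = 0 >].
Arguments vanishing_ideal : clear implicits.

Section VanishingIdeal.
Variables (C : numFieldType) (k n : nat).
Local Notation I := (vanishing_ideal C k n).
Local Notation ev v p :=
  (p.@[fun i => \det (colsub (kelt (enum_val i : ksubset k n)) v)]).

Lemma vanishingP (p : pluckerPoly C k n) :
  reflect (forall v : 'M[C]_(k, n), ev v p = 0) (p \in I).
Proof.
rewrite -[p \in I]/(`[< _ >]); apply: (iffP (@asboolP _)) => [p0 v|p0 w [v wv]].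
  by apply: (p0 (fun K => \det (colsub (kelt K) v))); exists v.
by rewrite -(p0 v); apply: meval_eq => i; rewrite wv.
Qed.

Lemma vanishing_ideal_closed : idealr_closed I.
Proof.
split=> [||a p q /vanishingP p0 /vanishingP q0].
- by apply/vanishingP => v; rewrite meval0.
- by apply/negP => /vanishingP/(_ 0)/eqP; rewrite meval1 oner_eq0.
- by apply/vanishingP => v; rewrite mevalD mevalM p0 q0 mulr0 addr0.
Qed.

HB.instance Definition _ :=
  isIdealr.Build (pluckerPoly C k n) I vanishing_ideal_closed.

(* Two polynomials not vanishing at v and w are restricted to the matrices
   v + t (w - v). *)
Lemma vanishing_ideal_prime : prime_idealr_closed I.
Proof.
pose M (v w : 'M[C]_(k, n)) : 'M[{poly C}]_(k, n) :=
  map_mx polyC v + 'X *: map_mx polyC (w - v).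
pose L v w (p : pluckerPoly C k n) : {poly C} :=
  mmap polyC
    (fun i => \det (colsub (kelt (enum_val i : ksubset k n)) (M v w))) p.
have LE v w p t : (L v w p).[t] = ev (v + t *: (w - v)) p.
  rewrite /L /meval /mmap -horner_evalE rmorph_sum /=; apply: eq_bigr => m _.
  rewrite rmorphM /= horner_evalE hornerC; congr (_ * _).
  rewrite /mmap1 rmorph_prod; apply: eq_bigr => i _.
  rewrite rmorphXn /=; congr (_ ^+ _).
  rewrite -det_map_mx; congr (\det _); apply/matrixP => a b.
  by rewrite !mxE /= horner_evalE !hornerE.
move=> p q /vanishingP pq0.
case: (boolP (p \in I)) => //= /vanishingP/existsNP[v /eqP pv].
case: (boolP (q \in I)) => //= /vanishingP/existsNP[w /eqP qw].
have Lp : L v w p != 0.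
  apply: contraNneq pv => L0.
  by rewrite -[v]addr0 -[X in v + X](scale0r (w - v)) -LE L0 horner0.
have Lq : L v w q != 0.
  apply: contraNneq qw => L0.
  by rewrite -(subrKC v w) -[X in v + X]scale1r -LE L0 horner0.
suff /eqP : L v w p * L v w q = 0 by rewrite mulf_eq0 (negPf Lp) (negPf Lq).
set l := _ * _; pose s := [seq i%:R : C | i <- iota 0 (size l)].
apply: (@roots_geq_poly_eq0 _ _ s).
- apply/allP => _ /mapP[i _ ->]; rewrite /root hornerM !LE -mevalM.
  by rewrite pq0.
- rewrite map_inj_uniq ?iota_uniq // => i j /eqP.
  by rewrite eqr_nat => /eqP.
- by rewrite size_map size_iota.
Qed.

HB.instance Definition _ := isPrimeIdealrClosed.Build (pluckerPoly C k n) I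
  vanishing_ideal_prime.

End VanishingIdeal.

Definition coordRing (C : numFieldType) (k n : nat) : Type :=
  {ideal_quot vanishing_ideal C k n}.

HB.instance Definition _ (C : numFieldType) (k n : nat) :=
  GRing.ComNzRing.on (coordRing C k n).
HB.instance Definition _ (C : numFieldType) (k n : nat) :=
  Quotient.on (coordRing C k n).


Section CoordRing.
Variables (C : numFieldType) (k n : nat).
Local Notation A := (coordRing C k n).

Let unitA : {pred A} := fun x => `[< exists y, y * x = 1 >].
Let invA (x : A) : A :=
  if pselect (exists y, y * x = 1) is left e then projT1 (cid e) else x.

Fact coordRing_mulVx : {in unitA, left_inverse 1 invA *%R}.
Proof.
move=> x /asboolP xu; rewrite /invA; case: pselect => // e.
by case: (cid e).
Qed.

Fact coordRing_unitPl (x y : A) : y * x = 1 -> unitA x.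
Proof. by move=> yx; apply/asboolP; exists y. Qed.

Fact coordRing_invr_out : {in [predC unitA], invA =1 id}.
Proof.
move=> x xNu; rewrite /invA; case: pselect => // e.
by case/negP: xNu; apply/asboolP.
Qed.

HB.instance Definition _ := GRing.ComNzRing_hasMulInverse.Build A
  coordRing_mulVx coordRing_unitPl coordRing_invr_out.

Fact coordRing_integral : GRing.integral_domain_axiom A.
Proof. exact: (@Quotient.rquot_IdomainAxiom _ (vanishing_ideal C k n)). Qed.

HB.instance Definition _ := GRing.ComUnitRing_isIntegral.Build A
  coordRing_integral.

End CoordRing.

Notation fracRing C k n := {fraction coordRing C k n}.

Section Embedding.
Variables (C : numFieldType) (k n : nat).

Definition coord_fun (p : pluckerPoly C k n) : fracRing C k n :=
  FracField.tofrac (\pi_(coordRing C k n) p).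

Definition const_fun (a : C) : fracRing C k n := coord_fun a%:MP.

(* For labels a_1, ..., a_k in {1, ..., n}, Delta [:: a_1; ...; a_k] is the
   function det(v_{a_1} ... v_{a_k}), i.e. the Plucker coordinate of the set
   of the a_j times the sign of the permutation sorting them, or 0 if the
   labels are not distinct.  Columns are numbered from 0 in 'I_n. *)
Definition Delta (a : seq nat) : fracRing C k n :=
  \sum_(K : ksubset k n)
    \sum_(s : 'S_k | [forall j : 'I_k, nth 0%N a j == (kelt K (s j)).+1])
      (-1) ^+ s * coord_fun 'X_(enum_rank K).

End Embedding.
Arguments const_fun {C} k n a.
Arguments Delta : clear implicits.

Section Seeds.
Variables (C F : fieldType) (iota : C -> F).

Definition peval (T : finType) (v : T -> F) (P : {mpoly C[#|T|]}) : F :=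
  mmap iota (fun i => v (enum_val i)) P.

Definition algebraically_independent (T : finType) (v : T -> F) : Prop :=
  forall P : {mpoly C[#|T|]}, peval v P = 0 -> P = 0.

Definition transcendence_basis (T : finType) (v : T -> F) : Prop :=
  algebraically_independent v /\
  forall f : F, ~ algebraically_independent (fun o : option T => oapp v f o).

Variables I J : finType.

(* A labelled triple (x, c, B): the rows of B are indexed by the labels of
   x and c, the columns by the labels of x. *)
Record seed := Seed {
  mutable : I -> F;
  frozen : J -> F;
  exchange : I + J -> I -> int }.

Definition extended_cluster (s : seed) (r : I + J) : F :=
  match r with inl i => mutable s i | inr j => frozen s j end.

Definition principal (s : seed) (i j : I) : int := exchange s (inl i) j.

Definition skew_symmetrizable (b : I -> I -> int) : Prop :=
  exists d : I -> int,
    (forall i, 0 < d i) /\ forall i j, d i * b i j = - (d j * b j i).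

Definition is_seed (s : seed) : Prop :=
  transcendence_basis (extended_cluster s) /\ skew_symmetrizable (principal s).

(* The new variable z' keeps the label of z. *)
Definition mutate (z : I) (s : seed) : seed :=
  let x := extended_cluster s in
  let b := exchange s in
  {| mutable := fun i =>
       if i == z then
         (\prod_(r | 0 < b r z) x r ^ b r z +
          \prod_(r | b r z < 0) x r ^ (- b r z)) / mutable s z
       else mutable s i;
     frozen := frozen s;
     exchange := fun r y =>
       if (r == inl z) || (y == z) then - b r y
       else b r y +
         ((`|b r z| * b (inl z) y + b r z * `|b (inl z) y|) %/ 2)%Z |}.

Inductive mutation_equivalent (s0 : seed) : seed -> Prop :=
  | mutation_refl : mutation_equivalent s0 s0
  | mutation_step z s :
      mutation_equivalent s0 s -> mutation_equivalent s0 (mutate z s).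

Definition seed_from (s0 s : seed) : Prop :=
  is_seed s /\ mutation_equivalent s0 s.

Definition cluster_variable (s0 : seed) (f : F) : Prop :=
  exists2 s, seed_from s0 s & exists i, f = mutable s i.

End Seeds.

Section GrassmannianSeed.
Variables (C : numFieldType) (k n : nat).

Definition label (r : int) : nat := (absz ((r - 1) %% n%:Z)%Z).+1.

(* The labels of a, a + 1, ..., a + l - 1. *)
Definition run (a : int) (l : nat) : seq nat :=
  [seq label (a + t%:Z) | t <- iota 0 l].

Definition p1 (i j : nat) : int :=
  (n - k)%N%:Z - ((i%:Z + j%:Z - 2) %/ 2)%Z.

Definition p2 (i j : nat) : int :=
  (n - k)%N%:Z + 2 + ((i%:Z + j%:Z - 1) %/ 2)%Z.

(* Subsets of {1, ..., n} are represented by increasing sequences. *)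
Definition Iset (i j : nat) : seq nat :=
  sort leq (run (p1 i j) i ++ run (p2 i j) (k - i)).

(* (i, j) : grid stands for the pair (i + 1, j + 1). *)
Definition grid : finType := ('I_k.-1 * 'I_(n - k).-1)%type.

Definition row_set (r : grid + 'I_n) : seq nat :=
  match r with
  | inl c => Iset c.1.+1 c.2.+1
  | inr r => sort leq (run r.+1%:Z k)
  end.

Definition initial_exchange (r : grid + 'I_n) (c : grid) : int :=
  let i := c.1.+1 in
  let j := c.2.+1 in
  if row_set r \in [:: Iset i.+1 j; Iset i.-1 j] then (-1) ^+ (i + j)
  else if row_set r \in [:: Iset i j.+1; Iset i j.-1] then - (-1) ^+ (i + j)
  else 0.

Definition initial_seed : seed (fracRing C k n) grid 'I_n :=
  {| mutable := fun c => Delta C k n (row_set (inl c));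
     frozen := fun r => Delta C k n (row_set (inr r));
     exchange := initial_exchange |}.

End GrassmannianSeed.
Arguments grid : clear implicits.
Arguments initial_seed : clear implicits.

(* Node i of the graph is numbered i - 1 in 'I_m. *)
Definition adjacent m (E : seq (nat * nat)) (i j : 'I_m) : bool :=
  ((i.+1, j.+1) \in E) || ((j.+1, i.+1) \in E).

Definition D4 : seq (nat * nat) := [:: (1, 2); (2, 3); (2, 4)]%N.
Definition E6 : seq (nat * nat) :=
  [:: (1, 3); (3, 4); (4, 5); (5, 6); (2, 4)]%N.
Definition E8 : seq (nat * nat) :=
  [:: (1, 3); (3, 4); (4, 5); (5, 6); (6, 7); (7, 8); (2, 4)]%N.

Section Roots.
Variables (m : nat) (E : seq (nat * nat)).

Definition cartan (i j : 'I_m) : int :=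
  if i == j then 2 else if adjacent E i j then -1 else 0.

Definition simple_root (i : 'I_m) : 'rV[int]_m := delta_mx 0 i.

Definition reflection (i : 'I_m) (v : 'rV[int]_m) : 'rV[int]_m :=
  v - (\sum_j cartan i j * v 0 j) *: simple_root i.

Inductive dynkin_root : 'rV[int]_m -> Prop :=
  | root_simple i : dynkin_root (simple_root i)
  | root_reflection i v : dynkin_root v -> dynkin_root (reflection i v).

Definition almost_positive_root (v : 'rV[int]_m) : Prop :=
  (dynkin_root v /\ forall i, 0 <= v 0 i) \/ exists i, v = - simple_root i.

End Roots.

Section Correspondence.
Variables (C : numFieldType) (m n : nat) (E : seq (nat * nat)).
Local Notation F := (fracRing C 3 n).
Local Notation seed0 := (initial_seed C 3 n).
Local Notation iota := (const_fun 3 n).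
Implicit Types (t : seq ('rV[int]_m * F)) (alpha beta : 'rV[int]_m).

Definition eq_up_to_sign (f g : F) : Prop := f = g \/ f = - g.

Definition tabulated t alpha : F :=
  nth 0 (unzip2 t) (index alpha (unzip1 t)).

(* Each almost positive root, and nothing else, has exactly one entry. *)
Definition indexed_by_roots t : Prop :=
  uniq (unzip1 t) /\
  forall alpha, alpha \in unzip1 t <-> almost_positive_root E alpha.

Definition bijective_onto_cluster_variables (X : 'rV[int]_m -> F) : Prop :=
  [/\ forall alpha, almost_positive_root E alpha ->
        exists2 f, cluster_variable iota seed0 f & eq_up_to_sign (X alpha) f,
      forall alpha beta,
        almost_positive_root E alpha -> almost_positive_root E beta ->
        eq_up_to_sign (X alpha) (X beta) -> alpha = beta
    & forall f, cluster_variable iota seed0 f ->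
        exists2 alpha, almost_positive_root E alpha
                     & eq_up_to_sign (X alpha) f].

Definition dynkin_cluster (x : 'I_m -> F) : Prop :=
  exists2 s, seed_from iota seed0 s &
  exists2 node : 'I_m -> grid 3 n, bijective node &
    (forall i, eq_up_to_sign (x i) (mutable s (node i))) /\
    forall i j, adjacent E i j <-> principal s (node i) (node j) != 0.

(* P is a polynomial in m + n variables, evaluated at the x_i and the
   boundary Plucker coordinates. *)
Definition has_denominator (x : 'I_m -> F) (f : F) (c : 'rV[int]_m) : Prop :=
  let var r := match r with inl i => x i | inr j => frozen seed0 j end in
  exists P : {mpoly C[#|[the finType of ('I_m + 'I_n)%type]|]},
    f = peval iota var P / \prod_i x i ^ c 0 i /\
    forall i Q, P <> 'X_(enum_rank (inl i)) * Q.

Definition root_correspondence t : Prop :=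
  let X := tabulated t in
  let x i := X (- simple_root i) in
  [/\ indexed_by_roots t,
      bijective_onto_cluster_variables X,
      dynkin_cluster x
    & forall alpha, almost_positive_root E alpha ->
        has_denominator x (X alpha) alpha].

End Correspondence.

(* Numerals in digits_scope keep their leading zeros; 00110 is read as
   [:: 0; 0; 1; 1; 0]. *)
Definition digits_numeral (u : Number.uint) : Number.uint := u.
Declare Scope digits_scope.
Delimit Scope digits_scope with digits.
Number Notation Number.uint digits_numeral digits_numeral : digits_scope.

Fixpoint decimal_digits (d : Decimal.uint) : seq nat :=
  match d with
  | Decimal.Nil => [::]
  | Decimal.D0 d => 0%N :: decimal_digits d
  | Decimal.D1 d => 1%N :: decimal_digits d
  | Decimal.D2 d => 2%N :: decimal_digits d
  | Decimal.D3 d => 3%N :: decimal_digits d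
  | Decimal.D4 d => 4%N :: decimal_digits d
  | Decimal.D5 d => 5%N :: decimal_digits d
  | Decimal.D6 d => 6%N :: decimal_digits d
  | Decimal.D7 d => 7%N :: decimal_digits d
  | Decimal.D8 d => 8%N :: decimal_digits d
  | Decimal.D9 d => 9%N :: decimal_digits d
  end.

Definition digits (u : Number.uint) : seq nat :=
  if u is Number.UIntDecimal d then decimal_digits d else [::].
Arguments digits u%_digits_scope.

Section Functions.
Variables (C : numFieldType) (n : nat).
Local Notation F := (fracRing C 3 n).

(* g is a substitution of labels: v_{g i} replaces v_i. *)
Section Substitution.
Variable g : nat -> nat.
Local Notation d a b c := (Delta C 3 n [:: g a%N; g b%N; g c%N]).

Definition X_fun : F := d 1 3 4 * d 2 5 6 - d 1 5 6 * d 2 3 4.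
Definition Y_fun : F := d 1 4 5 * d 2 3 6 - d 1 2 3 * d 4 5 6.
Definition A_fun : F :=
  d 1 3 4 * (d 2 5 8 * d 1 6 7 - d 6 7 8 * d 1 2 5)
  - d 1 5 8 * d 2 3 4 * d 1 6 7.
Definition B_fun : F :=
  d 2 5 8 * d 1 3 4 * d 2 6 7
  - d 2 3 4 * (d 1 2 8 * d 5 6 7 + d 2 5 8 * d 1 6 7).

End Substitution.

Definition D_ (u : Number.uint) : F := Delta C 3 n (digits u).
Definition X_ (u : Number.uint) : F := X_fun (fun r => nth 0%N (digits u) r.-1).
Definition Y_ (u : Number.uint) : F := Y_fun (fun r => nth 0%N (digits u) r.-1).

End Functions.
Arguments D_ C n%_nat_scope u%_digits_scope.
Arguments X_ C n%_nat_scope u%_digits_scope.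
Arguments Y_ C n%_nat_scope u%_digits_scope.

(* The representative of r modulo 8 in {1, ..., 8}, for r > 0. *)
Definition mod8 (r : nat) : nat := (r.-1 %% 8).+1.
Definition rho (i : nat) : nat := mod8 (i + 1).
Definition sigma (i : nat) : nat := mod8 (10 - i).

(* The first list is X[- alpha_1], ..., X[- alpha_m]; in the second one a
   positive root is given by its string of coefficients. *)
Definition mk_table C m n
    (negative : seq (fracRing C 3 n))
    (positive : seq (seq nat * fracRing C 3 n)) :
    seq ('rV[int]_m * fracRing C 3 n) :=
  zip [seq - simple_root i | i <- enum 'I_m] negative ++
  [seq (\row_i (nth 0%N p.1 i)%:Z, p.2) | p <- positive].

Arguments mk_table {C m n} negative positive.

Declare Scope table_scope.
Delimit Scope table_scope with table.
Notation "u |-> f" := (digits u, f) : table_scope.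

Local Open Scope table_scope.

Section TableD4.
Variable C : numFieldType.
Local Notation D := (D_ C 6).
Local Notation X := (X_ C 6).
Local Notation Y := (Y_ C 6).

Definition table_D4 : seq ('rV[int]_4 * fracRing C 3 6) :=
  mk_table
    [:: D 145; Y 123456; D 136; D 235]
    [:: 1000 |-> D 236; 1100 |-> D 356; 0111 |-> D 124;
        0100 |-> D 135; 1111 |-> D 246; 1211 |-> X 123456;
        0010 |-> D 245; 0110 |-> D 125; 1101 |-> D 346;
        0001 |-> D 146; 0101 |-> D 134; 1110 |-> D 256].

End TableD4.

Section TableE6.
Variable C : numFieldType.
Local Notation D := (D_ C 7).
Local Notation X := (X_ C 7).
Local Notation Y := (Y_ C 7).

Definition table_E6 : seq ('rV[int]_6 * fracRing C 3 7) :=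
  mk_table
    [:: D 237; D 147; Y 123567; Y 124567; D 246; D 346]
    [:: 100000 |-> D 156; 101000 |-> D 124; 001100 |-> D 467;
        010110 |-> D 356; 010111 |-> D 235; 001111 |-> D 457;
        101110 |-> D 134; 111100 |-> D 126; 011100 |-> D 267;
        000110 |-> D 137; 000011 |-> D 157; 000001 |-> D 245;

        001000 |-> D 247; 101100 |-> D 146; 111110 |-> X 123456;
        011211 |-> X 234567; 011221 |-> D 357; 111221 |-> D 135;
        112211 |-> X 124567; 112210 |-> X 123467; 111210 |-> D 136;
        011111 |-> D 257; 000111 |-> Y 123457; 000010 |-> Y 134567;

        010000 |-> D 256; 010100 |-> D 236; 001110 |-> D 347;
        101111 |-> D 145; 111111 |-> D 125; 011210 |-> D 367;

        000100 |-> Y 123467; 011110 |-> Y 234567; 111211 |-> Y 123456;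
        112221 |-> X 123457; 112321 |-> X 134567; 122321 |-> X 123567].

End TableE6.

Section TableE8.
Variable C : numFieldType.
Local Notation D := (D_ C 8).
Local Notation X := (X_ C 8).
Local Notation Y := (Y_ C 8).
Local Notation A := (A_fun C 8).
Local Notation B := (B_fun C 8).

Definition table_E8 : seq ('rV[int]_8 * fracRing C 3 8) :=
  mk_table
    [:: D 348; D 258; Y 234678; B id; A id; Y 135678; D 357; D 457]
    [:: 10000000 |-> D 267; 10100000 |-> D 125; 00110000 |-> D 158;
        01011000 |-> D 367; 01011100 |-> D 347; 00111110 |-> D 458;
        10111111 |-> D 256; 11111111 |-> D 126; 01121110 |-> D 148;
        01122100 |-> D 378; 11122100 |-> D 237; 11221110 |-> D 145;
        11221111 |-> D 156; 11122111 |-> D 236; 01122210 |-> D 478;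

        01000000 |-> X 123467; 01010000 |-> Y 134678; 00111000 |-> D 358;
        10111100 |-> D 257; 11111110 |-> X 124567; 01121111 |-> Y 134568;
        01122111 |-> D 368; 11122210 |-> D 247; 11222210 |-> X 124578;
        11232111 |-> Y 123568; 12232111 |-> D 136; 12232210 |-> D 147;
        11233210 |-> X 234578; 11233211 |-> X 235678; 12232221 |-> D 146;

        00100000 |-> X 123458; 10110000 |-> Y 125678; 11111000 |-> X 123567;
        01121100 |-> Y 134578; 01122110 |-> Y 345678; 11122211 |-> Y 234567;
        11222221 |-> X 124568; 11232221 |-> Y 124568; 12233211 |-> X 123678;
        12243210 |-> Y 123478; 12343210 |-> X 134578; 22343211 |-> Y 123567;
        22343221 |-> Y 123456; 12343321 |-> X 145678; 12244321 |-> X 234678;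

        00010000 |-> B sigma; 01111000 |-> B (sigma \o iter 5 rho);
        11121100 |-> B (iter 5 rho); 11222110 |-> B (iter 3 rho);
        11232211 |-> B (sigma \o iter 3 rho);
        12233221 |-> B (sigma \o iter 2 rho); 12243321 |-> B (iter 2 rho);
        12344321 |-> B (iter 6 rho); 22354321 |-> B (sigma \o iter 6 rho);
        23454321 |-> B (sigma \o iter 7 rho); 23464321 |-> B (iter 7 rho);
        23465321 |-> B rho; 23465421 |-> B (sigma \o rho);
        23465431 |-> B (sigma \o iter 4 rho); 23465432 |-> B (iter 4 rho);

        00001000 |-> Y 235678; 00011100 |-> Y 234578;
        01111110 |-> A (iter 3 rho); 11121111 |-> A (iter 5 rho);
        11222111 |-> X 123568; 11232210 |-> Y 124578;
        12233210 |-> A (iter 6 rho); 12243211 |-> A (iter 2 rho);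
        12343221 |-> X 134568; 22343321 |-> Y 124567; 22344321 |-> A rho;
        12354321 |-> A (iter 7 rho); 13354321 |-> X 134678;
        23354321 |-> Y 123467; 22454321 |-> A (iter 4 rho);

        00000100 |-> X 123457; 00001110 |-> Y 245678; 00011111 |-> Y 234568;
        01111111 |-> X 123468; 11121110 |-> Y 124678; 11222100 |-> X 123578;
        11232100 |-> Y 123578; 12232110 |-> X 134567; 12232211 |-> Y 134567;
        11233221 |-> X 234568; 11233321 |-> X 245678; 12233321 |-> X 124678;
        12243221 |-> Y 123468; 12343211 |-> X 135678; 22343210 |-> Y 123457;

        00000010 |-> Y 145678; 00000111 |-> X 123456; 00001111 |-> D 268;
        00011110 |-> D 248; 01111100 |-> X 123478; 11121000 |-> Y 123678;
        11221000 |-> D 135; 11221100 |-> D 157; 11122110 |-> X 234567;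
        01122211 |-> X 345678; 01122221 |-> D 468; 11122221 |-> D 246;
        11222211 |-> X 125678; 11232110 |-> Y 123458; 12232100 |-> D 137;

        00000001 |-> D 356; 00000011 |-> D 168; 00000110 |-> D 124;
        00001100 |-> D 278; 00011000 |-> D 238; 01110000 |-> D 134;
        11110000 |-> D 167; 10111000 |-> D 235; 00111100 |-> D 578;
        01011110 |-> D 467; 01011111 |-> D 346; 00111111 |-> D 568;
        10111110 |-> D 245; 11111100 |-> D 127; 01121000 |-> D 138].

End TableE8.

(* Main.v *)
From Stdlib Require Import ZArith FMapPositive MSetPositive Ring_polynom.
From HB Require Import structures.
Require Import Defs.
From mathcomp Require Import all_boot all_order all_algebra all_fingroup.
From mathcomp Require Import ring_quotient fraction boolp.
From mathcomp Require Import reals complex ssrZ zify ring.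
From mathcomp.multinomials Require Import mpoly.

Set Implicit Arguments.
Unset Strict Implicit.
Unset Printing Implicit Defensive.

Import Order.TTheory GRing.Theory Num.Theory.

Local Open Scope ring_scope.
Local Open Scope quotient_scope.
Delimit Scope Z_scope with ZZ.

(** In each of the three cases the exchange relations form a finite list: there
    are 16, 42 and 128 cluster variables, and an exchange relation says that a
    product of two of them is a sum of two monomials in cluster variables and
    boundary minors.  The proof produces this list, an atlas, as a table of
    integers, shows that it is closed under mutation, and reads every part of
    the theorem off it.

    The atlas is found numerically.  On the vertices of a convex polygon with
    integer coordinates the functions of the table take distinct non-zero
    values, up to sign, so the value of a function is its name: mutating labels
    and columns along a walk in the exchange graph, and identifying each new
    variable by its value, produces relations, and rotating the polygon produces
    the others.  Only the result of this search is verified, by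
    evaluation.

    Closure under mutation.  A seed is described by one label for each mutable
    variable and one column of the atlas for each label ([represents],
    [coherent]).  Two labels may be compatible or not; a mutation replaces a
    label by one compatible with all the others, and it must turn columns of the
    atlas into columns of the atlas.  Since this concerns only pairs of columns,
    a finite check on pairs of relations ([check_pairs]) replaces an enumeration
    of the 25080 clusters of type E8, and every seed that can be reached is
    coherent ([mutation_equivalent_valid]).  Hence all cluster variables are in
    the table, and they all occur because the walk meets all labels.

    The relations themselves are polynomial identities between 3 x 3 minors.  It
    is enough to prove them on a chart of the space of matrices with at
    most eight columns, where the minors are polynomials with few terms
    ([plucker_identity]).

    The initial seed is a transcendence basis: its minors are algebraically
    independent because they can be given arbitrary non-zero values
    ([interpolation6], [interpolation7], [interpolation8]), and they generate
    the field because all minors are reached from them by mutation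
    ([initial_generating]).

    Denominators.  The exponent of x_i in a denominator is the opposite of an
    order of vanishing along x_i = 0.  All functions are quotients of polynomials
    that are positive at a suitable point of the wall x_i = 0, up to a power of
    x_i ([has_order]); for such functions the order of a sum is exactly the
    minimum of the orders.  An exchange relation therefore determines the order
    of a variable from those of simpler ones, as in the tropical form of the
    relation.  That the functions are Laurent polynomials follows separately
    ([label_graded]): a relation whose other variable belongs to the Dynkin
    cluster exhibits one directly, and otherwise the function is a polynomial in
    simpler minors.  Distinct roots give distinct orders, so the map is
    injective ([table_injective]).

    The almost positive roots are recognized by the fact that the strings of the
    table and their opposites are closed under simple reflections, and that each
    string descends to a simple root by reflections ([almost_positiveP]). *)

HB.instance Definition _ := hasDecEq.Build positive Pos.eqb_spec.

(** * Expressions in the Plucker coordinates *)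

(** Expressions stay formal because the same term is read in several ways: as
    a function on the Grassmannian, as a polynomial on a chart and as an
    integer. *)
Inductive expr :=
  | EOne
  | EPl of nat & nat & nat
  | EOpp of expr
  | ESub of expr & expr
  | EAdd of expr & expr
  | EMul of expr & expr.

Section Interpretation.
Variables (T : Type) (one : T) (opp : T -> T) (sub add mul : T -> T -> T).
Variable d : nat -> nat -> nat -> T.

Fixpoint interp (e : expr) : T :=
  match e with
  | EOne => one
  | EPl a b c => d a b c
  | EOpp e => opp (interp e)
  | ESub e f => sub (interp e) (interp f)
  | EAdd e f => add (interp e) (interp f)
  | EMul e f => mul (interp e) (interp f)
  end.

End Interpretation.

Section Symbols.
Variable g : nat -> nat.
Local Notation d a b c := (EPl (g a%N) (g b%N) (g c%N)).

Definition X_expr := ESub (EMul (d 1 3 4) (d 2 5 6)) (EMul (d 1 5 6) (d 2 3 4)).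
Definition Y_expr := ESub (EMul (d 1 4 5) (d 2 3 6)) (EMul (d 1 2 3) (d 4 5 6)).
Definition A_expr :=
  ESub (EMul (d 1 3 4)
          (ESub (EMul (d 2 5 8) (d 1 6 7)) (EMul (d 6 7 8) (d 1 2 5))))
       (EMul (EMul (d 1 5 8) (d 2 3 4)) (d 1 6 7)).
Definition B_expr :=
  ESub (EMul (EMul (d 2 5 8) (d 1 3 4)) (d 2 6 7))
       (EMul (d 2 3 4)
          (EAdd (EMul (d 1 2 8) (d 5 6 7)) (EMul (d 2 5 8) (d 1 6 7)))).

End Symbols.

Definition digit (u : seq nat) (r : nat) : nat := nth 0%N u r.-1.
Definition D_expr (u : seq nat) : expr := EPl (digit u 1) (digit u 2) (digit u 3).

Section SymbolicTables.
Local Open Scope table_scope.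
Local Notation D u := (D_expr (digits u)).
Local Notation X u := (X_expr (digit (digits u))).
Local Notation Y u := (Y_expr (digit (digits u))).
Local Notation A := A_expr.
Local Notation B := B_expr.

Definition negs_D4 : seq expr :=
  [:: D 145; Y 123456; D 136; D 235].

Definition poss_D4 : seq (seq nat * expr) :=
    [:: 1000 |-> D 236; 1100 |-> D 356; 0111 |-> D 124;
        0100 |-> D 135; 1111 |-> D 246; 1211 |-> X 123456;
        0010 |-> D 245; 0110 |-> D 125; 1101 |-> D 346;
        0001 |-> D 146; 0101 |-> D 134; 1110 |-> D 256].

Definition negs_E6 : seq expr :=
  [:: D 237; D 147; Y 123567; Y 124567; D 246; D 346].

Definition poss_E6 : seq (seq nat * expr) :=
    [:: 100000 |-> D 156; 101000 |-> D 124; 001100 |-> D 467;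
        010110 |-> D 356; 010111 |-> D 235; 001111 |-> D 457;
        101110 |-> D 134; 111100 |-> D 126; 011100 |-> D 267;
        000110 |-> D 137; 000011 |-> D 157; 000001 |-> D 245;

        001000 |-> D 247; 101100 |-> D 146; 111110 |-> X 123456;
        011211 |-> X 234567; 011221 |-> D 357; 111221 |-> D 135;
        112211 |-> X 124567; 112210 |-> X 123467; 111210 |-> D 136;
        011111 |-> D 257; 000111 |-> Y 123457; 000010 |-> Y 134567;

        010000 |-> D 256; 010100 |-> D 236; 001110 |-> D 347;
        101111 |-> D 145; 111111 |-> D 125; 011210 |-> D 367;

        000100 |-> Y 123467; 011110 |-> Y 234567; 111211 |-> Y 123456;
        112221 |-> X 123457; 112321 |-> X 134567; 122321 |-> X 123567].

Definition negs_E8 : seq expr :=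
  [:: D 348; D 258; Y 234678; B id; A id; Y 135678; D 357; D 457].

Definition poss_E8 : seq (seq nat * expr) :=
    [:: 10000000 |-> D 267; 10100000 |-> D 125; 00110000 |-> D 158;
        01011000 |-> D 367; 01011100 |-> D 347; 00111110 |-> D 458;
        10111111 |-> D 256; 11111111 |-> D 126; 01121110 |-> D 148;
        01122100 |-> D 378; 11122100 |-> D 237; 11221110 |-> D 145;
        11221111 |-> D 156; 11122111 |-> D 236; 01122210 |-> D 478;

        01000000 |-> X 123467; 01010000 |-> Y 134678; 00111000 |-> D 358;
        10111100 |-> D 257; 11111110 |-> X 124567; 01121111 |-> Y 134568;
        01122111 |-> D 368; 11122210 |-> D 247; 11222210 |-> X 124578;
        11232111 |-> Y 123568; 12232111 |-> D 136; 12232210 |-> D 147;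
        11233210 |-> X 234578; 11233211 |-> X 235678; 12232221 |-> D 146;

        00100000 |-> X 123458; 10110000 |-> Y 125678; 11111000 |-> X 123567;
        01121100 |-> Y 134578; 01122110 |-> Y 345678; 11122211 |-> Y 234567;
        11222221 |-> X 124568; 11232221 |-> Y 124568; 12233211 |-> X 123678;
        12243210 |-> Y 123478; 12343210 |-> X 134578; 22343211 |-> Y 123567;
        22343221 |-> Y 123456; 12343321 |-> X 145678; 12244321 |-> X 234678;

        00010000 |-> B sigma; 01111000 |-> B (sigma \o iter 5 rho);
        11121100 |-> B (iter 5 rho); 11222110 |-> B (iter 3 rho);
        11232211 |-> B (sigma \o iter 3 rho);
        12233221 |-> B (sigma \o iter 2 rho); 12243321 |-> B (iter 2 rho);
        12344321 |-> B (iter 6 rho); 22354321 |-> B (sigma \o iter 6 rho);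
        23454321 |-> B (sigma \o iter 7 rho); 23464321 |-> B (iter 7 rho);
        23465321 |-> B rho; 23465421 |-> B (sigma \o rho);
        23465431 |-> B (sigma \o iter 4 rho); 23465432 |-> B (iter 4 rho);

        00001000 |-> Y 235678; 00011100 |-> Y 234578;
        01111110 |-> A (iter 3 rho); 11121111 |-> A (iter 5 rho);
        11222111 |-> X 123568; 11232210 |-> Y 124578;
        12233210 |-> A (iter 6 rho); 12243211 |-> A (iter 2 rho);
        12343221 |-> X 134568; 22343321 |-> Y 124567; 22344321 |-> A rho;
        12354321 |-> A (iter 7 rho); 13354321 |-> X 134678;
        23354321 |-> Y 123467; 22454321 |-> A (iter 4 rho);

        00000100 |-> X 123457; 00001110 |-> Y 245678; 00011111 |-> Y 234568;
        01111111 |-> X 123468; 11121110 |-> Y 124678; 11222100 |-> X 123578;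
        11232100 |-> Y 123578; 12232110 |-> X 134567; 12232211 |-> Y 134567;
        11233221 |-> X 234568; 11233321 |-> X 245678; 12233321 |-> X 124678;
        12243221 |-> Y 123468; 12343211 |-> X 135678; 22343210 |-> Y 123457;

        00000010 |-> Y 145678; 00000111 |-> X 123456; 00001111 |-> D 268;
        00011110 |-> D 248; 01111100 |-> X 123478; 11121000 |-> Y 123678;
        11221000 |-> D 135; 11221100 |-> D 157; 11122110 |-> X 234567;
        01122211 |-> X 345678; 01122221 |-> D 468; 11122221 |-> D 246;
        11222211 |-> X 125678; 11232110 |-> Y 123458; 12232100 |-> D 137;

        00000001 |-> D 356; 00000011 |-> D 168; 00000110 |-> D 124;
        00001100 |-> D 278; 00011000 |-> D 238; 01110000 |-> D 134;
        11110000 |-> D 167; 10111000 |-> D 235; 00111100 |-> D 578;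
        01011110 |-> D 467; 01011111 |-> D 346; 00111111 |-> D 568;
        10111110 |-> D 245; 11111100 |-> D 127; 01121000 |-> D 138].

End SymbolicTables.

(** * Columns of exchange matrices *)

Definition label := positive.
(** The non-zero entries of a column of an exchange matrix, in increasing order
    of the labels of their rows. *)
Definition column := seq (label * Z).

Fixpoint coef (l : label) (c : column) : Z :=
  if c is (l', e) :: c' then
    if Pos.eqb l l' then Z.add e (coef l c') else coef l c'
  else 0%ZZ.

Fixpoint add_column (c : column) : column -> column :=
  if c is (l, e) :: c1 then
    fix merge (d : column) : column :=
      if d is (l', e') :: d1 then
        match Pos.compare l l' with
        | Lt => (l, e) :: add_column c1 d
        | Gt => (l', e') :: merge d1
        | Eq => if Z.eqb (Z.add e e') 0 then add_column c1 d1
                else (l, Z.add e e') :: add_column c1 d1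
        end
      else c
  else fun d => d.

Definition opp_column (c : column) : column := [seq (x.1, Z.opp x.2) | x <- c].

(** Half of |e| b + e |b|, without a division. *)
Definition mutated_entry (e b : Z) : Z :=
  if Z.ltb 0 b then (if Z.ltb 0 e then Z.mul e b else 0%ZZ)
  else (if Z.ltb e 0 then Z.opp (Z.mul e b) else 0%ZZ).

Definition scaled_column (b : Z) (c : column) : column :=
  [seq x <- [seq (x.1, mutated_entry x.2 b) | x <- c] | ~~ Z.eqb x.2 0].

(** What a mutation at z, whose column is cz and whose new variable is w, adds to
    a column with entry b in row z.  The last two terms move that entry, with
    its sign changed, from row z to row w. *)
Definition mutation_increment (z w : label) (cz : column) (b : Z) : column :=
  add_column (scaled_column b cz) (add_column [:: (w, Z.opp b)] [:: (z, Z.opp b)]).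

Definition mutate_column (z w : label) (cz cy : column) : column :=
  let b := coef z cy in
  if Z.eqb b 0 then cy else add_column cy (mutation_increment z w cz b).

Definition eq_column (c d : column) : bool :=
  all2 (fun x y => Pos.eqb x.1 y.1 && Z.eqb x.2 y.2) c d.

(** Only the positive entries contribute; the other monomial of an exchange
    relation is the one of the opposite column. *)
Definition column_monomial (T : Type) (one : T) (mul : T -> T -> T) (val : label -> T)
    (c : column) : T :=
  foldr (fun x acc =>
    if Z.ltb 0 x.2 then Pos.iter (mul (val x.1)) acc (Z.to_pos x.2) else acc) one c.

Definition get (T : Type) (x0 : T) (M : PositiveMap.t T) (l : label) : T :=
  odflt x0 (PositiveMap.find l M).

Definition labels_upto (k : nat) : seq label := [seq Pos.of_succ_nat i | i <- iota 0 k].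

Definition numbered (T : Type) (xs : seq T) : PositiveMap.t T :=
  foldr (fun x M => PositiveMap.add x.1 x.2 M) (PositiveMap.empty T)
    (zip (labels_upto (size xs)) xs).

(** * Polynomials on a chart *)

Definition zpol := Ring_polynom.Pol Z.
Definition padd : zpol -> zpol -> zpol := Ring_polynom.Padd 0%ZZ Z.add Z.eqb.
Definition pmul : zpol -> zpol -> zpol :=
  Ring_polynom.Pmul 0%ZZ 1%ZZ Z.add Z.mul Z.eqb.
Definition popp : zpol -> zpol := Ring_polynom.Popp Z.opp.
Definition psub (p q : zpol) : zpol := padd p (popp q).
Definition pvar (i : positive) : zpol := Ring_polynom.mk_X 0%ZZ 1%ZZ i.
Definition peq : zpol -> zpol -> bool := Ring_polynom.Peq Z.eqb.
Definition pzero : zpol := Ring_polynom.Pc 0%ZZ.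
Definition pone : zpol := Ring_polynom.Pc 1%ZZ.
Arguments padd : simpl never.
Arguments pmul : simpl never.
Arguments popp : simpl never.
Arguments psub : simpl never.
Arguments pvar : simpl never.

(** A chart of the 3 x n matrices up to the left action of the unimodular group:
    columns 1, 2, 3 are a multiple of the first basis vector and the other two
    basis vectors.  Column 4 has independent coordinates, and those of a later
    column are written as multiples of the coordinates of column 4, which keeps
    the minors short. *)
Definition chart_entry (i j : nat) : zpol :=
  let x k := pvar (Pos.of_nat k) in
  match j with
  | 1 => if i == 0 then x 1 else pzero
  | 2 => if i == 1 then pone else pzero
  | 3 => if i == 2 then pone else pzero
  | 4 => x (2 + i)%N
  | _ => let t := pmul (x (2 + i)%N) (x j) in
         if i == 0 then t else pmul t (x (8 + i + 2 * (j - 5))%N)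
  end%N.

Definition chart_minor (a b c : nat) : zpol :=
  let e := chart_entry in
  let minor i k := psub (pmul (e i b) (e k c)) (pmul (e i c) (e k b)) in
  padd (psub (pmul (e 0 a) (minor 1 2)) (pmul (e 1 a) (minor 0 2)))
       (pmul (e 2 a) (minor 0 1)).

Definition pol_of : expr -> zpol := interp pone popp psub padd pmul chart_minor.

(** * Generating the exchange relations *)

(** The first 6, 7 or 8 points are the vertices of a convex polygon.  They are
    generic enough for the functions of each table, and the boundary minors, to
    take values that are distinct up to sign and not zero. *)
Definition octagon : seq (Z * Z) :=
  [:: (0, 0); (-4, -1); (-4, -5); (-1, -19); (6, -14); (7, -13);
      (10, -7); (4, -1)]%ZZ.

(** The polygon is turned by k steps. *)
Definition octagon_minor (n k a b c : nat) : Z :=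
  let p i := nth (0, 0)%ZZ octagon ((i.-1 + k) %% n) in
  let (x1, y1) := p a in let (x2, y2) := p b in let (x3, y3) := p c in
  ((x2 - x1) * (y3 - y1) - (x3 - x1) * (y2 - y1))%ZZ.

Definition value (n k : nat) : expr -> Z :=
  interp 1%ZZ Z.opp Z.sub Z.add Z.mul (octagon_minor n k).

(** Exchange relations have positive signs, so the functions have to be taken
    with the sign that makes them positive on a convex polygon. *)
Definition normalized (n : nat) (e : expr) : expr :=
  if Z.ltb (value n 0 e) 0 then EOpp e else e.

Definition frozen_expr (n j : nat) : expr :=
  let s := sort leq (run n j.+1%:Z 3) in
  EPl (nth 0%N s 0) (nth 0%N s 1) (nth 0%N s 2).

(** For a relation at z: the new variable, the column of z, the mutable labels
    that occur in the relation (z included) and the labels compatible with all of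
    these.  The two sets follow from the column; they are stored because the
    check of pairs of relations consults them for every pair. *)
Record rel := Rel {
  partner : label; col : column; supp : PositiveSet.t; common : PositiveSet.t }.

(** The labels of a seed and the columns of its exchange matrix, position by
    position. *)
Definition state : Type := seq label * seq column.

Definition mutate_state (s : state) (x : nat * label) : state :=
  let z := nth 1%positive s.1 x.1 in
  let c := nth [::] s.2 x.1 in
  (set_nth 1%positive s.1 x.1 x.2,
   set_nth [::] [seq mutate_column z x.2 c d | d <- s.2] x.1 (opp_column c)).

Definition relmap := PositiveMap.t (seq rel).
Definition rawmap := PositiveMap.t (seq (label * column)).
Definition setmap := PositiveMap.t PositiveSet.t.
Definition bucketmap := PositiveMap.t (PositiveMap.t (seq (Z * rel))).

Definition is_mutable (nmut : nat) (l : label) : bool := Pos.leb l (Pos.of_nat nmut).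

Section Generation.
Variables (n nmut : nat).
Variables (values : PositiveMap.t Z) (index rotations : PositiveMap.t label).

(** Values identify labels, up to sign. *)
Definition lookup (v : Z) : label := get 1%positive index (Z.to_pos (Z.abs v)).
Definition rotate (l : label) : label := get 1%positive rotations l.
Definition rotate_column (c : column) : column :=
  foldr (fun x d => add_column [:: (rotate x.1, x.2)] d) [::] c.

Definition find_partner (z : label) (c : column) : label :=
  let v := get 0%ZZ values in
  lookup (Z.div (Z.add (column_monomial 1%ZZ Z.mul v c)
                       (column_monomial 1%ZZ Z.mul v (opp_column c))) (v z)).

Definition grid_label (i j : nat) : label :=
  let s := Iset 3 n i j in
  lookup (octagon_minor n 0 (nth 0%N s 0) (nth 0%N s 1) (nth 0%N s 2)).
Definition grid_column (i j : nat) : column :=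
  let s := if odd (i + j) then (-1)%ZZ else 1%ZZ in
  foldr add_column [::]
    [:: [:: (grid_label i.+1 j, s)]; [:: (grid_label i.-1 j, s)];
        [:: (grid_label i j.+1, Z.opp s)]; [:: (grid_label i j.-1, Z.opp s)]].
Definition initial_state : state :=
  let positions := [seq (i, j) | i <- iota 1 2, j <- iota 1 (n - 3).-1] in
  ([seq grid_label p.1 p.2 | p <- positions],
   [seq grid_column p.1 p.2 | p <- positions]).

(** The positions ps count from 1. *)
Fixpoint label_walk (s : state) (ps : seq nat) : seq (nat * label) :=
  if ps is p :: ps' then
    let x := (p.-1, find_partner (nth 1%positive s.1 p.-1) (nth [::] s.2 p.-1)) in
    x :: label_walk (mutate_state s x) ps'
  else [::].

Definition known (M : rawmap) (z : label) (c : column) : bool :=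
  has (fun x => eq_column x.2 c) (get [::] M z).
Definition insert_relation (M : rawmap) (x : label * label * column) : rawmap :=
  let: (z, w, c) := x in
  PositiveMap.add z ((w, c) :: get [::] M z) M.
Definition rotate_relation (x : label * label * column) :=
  let: (z, w, c) := x in (rotate z, rotate w, rotate_column c).
Definition reverse_relation (x : label * label * column) :=
  let: (z, w, c) := x in (w, z, opp_column c).
(** Relations are added together with their images under rotation, and each one
    together with its reverse, which is the relation for the mutation back. *)
Definition insert_orbit (M : rawmap) (z : label) (c : column) : rawmap :=
  if known M z c then M else
  foldl (fun M r => if known M r.1.1 r.2 then M
                    else insert_relation (insert_relation M r) (reverse_relation r))
    M (traject rotate_relation (z, find_partner z c, c) n).
Definition raw_relations (states : seq state) : rawmap :=
  foldl (fun M (s : state) => foldl (fun M x => insert_orbit M x.1 x.2) M (zip s.1 s.2))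
    (PositiveMap.empty _) states.

Definition insert_pair (M : setmap) (a b : label) : setmap :=
  PositiveMap.add a (PositiveSet.add b (get PositiveSet.empty M a)) M.
Definition insert_pair_orbit (M : setmap) (x : label * label) : setmap :=
  if PositiveSet.mem x.1 (get PositiveSet.empty M x.2) then M else
  foldl (fun M x => insert_pair (insert_pair M x.1 x.2) x.2 x.1) M
    (traject (fun x => (rotate x.1, rotate x.2)) x n).
Definition compatibilities (states : seq state) : setmap :=
  foldl (fun M (s : state) => foldl insert_pair_orbit M [seq (a, b) | a <- s.1, b <- s.1])
    (PositiveMap.empty _) states.

End Generation.

Definition mk_rel (nmut : nat) (compats : setmap) (z : label) (x : label * column) : rel :=
  {| partner := x.1; col := x.2;
     supp := foldr (fun y S => if is_mutable nmut y.1 then PositiveSet.add y.1 S else S)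
               (PositiveSet.singleton z) x.2;
     common := foldr (fun y K => if is_mutable nmut y.1
                 then PositiveSet.inter (get PositiveSet.empty compats y.1) K else K)
               (get PositiveSet.empty compats z) x.2 |}.

(** Files r, a relation at y, under y and each label x of its column, together
    with the entry at x. *)
Definition insert_bucket (nmut : nat) (y : label) (r : rel) (B : bucketmap)
    (x : label * Z) : bucketmap :=
  if is_mutable nmut x.1 then
    let By := get (PositiveMap.empty _) B y in
    PositiveMap.add y (PositiveMap.add x.1 ((x.2, r) :: get [::] By x.1) By) B
  else B.
Definition bucket_relations (nmut : nat) (relations : relmap) : bucketmap :=
  foldl (fun B y => foldl (fun B r => foldl (insert_bucket nmut y r) B (col r))
                      B (get [::] relations y))
    (PositiveMap.empty _) (labels_upto nmut).

(** Labels are numbered from 1: the [nmut] mutable ones come first and the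
    boundary minors follow.  The route is a list of mutations, given by positions
    and new labels, that starts from [origin]. *)
Record atlas := Atlas {
  nmut : nat;
  origin : state;
  route : seq (nat * label);
  compats : setmap;
  relations : relmap;
  buckets : bucketmap }.

Section MkAtlas.
Variables (n : nat) (negs : seq expr) (poss : seq (seq nat * expr)) (walk : seq nat).

Definition mutable_exprs : seq expr := [seq normalized n e | e <- negs ++ map snd poss].
Definition exprs : seq expr := mutable_exprs ++ mkseq (frozen_expr n) n.

Definition mk_atlas : atlas :=
  let es := exprs in
  let nm := (size negs + size poss)%N in
  let values := numbered (map (value n 0) es) in
  let index :=
    foldr (fun x M => PositiveMap.add (Z.to_pos (Z.abs (value n 0 x.2))) x.1 M)
      (PositiveMap.empty label) (zip (labels_upto (size es)) es) in
  let rotations := numbered (map (fun e => lookup index (value n 1 e)) es) in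
  let s0 := initial_state n index in
  let ps := label_walk values index s0 walk in
  let states := s0 :: scanl mutate_state s0 ps in
  let compats := compatibilities n rotations states in
  let relations := PositiveMap.mapi (fun z => map (mk_rel nm compats z))
    (raw_relations n values index rotations states) in
  {| nmut := nm; origin := s0; route := ps; compats := compats; relations := relations;
     buckets := bucket_relations nm relations |}.

End MkAtlas.

(** * Checks *)

Section Checks.
Variable d : atlas.
Local Notation is_mutable := (is_mutable (nmut d)).
Definition compat (l : label) : PositiveSet.t := get PositiveSet.empty (compats d) l.
Definition rels (z : label) : seq rel := get [::] (relations d) z.
Definition bucket (y z : label) : seq (Z * rel) :=
  get [::] (get (PositiveMap.empty _) (buckets d) y) z.
Definition forall_mutable (P : label -> bool) : bool := all P (labels_upto (nmut d)).
Definition forall_rels (P : label -> rel -> bool) : bool :=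
  forall_mutable (fun z => List.forallb (P z) (rels z)).
Definition admissible (z w : label) (c : column) : bool :=
  List.existsb (fun r => Pos.eqb (partner r) w && eq_column (col r) c) (rels z).

Definition check_compat : bool :=
  forall_mutable (fun a => PositiveSet.mem a (compat a) && forall_mutable (fun b =>
    ~~ PositiveSet.mem b (compat a) || PositiveSet.mem a (compat b))).

Definition check_rels : bool :=
  forall_rels (fun z r =>
    let w := partner r in
    [&& is_mutable w, ~~ PositiveSet.mem w (compat z), sorted Pos.ltb (map fst (col r)),
     all (fun x => ~~ Z.eqb x.2 0) (col r),
     admissible w z (opp_column (col r)) &
     PositiveSet.subset (PositiveSet.remove z (common r)) (compat w)]).

(** Each relation at y can be found under each label of its column; this is what
    allows [check_pairs] to range over buckets only. *)
Definition check_buckets : bool :=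
  forall_rels (fun y r => List.forallb (fun x => ~~ is_mutable x.1 ||
    List.existsb (fun q => Z.eqb q.1 x.2 && eq_column (col q.2) (col r)) (bucket y x.1))
    (col r)).

(** Suppose that r at z and q at y = x.1 occur in one seed.  By skew-symmetry the
    entries of the two columns at each other are opposite, and the labels of q
    are compatible with those of r.  For all such pairs, the mutation at z has to
    turn the column of q into a column of the atlas at y. *)
Definition check_pairs : bool :=
  forall_rels (fun z r => List.forallb (fun x => ~~ is_mutable x.1 ||
    let b := Z.opp x.2 in
    let w := partner r in
    let increment := mutation_increment z w (col r) b in
    let images := bucket x.1 w in
    List.forallb (fun q => ~~ Z.eqb q.1 b ||
        ~~ PositiveSet.subset (supp q.2) (common r) ||
        let c := add_column (col q.2) increment in
        List.existsb (fun q => eq_column (col q.2) c) images)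
      (bucket x.1 z)) (col r)).

Fixpoint check_route (s : state) (xs : seq (nat * label)) : bool :=
  if xs is x :: xs' then
    [&& (x.1 < size s.1)%N,
        admissible (nth 1%positive s.1 x.1) x.2 (nth [::] s.2 x.1)
      & check_route (mutate_state s x) xs']
  else true.

(** Indexed by labels: the opposite simple roots, the positive roots, and zero for
    the boundary minors. *)
Definition degree_vectors (m n : nat) (roots : seq (seq nat)) : seq (seq Z) :=
  [seq [seq (if i == j then (-1)%ZZ else 0%ZZ) | j <- iota 0 m] | i <- iota 0 m] ++
  [seq map Z.of_nat s | s <- roots] ++ nseq n (nseq m 0%ZZ).
(** The measure for the induction on denominators; it vanishes exactly on the
    Dynkin cluster and the boundary minors. *)
Definition heights (m n : nat) (roots : seq (seq nat)) : seq nat :=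
  nseq m 0%N ++ map sumn roots ++ nseq n 0%N.

Definition exponent (dv : label -> seq Z) (i : nat) (c : column) : Z :=
  foldr (fun x acc => if Z.ltb 0 x.2
                      then Z.add (Z.mul x.2 (nth 0%ZZ (dv x.1) i)) acc else acc) 0%ZZ c.

Fixpoint minors_among (P : nat -> nat -> nat -> bool) (e : expr) : bool :=
  match e with
  | EOne => true
  | EPl a b c => P a b c
  | EOpp e => minors_among P e
  | ESub e f | EAdd e f | EMul e f => minors_among P e && minors_among P f
  end.

(** A cyclic permutation of three labels does not change the sign of a minor. *)
Definition is_minor (a b c : nat) (e : expr) : bool :=
  if e is EPl x y z then
    [:: x; y; z] \in [:: [:: a; b; c]; [:: b; c; a]; [:: c; a; b]]
  else false.

(** Everything in the relation except l is lower than l, and the exponents of the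
    denominators satisfy the tropical form of the relation: the exponent of a
    sum is the maximum of the two exponents. *)
Definition descends (m last : nat) (dv : label -> seq Z) (ht : label -> nat)
    (l : label) (r : rel) : bool :=
  [&& (ht (partner r) < ht l)%N,
      List.forallb (fun x => Pos.leb x.1 (Pos.of_nat last) && (ht x.1 < ht l)%N) (col r)
    & all (fun i => Z.eqb (Z.add (nth 0%ZZ (dv l) i) (nth 0%ZZ (dv (partner r)) i))
          (Z.max (exponent dv i (col r)) (exponent dv i (opp_column (col r)))))
        (iota 0 m)].

(** A relation that descends gives the exponents.  If its new variable is in the
    Dynkin cluster it also shows that the function is a Laurent polynomial;
    otherwise this has to come from the expression of the function in minors that
    are lower. *)
Definition check_denominators (m n : nat) (roots : seq (seq nat)) (es : seq expr) : bool :=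
  let dv := get [::] (numbered (degree_vectors m n roots)) in
  let ht := get 0%N (numbered (heights m n roots)) in
  let expr_at := get EOne (numbered es) in
  let last := (nmut d + n)%N in
  let all_labels := labels_upto last in
  forall_mutable (fun l =>
    if ht l == 0%N then true else
    if List.existsb (fun r => if (Pos.to_nat (partner r) <= m)%N
                              then descends m last dv ht l r else false) (rels l)
    then true
    else minors_among (fun a b c => has (fun y =>
             (ht y < ht l)%N && is_minor a b c (expr_at y)) all_labels) (expr_at l)
         && List.existsb (descends m last dv ht l) (rels l)).

(** A relation and its reverse state the same identity, so one of them is
    enough. *)
Definition check_identities (es : seq expr) : bool :=
  let pols := numbered (map pol_of es) in
  let pol := get pone pols in
  let monomial := column_monomial pone pmul pol in
  forall_rels (fun z r => Pos.ltb (partner r) z ||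
    peq (pmul (pol z) (pol (partner r)))
        (padd (monomial (col r)) (monomial (opp_column (col r))))).

End Checks.

(** Walks of mutations, by positions, that start at the initial seed, meet all
    cluster variables and, up to rotation and reversal, all exchange relations, and
    end at the Dynkin cluster. *)
Definition walk_D4 : seq nat := digits 243424123411243.
Definition walk_E6 : seq nat := digits 251535123425153236513453146323421362514126163456412356641.
Definition walk_E8 : seq nat := digits 263646148153678342712618341828681765378673127313615631368562736756245715878416248513187251467518565836753743863486171262127826125625276285358158652823656868312858372481751367181286145186253878618235137251487378636147658763467473481617137687317312631561887253617637364867856235442683567252472567284367367678574568622834153748138683521185628375643183.

(** * Polynomial functions on matrices *)

Section MpolyInd.
Variables (d : nat) (R : comNzRingType) (P : {mpoly R[d]} -> Prop).
Hypotheses (PC : forall c, P c%:MP) (PX : forall i, P 'X_i).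
Hypotheses (PD : forall p q, P p -> P q -> P (p + q)).
Hypotheses (PM : forall p q, P p -> P q -> P (p * q)).

(** Ring morphisms out of a polynomial ring are compared on constants and
    variables. *)
Lemma mpoly_subring_ind p : P p.
Proof.
elim/mpolyind: p => [|c m p _ _ Pp]; first by rewrite -mpolyC0; apply: PC.
apply: PD => //; rewrite -mul_mpolyC; apply: PM => //.
rewrite mpolyXE_id; elim/big_ind: _ => // [|i _]; first by rewrite -mpolyC1.
elim: (m i) => [|k IH]; first by rewrite expr0 -mpolyC1.
by rewrite exprS; apply: PM.
Qed.
End MpolyInd.

Section CoordFun.
Variables (C : numFieldType) (k n : nat).
Local Notation coord := (@coord_fun C k n).

Lemma coord_fun_is_zmod_morphism : zmod_morphism coord.
Proof. by move=> p q; rewrite /coord_fun -tofracB -raddfB. Qed.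
HB.instance Definition _ :=
  GRing.isZmodMorphism.Build _ _ coord coord_fun_is_zmod_morphism.

Lemma coord_fun_is_monoid_morphism : monoid_morphism coord.
Proof.
split; first by rewrite /coord_fun rmorph1 tofrac1.
by move=> p q; rewrite /coord_fun -tofracM -rmorphM.
Qed.
HB.instance Definition _ :=
  GRing.isMonoidMorphism.Build _ _ coord coord_fun_is_monoid_morphism.

Lemma const_fun_is_zmod_morphism : zmod_morphism (@const_fun C k n).
Proof. by move=> a b; rewrite /const_fun !rmorphB. Qed.
HB.instance Definition _ :=
  GRing.isZmodMorphism.Build _ _ (@const_fun C k n) const_fun_is_zmod_morphism.

Lemma const_fun_is_monoid_morphism : monoid_morphism (@const_fun C k n).
Proof.
by split=> [|a b]; rewrite /const_fun ?rmorph1 // !rmorphM.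
Qed.
HB.instance Definition _ :=
  GRing.isMonoidMorphism.Build _ _ (@const_fun C k n) const_fun_is_monoid_morphism.

Definition at_matrix (v : 'M[C]_(k, n)) (p : pluckerPoly C k n) : C :=
  p.@[fun i => \det (colsub (kelt (enum_val i : ksubset k n)) v)].

HB.instance Definition _ v := GRing.RMorphism.copy (at_matrix v) (at_matrix v).

Lemma coord_fun_eq0P p : reflect (forall v, at_matrix v p = 0) (coord p == 0).
Proof.
rewrite /coord_fun tofrac_eq0 -[X in _ == X](raddf0 \pi_(coordRing C k n)).
rewrite -Quotient.idealrBE subr0.
exact: vanishingP.
Qed.

End CoordFun.

Section Delta.
Variables (C : numFieldType) (k n : nat).
Implicit Types (K : ksubset k n) (v : 'M[C]_(k, n)) (f : 'I_k -> 'I_n).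

Lemma kelt_inj K : injective (kelt K).
Proof. by move=> i j /enum_val_inj/cast_ord_inj. Qed.

Lemma kelt_in K j : kelt K j \in val K.
Proof. exact: enum_valP. Qed.

Lemma kelt_onto K x : x \in val K -> exists j, kelt K j = x.
Proof.
move=> Kx; exists (cast_ord (eqP (valP K)) (enum_rank_in Kx x)).
by rewrite /kelt cast_ordK enum_rankK_in.
Qed.

Definition delta_poly (a : seq nat) : pluckerPoly C k n :=
  \sum_K \sum_(s : 'S_k | [forall j : 'I_k, nth 0%N a j == (kelt K (s j)).+1])
    (-1) ^+ s * 'X_(enum_rank K).

Lemma coord_fun_delta_poly a : coord_fun (delta_poly a) = Delta C k n a.
Proof.
rewrite rmorph_sum; apply: eq_bigr => K _; rewrite rmorph_sum /=.
by apply: eq_bigr => s _; rewrite rmorphM /= rmorphXn rmorphN1.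
Qed.

(** If the columns f j are distinct, exactly one subset K and one permutation s
    contribute, and the sign is the one that sorts the columns.  Otherwise both
    sides vanish. *)
Lemma at_matrix_delta_poly v a f : (forall j : 'I_k, nth 0%N a j = (f j).+1) ->
  at_matrix v (delta_poly a) = \det (colsub f v).
Proof.
move=> fa; rewrite rmorph_sum /=.
pose sorts K (s : 'S_k) := [forall j, f j == kelt K (s j)].
have term K : at_matrix v (\sum_(s : 'S_k | [forall j : 'I_k,
      nth 0%N a j == (kelt K (s j)).+1]) (-1) ^+ s * 'X_(enum_rank K))
    = \sum_(s | sorts K s) \det (colsub f v).
  rewrite rmorph_sum; apply: eq_big => [s | s sP].
    by rewrite /sorts; apply: eq_forallb => j; rewrite fa eqSS.
  rewrite rmorphM rmorphXn rmorphN1 /= /at_matrix mevalXU enum_rankK.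
  have ->: colsub f v = col_perm s (colsub (kelt K) v).
    apply/matrixP => i j; rewrite !mxE; congr (v _ _).
    by have /forallP/(_ j)/eqP := sP; rewrite fa => -[] /val_inj.
  by rewrite col_permE det_mulmx det_perm odd_permV mulrC.
under eq_bigr do rewrite term.
case: (boolP (injectiveb f)) => [/injectiveP f_inj | /injectivePn[i [j ij fij]]];
  last first.
  suff ->: \det (colsub f v) = 0 by rewrite big1 // => K _; rewrite big1.
  rewrite -det_tr; apply: (determinant_alternate ij) => l.
  by rewrite !mxE fij.
(* K0 is the image of f, and the permutation is the one that sorts f. *)
have K0P : #|[set f j | j : 'I_k]| == k by rewrite card_imset // card_ord.
pose K0 : ksubset k n :=
  exist (fun K : {set 'I_n} => #|K| == k) _ K0P.
have f_onto j : exists i, kelt K0 i == f j.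
  have [|i <-] := @kelt_onto K0 (f j); first exact: imset_f.
  by exists i.
have s0_inj : injective (fun j => xchoose (f_onto j)).
  move=> i j eq_ij; apply: f_inj.
  by rewrite -(eqP (xchooseP (f_onto i))) eq_ij (eqP (xchooseP (f_onto j))).
have sortsE K s : sorts K s = (K == K0) && (s == perm s0_inj).
  apply/forallP/andP => [fK | [/eqP-> /eqP->] j]; last first.
    by rewrite permE eq_sym (xchooseP (f_onto j)).
  have KK0: K = K0.
    apply/val_inj/setP => x /=; apply/idP/imsetP => [/kelt_onto[i <-] | [i _ ->]].
      by exists (s^-1 i)%g => //; rewrite (eqP (fK _)) permKV.
    by rewrite (eqP (fK i)) kelt_in.
  split; apply/eqP => //; apply/permP => j; rewrite permE.
  by apply: (@kelt_inj K0); rewrite (eqP (xchooseP (f_onto j))) -KK0 (eqP (fK j)).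
rewrite (bigD1 K0) //= [X in _ + X]big1 ?addr0 => [|K KK0]; last first.
  by rewrite big1 // => s; rewrite sortsE (negPf KK0).
by rewrite (big_pred1 (perm s0_inj)) // => s; rewrite sortsE eqxx.
Qed.

End Delta.

(** * Expressions as functions on the Grassmannian *)

Section PluckerInterpretation.
Variables (C : numFieldType) (n : nat).

Definition plucker_poly : expr -> pluckerPoly C 3 n :=
  interp 1 -%R (fun x y => x - y) +%R *%R (fun a b c => delta_poly C 3 n [:: a; b; c]).

Definition plucker_fun : expr -> fracRing C 3 n :=
  interp 1 -%R (fun x y => x - y) +%R *%R (fun a b c => Delta C 3 n [:: a; b; c]).

Lemma coord_fun_plucker_poly e : coord_fun (plucker_poly e) = plucker_fun e.
Proof.
elim: e => [|a b c|e IH|e IHe f IHf|e IHe f IHf|e IHe f IHf] /=.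
- exact: rmorph1.
- exact: coord_fun_delta_poly.
- by rewrite rmorphN /= IH.
- by rewrite rmorphB /= IHe IHf.
- by rewrite rmorphD /= IHe IHf.
- by rewrite rmorphM /= IHe IHf.
Qed.

Lemma plucker_funM e f : plucker_fun (EMul e f) = plucker_fun e * plucker_fun f.
Proof. by []. Qed.
Lemma plucker_funB e f : plucker_fun (ESub e f) = plucker_fun e - plucker_fun f.
Proof. by []. Qed.
Lemma plucker_funD e f : plucker_fun (EAdd e f) = plucker_fun e + plucker_fun f.
Proof. by []. Qed.
Lemma plucker_funN e : plucker_fun (EOpp e) = - plucker_fun e.
Proof. by []. Qed.

Implicit Types v : 'M[C]_(3, n).

Definition entry v (i a : nat) : C := \sum_(j < n | j.+1 == a) v (inord i) j.

Definition det3 (T : pzRingType) (u : nat -> nat -> T) (a b c : nat) : T :=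
  let minor i k := u i b * u k c - u i c * u k b in
  u 0%N a * minor 1%N 2%N - u 1%N a * minor 0%N 2%N + u 2%N a * minor 0%N 1%N.

Fixpoint well_labelled (e : expr) : bool :=
  match e with
  | EOne => true
  | EPl a b c => [&& 0 < a <= n, 0 < b <= n & 0 < c <= n]%N
  | EOpp e => well_labelled e
  | ESub e f | EAdd e f | EMul e f => well_labelled e && well_labelled f
  end.

Lemma at_matrix_delta3 v a b c :
  (0 < a <= n)%N -> (0 < b <= n)%N -> (0 < c <= n)%N ->
  at_matrix v (delta_poly C 3 n [:: a; b; c]) = det3 (entry v) a b c.
Proof.
move=> ha hb hc.
have lt x : (0 < x <= n)%N -> (x.-1 < n)%N by case: x.
pose f (j : 'I_3) : 'I_n := tnth [tuple Ordinal (lt a ha); Ordinal (lt b hb); Ordinal (lt c hc)] j.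
have fE (j : 'I_3) : nth 0%N [:: a; b; c] j = (f j).+1.
  case: j => -[|[|[|//]]] i; rewrite /f (tnth_nth (Ordinal (lt a ha))) /= prednK //.
  - by have /andP[] := ha.
  - by have /andP[] := hb.
  - by have /andP[] := hc.
rewrite (at_matrix_delta_poly v fE).
have eE i x (hx : (0 < x <= n)%N) : entry v i x = v (inord i) (Ordinal (lt x hx)).
  rewrite /entry (big_pred1 (Ordinal (lt x hx))) // => j.
  apply/eqP/eqP => [jx | ->]; first by apply: val_inj; rewrite /= -jx.
  by rewrite /= prednK //; have /andP[] := hx.
rewrite (expand_det_row _ 0) !big_ord_recl big_ord0 /cofactor.
rewrite !(expand_det_row _ 0) !big_ord_recl !big_ord0 /cofactor !det_mx11 !mxE /=.
rewrite /det3 !eE /f !(tnth_nth (Ordinal (lt a ha))) /=.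
have -> : inord 0 = 0 :> 'I_3 by apply: val_inj; rewrite /= inordK.
have -> : inord 1 = lift 0 0 :> 'I_3 by apply: val_inj; rewrite /= inordK.
have -> : inord 2 = lift 0 (lift 0 0) :> 'I_3 by apply: val_inj; rewrite /= inordK.
by rewrite /bump /= !addn0; ring.
Qed.

Lemma at_matrix_plucker_poly v e : well_labelled e ->
  at_matrix v (plucker_poly e) =
  interp 1 -%R (fun x y => x - y) +%R *%R (det3 (entry v)) e.
Proof.
elim: e => [|a b c|e IH|e IHe f IHf|e IHe f IHf|e IHe f IHf] /=.
- by rewrite rmorph1.
- by case/and3P; apply: at_matrix_delta3.
- by move=> /IH <-; rewrite rmorphN.
- by move=> /andP[/IHe <- /IHf <-]; rewrite rmorphB.
- by move=> /andP[/IHe <- /IHf <-]; rewrite rmorphD.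
- by move=> /andP[/IHe <- /IHf <-]; rewrite rmorphM.
Qed.

Lemma plucker_fun_eq0P e : well_labelled e ->
  reflect (forall v, interp 1 -%R (fun x y => x - y) +%R *%R (det3 (entry v)) e = 0)
          (plucker_fun e == 0).
Proof.
move=> we; rewrite -coord_fun_plucker_poly.
by apply: (iffP (coord_fun_eq0P _)) => h v;
  move: (h v); rewrite at_matrix_plucker_poly.
Qed.

(** The points of the moment curve are in general position. *)
Lemma minor_neq0 a b c :
  (0 < a <= n)%N -> (0 < b <= n)%N -> (0 < c <= n)%N -> uniq [:: a; b; c] ->
  plucker_fun (EPl a b c) != 0.
Proof.
move=> ha hb hc abc.
apply/plucker_fun_eq0P; first by rewrite /= ha hb hc.
move/(_ (\matrix_(i, j) j.+1%:R ^+ i)) => /=.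
have eE i x : (i < 3)%N -> (0 < x <= n)%N ->
    entry (\matrix_(i < 3, j < n) j.+1%:R ^+ i) i x = x%:R ^+ i.
  case: x => // x i3 xn; rewrite /entry (big_pred1 (Ordinal xn)) ?mxE ?inordK //.
rewrite /det3 !eE // => /eqP; apply/negP.
have -> : a%:R ^+ 0 * (b%:R ^+ 1 * c%:R ^+ 2 - c%:R ^+ 1 * b%:R ^+ 2) -
  a%:R ^+ 1 * (b%:R ^+ 0 * c%:R ^+ 2 - c%:R ^+ 0 * b%:R ^+ 2) +
  a%:R ^+ 2 * (b%:R ^+ 0 * c%:R ^+ 1 - c%:R ^+ 0 * b%:R ^+ 1)
  = (b%:R - a%:R) * (c%:R - a%:R) * (c%:R - b%:R) :> C by ring.
move: abc; rewrite /= !inE negb_or !andbT => /andP[/andP[ab ac] bc].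
by rewrite !mulf_neq0 // subr_eq0 eqr_nat eq_sym.
Qed.
End PluckerInterpretation.

(** * Polynomial identities between minors *)

Section Polynomials.
Variable C : numFieldType.

Definition scalar (z : Z) : C := (int_of_Z z)%:~R.

(** Polynomials with integer coefficients in Horner form, evaluated in C. *)
Definition zpol_eval (l : seq C) : zpol -> C :=
  Pphi 0 (fun x y => x + y) (fun x y => x * y) scalar l.

Arguments zpol_eval : simpl never.

Lemma field_almost_ring : almost_ring_theory (0 : C) 1 (fun x y => x + y)
  (fun x y => x * y) (fun x y => x - y) (fun x => - x) eq.
Proof. by split=> *; ring. Qed.

Lemma scalar_morph : ring_morph (0 : C) 1 (fun x y => x + y)
  (fun x y => x * y) (fun x y => x - y) (fun x => - x) eq
  0%ZZ 1%ZZ Z.add Z.mul Z.sub Z.opp Z.eqb scalar.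
Proof.
have ext x y : Z.sub x y = x - y by [].
split=> // [x y|x y|x y|x|x y /Z.eqb_eq -> //]; rewrite /scalar.
- by rewrite -[Z.add x y]/(x + y) !rmorphD.
- by rewrite -[Z.sub x y]/(x - y) !rmorphB.
- by rewrite -[Z.mul x y]/(x * y) !rmorphM.
- by rewrite -[Z.opp x]/(- x) !rmorphN.
Qed.

Let ext : ring_eq_ext (fun x y : C => x + y) (fun x y => x * y) (fun x => - x) eq.
Proof. by split=> [x y -> ? ? ->|x y -> ? ? ->|x y ->]. Qed.
Let equiv : RelationClasses.Equivalence (@eq C).
Proof. by split=> // x y z -> ->. Qed.

Lemma zpol_evalD l p q : zpol_eval l (padd p q) = zpol_eval l p + zpol_eval l q.
Proof. exact: (Padd_ok equiv ext field_almost_ring scalar_morph). Qed.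
Lemma zpol_evalM l p q : zpol_eval l (pmul p q) = zpol_eval l p * zpol_eval l q.
Proof. exact: (Pmul_ok equiv ext field_almost_ring scalar_morph). Qed.
Lemma zpol_evalN l p : zpol_eval l (popp p) = - zpol_eval l p.
Proof. exact: (Popp_ok equiv ext field_almost_ring scalar_morph). Qed.
Lemma zpol_evalB l p q : zpol_eval l (psub p q) = zpol_eval l p - zpol_eval l q.
Proof. by rewrite zpol_evalD zpol_evalN. Qed.
Lemma zpol_eval_var l i : zpol_eval l (pvar i) = BinList.nth 0 i l.
Proof. exact: esym (mkX_ok equiv ext field_almost_ring scalar_morph i l). Qed.
Lemma zpol_eval0 l : zpol_eval l pzero = 0. Proof. by []. Qed.
Lemma zpol_eval1 l : zpol_eval l pone = 1. Proof. by []. Qed.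
Lemma zpol_eval_eq l p q : peq p q -> zpol_eval l p = zpol_eval l q.
Proof. by move=> pq; apply: (Peq_ok equiv ext scalar_morph). Qed.

Definition zpol_evalE := (zpol_evalB, zpol_evalD, zpol_evalM, zpol_evalN,
  zpol_eval_var, zpol_eval0, zpol_eval1).

Lemma zpol_eval_chart_minor l a b c : zpol_eval l (chart_minor a b c) =
  det3 (fun i j => zpol_eval l (chart_entry i j)) a b c.
Proof. by rewrite /chart_minor !zpol_evalE. Qed.

Lemma zpol_eval_pol_of l e : zpol_eval l (pol_of e) =
  interp 1 -%R (fun x y => x - y) +%R *%R
    (det3 (fun i j => zpol_eval l (chart_entry i j))) e.
Proof.
elim: e => [|a b c|e IH|e IHe f IHf|e IHe f IHf|e IHe f IHf] /=;
  rewrite ?zpol_eval1 ?zpol_eval_chart_minor // ?zpol_evalE ?IH ?IHe ?IHf //.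
Qed.

Lemma det3_mul (g u : nat -> nat -> C) a b c :
  det3 (fun i j => g i 0%N * u 0%N j + g i 1%N * u 1%N j + g i 2%N * u 2%N j) a b c
  = det3 g 0 1 2 * det3 u a b c.
Proof. by rewrite /det3; ring. Qed.

(** In the basis of columns 1, 2, 3 of a matrix, scaled to have determinant 1,
    the coordinates of the other columns are quotients of minors.  The chart
    further divides by coordinates of column 4 and by the first coordinate of the
    later columns, whence the minors that must not vanish. *)
Lemma chart_exists n (u : nat -> nat -> C) : (n <= 8)%N ->
  det3 u 1 2 3 != 0 -> det3 u 1 4 3 != 0 -> det3 u 1 2 4 != 0 ->
  (forall j, (3 < j <= n)%N -> det3 u j 2 3 != 0) -> (3 < n)%N ->
  exists l : seq C, forall a b c,
    (0 < a <= n)%N -> (0 < b <= n)%N -> (0 < c <= n)%N ->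
    det3 u a b c = det3 (fun i j => zpol_eval l (chart_entry i j)) a b c.
Proof.
move=> n8 h123 h143 h124 h3 n4.
pose D := det3 u 1 2 3.
pose w i j := if i == 0%N then det3 u j 2 3
              else if i == 1%N then det3 u 1 j 3 / D else det3 u 1 2 j / D.
pose x j := w 0%N j / w 0%N 4.
pose y i j := w i j / (w i 4 * x j).
pose l := [:: D; w 0%N 4; w 1%N 4; w 2%N 4; x 5%N; x 6%N; x 7%N; x 8%N;
  y 1%N 5%N; y 2%N 5%N; y 1%N 6%N; y 2%N 6%N; y 1%N 7%N; y 2%N 7%N; y 1%N 8%N; y 2%N 8%N].
pose g i j := if j == 0%N then u i 1%N / D
              else if j == 1%N then u i 2%N else u i 3%N.
have D0 : D != 0 by [].
have w4 : w 1%N 4 != 0 /\ w 2%N 4 != 0.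
  by rewrite /w !mulf_neq0 ?invr_neq0.
exists l => a b c ha hb hc.
have wE i j : (i < 3)%N -> (0 < j <= n)%N ->
    zpol_eval l (chart_entry i j) = w i j.
  move=> i3; case/andP.
  case: j => [|[|[|[|[|j]]]]] // _ jn.
  - by case: i i3 => [|[|[|//]]] _; rewrite /= ?zpol_evalE /= /w /= -/D ?divff //;
      by rewrite /det3; field.
  - by case: i i3 => [|[|[|//]]] _; rewrite /= ?zpol_evalE /= /w /= -/D ?divff //;
      by rewrite /det3; field.
  - by case: i i3 => [|[|[|//]]] _; rewrite /= ?zpol_evalE /= /w /= -/D ?divff //;
      by rewrite /det3; field.
  - by case: i i3 => [|[|[|//]]] _; rewrite /= ?zpol_evalE.
  - have j0 : w 0%N j.+4.+1 != 0 by apply: h3; rewrite /= ?n4 ?jn.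
    have w04 : w 0%N 4 != 0 by apply: h3; rewrite /= ?n4 ?jn.
    have x0 : x j.+4.+1 != 0 by rewrite mulf_neq0 ?invr_neq0.
    have [w14 w24] := w4.
    have {jn} : (j < 4)%N by lia.
    case: j j0 x0 => [|[|[|[|//]]]] j0 x0 _;
      case: i i3 => [|[|[|//]]] _; rewrite /= ?zpol_evalE /= mulrC;
      by [rewrite divfK | rewrite divfK // mulf_neq0].
have uE i j : (i < 3)%N -> u i j = g i 0%N * w 0%N j + g i 1%N * w 1%N j + g i 2%N * w 2%N j.
  move=> i3; apply: (mulIf D0); rewrite /g /w /=; move: D0; rewrite /D /det3 => D0.
  by case: i i3 => [|[|[|//]]] _; field.
have gE : det3 g 0 1 2 = 1.
  by rewrite /g /=; move: D0; rewrite /D /det3 /= => D0; field.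
transitivity (det3 (fun i j => g i 0%N * w 0%N j + g i 1%N * w 1%N j + g i 2%N * w 2%N j) a b c).
  by rewrite {1}/det3 !uE.
by rewrite det3_mul gE mul1r /det3 !wE.
Qed.

(** The chart covers the matrices on which the product g of a few minors does not
    vanish.  So g (e - f) vanishes on all matrices, and g can be cancelled
    because the coordinate ring is a domain. *)
Lemma plucker_identity n e f : (3 < n <= 8)%N ->
  well_labelled n e -> well_labelled n f -> peq (pol_of e) (pol_of f) ->
  plucker_fun C n e = plucker_fun C n f.
Proof.
move=> /andP[n4 n8] we wf ef.
(* The minors that [chart_exists] requires not to vanish. *)
pose es := [:: EPl 1 2 3; EPl 1 4 3; EPl 1 2 4] ++ [seq EPl j 2 3 | j <- iota 4 (n - 3)].
pose g := foldr EMul (EPl 1 2 3) es.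
have le x : (x <= 4)%N -> (x <= n)%N by move/leq_trans; apply.
have we3 j : (3 < j <= n)%N -> well_labelled n (EPl j 2 3).
  by case/andP=> j3 jn; rewrite /= jn (leq_trans _ j3) // !le.
have wes : all (well_labelled n) es.
  rewrite all_cat; apply/andP; split; first by rewrite /= !le.
  rewrite all_map; apply/allP => j /=.
  by rewrite mem_iota => jn; apply: we3; lia.
have wg : well_labelled n g.
  rewrite /g; elim: (es) wes => /= [|e' s IH]; first by rewrite !le.
  by move=> /andP[-> /IH ->].
have g0 : plucker_fun C n g != 0.
  have: all (fun e => plucker_fun C n e != 0) es.
    rewrite all_cat; apply/andP; split; last first.
      rewrite all_map; apply/allP => j; rewrite mem_iota => jn.
      apply: minor_neq0; [lia | lia | lia |].
      by rewrite /= !inE; apply/andP; split=> //; apply/negP; lia.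
    by apply/and4P; split=> //; apply: minor_neq0; rewrite ?le.
  rewrite /g; elim: (es) => [_|e' s IH]; first by apply: minor_neq0; rewrite ?le.
  by move=> /andP[e0 /IH s0]; exact: mulf_neq0 e0 s0.
have: plucker_fun C n (EMul g (ESub e f)) == 0.
  apply/plucker_fun_eq0P => [|v]; first by apply/and3P.
  set d := det3 _; pose val := interp 1 -%R (fun x y : C => x - y) +%R *%R d.
  rewrite -/val -[val _]/(val g * (val e - val f)).
  case: (eqVneq (val g) 0) => [-> | vg0]; first by rewrite mul0r.
  have {vg0}: all (fun e => val e != 0) es.
    move: vg0; rewrite /g; elim: (es) => //= e' s IH.
    by rewrite mulf_eq0 negb_or => /andP[-> /IH].
  rewrite all_cat all_map /= => /andP[/and4P[v1 v2 v3 _] /allP v4].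
  have [j jn||l lP] := @chart_exists n (entry v) n8 v1 v2 v3 => //.
    by apply: (v4 j); rewrite mem_iota; lia.
  have vE e' : well_labelled n e' -> val e' = zpol_eval l (pol_of e').
    rewrite zpol_eval_pol_of /val.
    elim: e' => [|a b c|e1 IH|e1 IHe f1 IHf|e1 IHe f1 IHf|e1 IHe f1 IHf] /=.
    - by [].
    - by case/and3P; apply: lP.
    - by move=> /IH ->.
    - by move=> /andP[/IHe -> /IHf ->].
    - by move=> /andP[/IHe -> /IHf ->].
    - by move=> /andP[/IHe -> /IHf ->].
  have -> : val e = val f by rewrite (vE _ we) (vE _ wf); apply: zpol_eval_eq.
  by rewrite subrr mulr0.
rewrite plucker_funM plucker_funB mulf_eq0 => /orP[g0' | ].
  by rewrite g0' in g0.
by rewrite subr_eq0 => /eqP.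
Qed.
End Polynomials.

(** * Algebraic independence and exchange *)

Section Evaluation.
Variables (C : numFieldType) (F : fieldType) (iota : {rmorphism C -> F}).
Variable T : finType.
Local Notation peval := (peval iota).
Implicit Types (v u : T -> F) (P Q : {mpoly C[#|T|]}) (t z : T).

HB.instance Definition _ v := GRing.RMorphism.copy (@Defs.peval C F iota T v)
  (mmap iota (fun i => v (enum_val i))).

Definition pvarX (t : T) : {mpoly C[#|T|]} := 'X_(enum_rank t).

Lemma peval_var v t : peval v (pvarX t) = v t.
Proof. by rewrite /peval mmapX mmap1U enum_rankK. Qed.

Lemma peval_const v c : peval v c%:MP = iota c.
Proof. exact: mmapC. Qed.

Lemma eq_peval v u P : v =1 u -> peval v P = peval u P.
Proof.
move=> vu; rewrite /peval /mmap; apply: eq_bigr => m _; congr (_ * _).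
by rewrite /mmap1; apply: eq_bigr => i _; rewrite vu.
Qed.

(** Membership in the subfield generated by the values of v. *)
Definition rational_in v (f : F) : Prop :=
  exists P Q, peval v Q != 0 /\ f * peval v Q = peval v P.

Definition generating v : Prop := forall f, rational_in v f.

Lemma rational_var v t : rational_in v (v t).
Proof. by exists (pvarX t), 1; rewrite rmorph1 oner_eq0 peval_var mulr1. Qed.
Lemma rational_const v c : rational_in v (iota c).
Proof. by exists c%:MP, 1; rewrite rmorph1 oner_eq0 peval_const mulr1. Qed.
Lemma rationalD v f g : rational_in v f -> rational_in v g -> rational_in v (f + g).
Proof.
move=> [P [Q [Q0 fE]]] [P' [Q' [Q'0 gE]]]; exists (P * Q' + P' * Q), (Q * Q').
by rewrite !rmorphD !rmorphM /= mulf_neq0 // -fE -gE; split=> //; ring.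
Qed.
Lemma rationalM v f g : rational_in v f -> rational_in v g -> rational_in v (f * g).
Proof.
move=> [P [Q [Q0 fE]]] [P' [Q' [Q'0 gE]]]; exists (P * P'), (Q * Q').
by rewrite !rmorphM /= mulf_neq0 // -fE -gE; split=> //; ring.
Qed.
Lemma rationalV v f : rational_in v f -> rational_in v f^-1.
Proof.
move=> [P [Q [Q0 fE]]]; have [-> | f0] := eqVneq f 0.
  by rewrite invr0 -(rmorph0 iota); apply: rational_const.
by exists Q, P; rewrite -fE mulf_neq0 // mulKf.
Qed.

Lemma rational_peval v u P : (forall t, rational_in v (u t)) -> rational_in v (peval u P).
Proof.
move=> vu; elim/mpoly_subring_ind: P => [c|i|p q IHp IHq|p q IHp IHq].
- by rewrite peval_const; apply: rational_const.
- by rewrite -(enum_valK i) -/(pvarX _) peval_var.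
- by rewrite rmorphD; apply: rationalD.
- by rewrite rmorphM; apply: rationalM.
Qed.

Lemma generating_trans v u :
  generating v -> (forall t, rational_in u (v t)) -> generating u.
Proof.
move=> gv uv f; have [P [Q [Q0 fE]]] := gv f.
rewrite -(mulfK Q0 f) fE; apply: rationalM; last apply: rationalV.
  exact: rational_peval.
exact: rational_peval.
Qed.

Definition upd v z (a : F) : T -> F := fun t => if t == z then a else v t.

(** Substituting N / v z for v z turns a polynomial into a polynomial divided by a
    power of v z. *)
Lemma peval_upd z (N : {mpoly C[#|T|]}) P : exists D Q, forall u, u z != 0 ->
  peval u Q = u z ^+ D * peval (upd u z (peval u N / u z)) P.
Proof.
elim/mpoly_subring_ind: P => [c|i|p q [D [P IHp]] [D' [P' IHq]]|p q [D [P IHp]] [D' [P' IHq]]].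
- by exists 0%N, c%:MP => u _; rewrite !peval_const expr0 mul1r.
- case: (eqVneq (enum_val i) z) => iz.
    exists 1%N, N => u u0.
    rewrite -(enum_valK i) -/(pvarX _) peval_var /upd iz eqxx expr1.
    by rewrite mulrCA divff ?mulr1.
  exists 0%N, 'X_i => u _; rewrite -(enum_valK i) -/(pvarX _) !peval_var.
  by rewrite /upd (negPf iz) expr0 mul1r.
- exists (D + D')%N, (pvarX z ^+ D' * P + pvarX z ^+ D * P') => u u0.
  by rewrite !rmorphD !rmorphM !rmorphXn /= !peval_var IHp // IHq // exprD; ring.
- exists (D + D')%N, (P * P') => u u0.
  by rewrite !rmorphM /= IHp // IHq // exprD; ring.
Qed.

Lemma independent_neq0 v t : algebraically_independent iota v -> v t != 0.
Proof.
move=> iv; apply/eqP => vt; have /iv/(congr1 (meval (fun=> 1))) : peval v (pvarX t) = 0.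
  by rewrite peval_var.
by rewrite mevalXU meval0 => /eqP; rewrite oner_eq0.
Qed.

Section Exchange.
Variables (v : T -> F) (z : T) (N : {mpoly C[#|T|]}).
Hypotheses (Nz : forall u a, peval (upd u z a) N = peval u N).
Hypothesis N0 : peval v N != 0.
Hypothesis iv : algebraically_independent iota v.
Let v' := upd v z (peval v N / v z).

Lemma v'z : v' z = peval v N / v z. Proof. by rewrite /v' /upd eqxx. Qed.
Lemma updK : upd v' z (peval v' N / v' z) =1 v.
Proof.
move=> t; rewrite v'z Nz /upd; case: eqP => [->|]; last by rewrite /v' /upd; case: eqP.
have vz := independent_neq0 z iv.
by rewrite invf_div mulrCA divff // mulr1.
Qed.

(** Exchange is an involution, as N does not involve the variable z.  By
    [peval_upd], a relation between the new elements gives, up to a power of v z,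
    a relation between the old ones; the latter is trivial, and going back along
    the involution shows that the former is trivial too. *)
Lemma independent_exchange : algebraically_independent iota v'.
Proof.
move=> P P0; have [D [Q QE]] := peval_upd z N P.
have vz := independent_neq0 z iv.
have /iv Q0 : peval v Q = 0 by rewrite QE // P0 mulr0.
apply: iv; have v'0 : v' z != 0 by rewrite v'z mulf_neq0 ?invr_neq0.
move: (QE v' v'0); rewrite Q0 rmorph0 => /esym/eqP.
by rewrite mulf_eq0 expf_eq0 (negPf v'0) andbF (eq_peval _ updK) => /eqP.
Qed.

Lemma generating_exchange : generating v -> generating v'.
Proof.
move/generating_trans; apply=> t; have [-> | tz] := eqVneq t z; last first.
  have <- : v' t = v t by rewrite /v' /upd (negPf tz).
  exact: rational_var.
rewrite -updK /upd eqxx; apply: rationalM; last exact/rationalV/rational_var.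
by apply: rational_peval => ?; apply: rational_var.
Qed.
End Exchange.
End Evaluation.

Section Maximal.
Variables (C : numFieldType) (F : fieldType) (iota : {rmorphism C -> F}).
Variables (T : finType) (v : T -> F).

(** An element f = P / Q that is added satisfies f Q - P = 0.  If this relation
    is trivial, it also holds for f + 1 in place of f, and then Q = 0. *)
Lemma generating_transcendence_basis :
  algebraically_independent iota v -> generating iota v ->
  transcendence_basis iota v.
Proof.
move=> iv gv; split=> // f; have [P [Q [Q0 fE]]] := gv f.
pose widen (p : {mpoly C[#|T|]}) : {mpoly C[#|[the finType of option T]|]} :=
  mmap (@mpolyC _ C) (fun i => pvarX C (Some (enum_val i))) p.
have wE u p : peval iota u (widen p) = peval iota (u \o some) p.
  rewrite /widen {2}/peval /mmap rmorph_sum; apply: eq_bigr => m _.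
  rewrite rmorphM /= peval_const; congr (_ * _).
  rewrite /mmap1 rmorph_prod; apply: eq_bigr => i _.
  by rewrite rmorphXn /= peval_var.
set w := fun o => _ => iw.
(* [None] is the variable of the added element f. *)
have R0 : pvarX C None * widen Q - widen P = 0.
  apply: iw; rewrite rmorphB rmorphM /= peval_var !wE /w /=.
  by rewrite -fE; apply/eqP; rewrite subr_eq0; apply/eqP; congr (_ * _).
have := congr1 (peval iota (fun o => oapp v (f + 1) o)) R0.
rewrite rmorphB rmorphM rmorph0 /= peval_var !wE /= => /eqP.
rewrite -[_ \o some]/v mulrDl fE mul1r addrC addrA addNr add0r => /eqP Q1.
by rewrite Q1 eqxx in Q0.
Qed.
End Maximal.

(** * Mutation of seeds *)

Section Seeds.
Variables (C : numFieldType) (F : fieldType) (iota : {rmorphism C -> F}).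
Variables I J : finType.
Implicit Types (s : seed F I J) (z : I).

Definition skew s := forall i j, principal s i j = - principal s j i.

(** For the seeds at hand the principal part is skew-symmetric, and the symmetrizing
    diagonal matrix is the identity. *)
Definition good_basis s :=
  algebraically_independent iota (extended_cluster s) /\ skew s.

Lemma good_basis_is_seed s :
  good_basis s -> generating iota (extended_cluster s) -> is_seed iota s.
Proof.
move=> [ind sk] gen; split; first exact: generating_transcendence_basis.
by exists (fun=> 1); split=> [//|i j]; rewrite !mul1r.
Qed.

Definition mutated_int (p q : int) : int := ((`|p| * q + p * `|q|) %/ 2)%Z.

Lemma mutated_intE p q : mutated_int p q =
  if (0 < p) && (0 < q) then p * q else if (p < 0) && (q < 0) then - (p * q) else 0.
Proof.
rewrite /mutated_int; have half x : (x *+ 2 %/ 2)%Z = x.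
  by rewrite -[x *+ 2]mulr_natr; apply: (@mulzK x 2).
have [p0|p0|->] := ltrgt0P p; last by rewrite !mul0r addr0 div0z.
  have [q0|q0|->] := ltrgt0P q; last by rewrite !mulr0 addr0 div0z.
    by rewrite -mulr2n half.
  by rewrite mulrN addrN div0z.
have [q0|q0|->] := ltrgt0P q; last by rewrite !mulr0 addr0 div0z.
  by rewrite mulNr addNr div0z.
by rewrite mulrN mulNr -mulr2n half.
Qed.

Lemma mutated_intN p q : mutated_int (- q) (- p) = - mutated_int p q.
Proof.
rewrite !mutated_intE !oppr_gt0 !oppr_lt0 mulrNN (mulrC q).
by have [p0|p0|_] := ltrgt0P p; have [q0|q0|_] := ltrgt0P q; rewrite ?opprK ?oppr0.
Qed.

Lemma skew_mutate z s : skew s -> skew (mutate z s).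
Proof.
move=> sk i j; rewrite /principal /=.
have inlE (a b : I) : (inl a == inl b :> I + J) = (a == b) by [].
rewrite !inlE orbC; have sk' a b : exchange s (inl a) b = - exchange s (inl b) a.
  exact: sk.
case: ifP => _; first by rewrite sk' opprK.
rewrite -!/(mutated_int _ _) opprD [exchange s (inl i) j]sk'; congr (_ + _).
by rewrite [exchange s (inl j) z]sk' [exchange s (inl z) i]sk' mutated_intN opprK.
Qed.

Lemma skew_diag z s : skew s -> exchange s (inl z) z = 0.
Proof.
move=> /(_ z z) /eqP; rewrite -addr_eq0 -mulr2n mulrn_eq0 /= => /eqP.
exact.
Qed.

Definition exchange_poly (b : I + J -> int) : {mpoly C[#|[the finType of (I + J)%type]|]} :=
  \prod_(r | 0 < b r) pvarX C r ^+ `|b r|%N + \prod_(r | b r < 0) pvarX C r ^+ `|b r|%N.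

Lemma peval_exchange_poly b (x : I + J -> F) :
  peval iota x (exchange_poly b) =
  \prod_(r | 0 < b r) x r ^ b r + \prod_(r | b r < 0) x r ^ (- b r).
Proof.
rewrite rmorphD !rmorph_prod; congr (_ + _); apply: eq_bigr => r br.
  by rewrite rmorphXn /= peval_var exprnP gtz0_abs.
by rewrite rmorphXn /= peval_var exprnP ltz0_abs.
Qed.

Lemma extended_cluster_mutate z s :
  extended_cluster (mutate z s) =1
  upd (extended_cluster s) (inl z)
    (peval iota (extended_cluster s) (exchange_poly (fun r => exchange s r z)) /
     extended_cluster s (inl z)).
Proof.
case=> [i|j]; rewrite /upd //= peval_exchange_poly.
by rewrite -[inl i == inl z]/(i == z); case: eqP.
Qed.

Lemma eq_independent (x y : I + J -> F) : x =1 y ->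
  algebraically_independent iota x -> algebraically_independent iota y.
Proof. by move=> xy ix P; rewrite -(eq_peval _ _ xy); apply: ix. Qed.

Lemma eq_generating (x y : I + J -> F) : x =1 y ->
  generating iota x -> generating iota y.
Proof.
by move=> xy gx f; have [P [Q]] := gx f; exists P, Q; rewrite -!(eq_peval _ _ xy).
Qed.

Lemma exchange_poly_upd z s (u : I + J -> F) a : skew s ->
  let N := exchange_poly (fun r => exchange s r z) in
  peval iota (upd u (inl z) a) N = peval iota u N.
Proof.
move=> sk /=; rewrite !peval_exchange_poly; congr (_ + _); apply: eq_bigr => r;
by rewrite /upd; case: eqP => // ->; rewrite skew_diag.
Qed.

(** The numerator of an exchange takes the value 2 at the point whose coordinates
    are all 1. *)
Lemma exchange_poly_neq0 b (x : I + J -> F) : algebraically_independent iota x ->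
  peval iota x (exchange_poly b) != 0.
Proof.
move=> ind; apply/eqP => /ind/(congr1 (meval (fun=> 1))).
rewrite rmorphD !rmorph_prod meval0 /=.
rewrite !big1 => [|r _|r _]; rewrite ?rmorphXn /= ?mevalXU ?expr1n //.
by move/eqP; rewrite (_ : 1 + 1 = 2%:R) // pnatr_eq0.
Qed.

Lemma good_basis_mutate z s : good_basis s -> good_basis (mutate z s).
Proof.
move=> [ind sk]; split; last exact: skew_mutate.
have Nz u a := @exchange_poly_upd z s u a sk.
apply: eq_independent (independent_exchange Nz (exchange_poly_neq0 _ ind) ind) => t.
by rewrite extended_cluster_mutate.
Qed.

Lemma generating_mutate z s : good_basis s ->
  generating iota (extended_cluster s) ->
  generating iota (extended_cluster (mutate z s)).
Proof.
move=> [ind sk] gen; have Nz u a := @exchange_poly_upd z s u a sk.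
apply: eq_generating (generating_exchange Nz (exchange_poly_neq0 _ ind) ind gen) => t.
by rewrite extended_cluster_mutate.
Qed.

Lemma rational_equivalent s s' : mutation_equivalent s s' ->
  forall r, rational_in iota (extended_cluster s) (extended_cluster s' r).
Proof.
elim=> [|z s'' _ IH] r; first exact: rational_var.
rewrite extended_cluster_mutate /upd; case: eqP => // _.
by apply: rationalM; [apply: rational_peval | apply: rationalV].
Qed.

Lemma good_basis_equivalent s s' :
  good_basis s -> mutation_equivalent s s' -> good_basis s'.
Proof. by move=> gs; elim=> // z s'' _; apply: good_basis_mutate. Qed.

Lemma generating_equivalent s s' : good_basis s ->
  generating iota (extended_cluster s) -> mutation_equivalent s s' ->
  generating iota (extended_cluster s').
Proof.
move=> gs gen; elim=> // z s'' e; apply: generating_mutate.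
exact: good_basis_equivalent e.
Qed.

End Seeds.

(** * Laurent polynomials and their order along a variable *)

Section Denominators.
Variables (C : numFieldType) (F : fieldType) (iota : {rmorphism C -> F}).
Variables I J : finType.
Local Notation T := [the finType of (I + J)%type].
Variable v : I + J -> F.
Hypothesis iv : algebraically_independent iota v.
Local Notation eval := (peval iota v).
Local Notation poly := {mpoly C[#|T|]}.
Implicit Types (P Q : poly) (f g : F) (i : I).

Local Notation xvar := (@pvarX C T).

Lemma v_neq0 r : v r != 0. Proof. exact: (independent_neq0 r iv). Qed.

Lemma eval_inj P Q : eval P = eval Q -> P = Q.
Proof.
by move=> PQ; apply/eqP; rewrite -subr_eq0; apply/eqP/iv; rewrite rmorphB /= PQ subrr.
Qed.

(** The value at the point of the hyperplane x_i = 0 whose other coordinates are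
    all 1. *)
Definition wall i (P : poly) : C := P.@[fun r => (enum_val r != inl i :> T)%:R].
HB.instance Definition _ i := GRing.RMorphism.copy (wall i)
  (meval (fun r => (enum_val r != inl i :> T)%:R)).

Lemma wall_var i r : wall i (xvar r) = (r != inl i)%:R.
Proof. by rewrite /wall mevalXU enum_rankK. Qed.

(** f is x_i to the power d times a quotient of two polynomials that are positive
    at a point of the hyperplane x_i = 0.  Besides fixing the order of vanishing
    of f, this positivity excludes cancellation of leading terms in sums. *)
Definition has_order i (d : int) f :=
  exists A B, [/\ 0 < wall i A, 0 < wall i B & f * eval B = v (inl i) ^ d * eval A].

Lemma has_orderM i d e f g :
  has_order i d f -> has_order i e g -> has_order i (d + e) (f * g).
Proof.
move=> [A [B [A0 B0 fE]]] [A' [B' [A'0 B'0 gE]]]; exists (A * A'), (B * B').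
rewrite !rmorphM /= !mulr_gt0 // expfzDr ?v_neq0 //; split=> //.
by rewrite mulrACA fE gE mulrACA.
Qed.

Lemma eval_wall_neq0 i P : 0 < wall i P -> eval P != 0.
Proof. by move=> P0; apply: contraTneq P0 => /iv ->; rewrite rmorph0 ltxx. Qed.

Lemma has_order_neq0 i d f : has_order i d f -> f != 0.
Proof.
move=> [A [B [A0 B0 fE]]]; apply: contra_eqN fE => /eqP ->.
by rewrite mul0r eq_sym mulf_neq0 ?expfz_neq0 ?v_neq0 ?(eval_wall_neq0 A0).
Qed.

Lemma has_orderV i d f : has_order i d f -> has_order i (- d) f^-1.
Proof.
move=> fd; have f0 := has_order_neq0 fd.
have [A [B [A0 B0 fE]]] := fd; exists B, A; split=> //.
apply: (mulfI f0); rewrite mulVKf // mulrCA fE mulrA -expfzDr ?v_neq0 // addNr.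
by rewrite expr0z mul1r.
Qed.

Lemma has_order1 i : has_order i 0 1.
Proof. by exists 1, 1; rewrite rmorph1 ltr01 expr0z; split. Qed.

Lemma has_order_var i r : has_order i (r == inl i)%:Z (v r).
Proof.
have [-> | ri] := eqVneq r (inl i).
  by exists 1, 1; rewrite !rmorph1; split; rewrite ?ltr01 ?mulr1.
exists (xvar r), 1; rewrite !rmorph1 wall_var ri ltr01 mulr1 expr0z mul1r.
by rewrite peval_var; split.
Qed.

Lemma has_orderX i d f k : has_order i d f -> has_order i (d * k%:Z) (f ^+ k).
Proof.
move=> fd; elim: k => [|k IH]; first by rewrite mulr0; apply: has_order1.
by rewrite exprS intS mulrDr mulr1; apply: has_orderM.
Qed.

Lemma has_orderXz i d f k : has_order i d f -> has_order i (d * k) (f ^ k).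
Proof.
move=> fd; case: k => k; first exact: has_orderX.
by rewrite NegzE mulrN -exprz_inv -exprnP exprVn; apply/has_orderV/has_orderX.
Qed.

Lemma has_order_prod i (S : finType) (d : S -> int) (f : S -> F) :
  (forall s, has_order i (d s) (f s)) -> has_order i (\sum_s d s) (\prod_s f s).
Proof.
move=> fd; apply: (big_ind2 (has_order i)) => //; first exact: has_order1.
by move=> d1 f1 d2 f2; apply: has_orderM.
Qed.

(** If d < e, the second term vanishes on the hyperplane after division by the
    d-th power of x_i; if d = e, two positive values are added. *)
Lemma has_orderD i d e f g :
  has_order i d f -> has_order i e g -> has_order i (Num.min d e) (f + g).
Proof.
wlog de : d e f g / d <= e.
  move=> H fd ge; case: (leP d e) => [|/ltW] de.
    by rewrite -(min_l de); apply: H.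
  by rewrite -(min_l de) addrC; apply: H.
move=> [A [B [A0 B0 fE]]] [A' [B' [A'0 B'0 gE]]]; rewrite min_l //.
have [k ek] : exists k : nat, e = d + k%:Z.
  by exists `|e - d|%N; rewrite gez0_abs ?subr_ge0 // subrKC.
rewrite {}ek in gE {de}.
exists (A * B' + xvar (inl i) ^+ k * A' * B), (B * B'); split.
- rewrite rmorphD !rmorphM rmorphXn /= wall_var eqxx expr0n.
  by apply: ltr_pwDl; rewrite ?mulr_gt0 // !mulr_ge0 ?ler0n // ltW.
- by rewrite rmorphM mulr_gt0.
rewrite rmorphD !rmorphM rmorphXn /= peval_var mulrDl !mulrA fE.
have -> : g * eval B * eval B' = g * eval B' * eval B by rewrite mulrAC.
have -> : v (inl i) ^+ k = v (inl i) ^ k%:Z by [].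
by rewrite gE mulrDr !mulrA expfzDr ?v_neq0.
Qed.

Lemma has_order_poly_ge0 i d P : has_order i d (eval P) -> 0 <= d.
Proof.
move=> [A [B [A0 B0 PE]]]; rewrite leNgt; apply/negP => d0.
suff E : xvar (inl i) ^+ `|d|%N * P * B = A.
  by move: A0; rewrite -E !rmorphM rmorphXn /= wall_var eqxx expr0n absz_eq0 lt_eqF //
    !mul0r ltxx.
apply: eval_inj; rewrite !rmorphM rmorphXn /= peval_var -mulrA PE mulrA.
rewrite exprnP ltz0_abs // -expfzDr ?v_neq0 // addNr.
by rewrite expr0z mul1r.
Qed.

Definition restrict i P : poly :=
  mmap (@mpolyC _ C) (fun r => if enum_val r == inl i :> T then 0 else 'X_r) P.
HB.instance Definition _ i := GRing.RMorphism.copy (restrict i)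
  (mmap (@mpolyC _ C) (fun r => if enum_val r == inl i :> T then 0 else 'X_r)).

Lemma restrict_var i r : restrict i (xvar r) = if r == inl i then 0 else xvar r.
Proof. by rewrite /restrict /pvarX mmapX mmap1U enum_rankK. Qed.

(** Restriction to x_i = 0 detects divisibility by x_i. *)
Lemma restrictE i P : exists Q, P = restrict i P + xvar (inl i) * Q.
Proof.
elim/mpoly_subring_ind: P => [c|r|p q [p' pE] [q' qE]|p q [p' pE] [q' qE]].
- by exists 0; rewrite mulr0 addr0 /restrict mmapC.
- rewrite -(enum_valK r) -/(xvar (enum_val r)) restrict_var.
  case: eqP => [->|_]; first by exists 1; rewrite mulr1 add0r.
  by exists 0; rewrite mulr0 addr0.
- exists (p' + q'); rewrite {1}pE {1}qE rmorphD /=; ring.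
- exists (restrict i p * q' + p' * restrict i q + xvar (inl i) * p' * q').
  by rewrite {1}pE {1}qE rmorphM /=; ring.
Qed.

Lemma wall_restrict i P : wall i (restrict i P) = wall i P.
Proof.
have [Q {2}->] := restrictE i P; rewrite rmorphD rmorphM /= wall_var eqxx.
by rewrite mul0r addr0.
Qed.

Lemma has_order_poly_gt0 i d P : has_order i d (eval P) -> 0 < d ->
  exists Q, P = xvar (inl i) * Q.
Proof.
move=> [A [B [A0 B0 PE]]] d0.
have E : P * B = xvar (inl i) ^+ `|d|%N * A.
  by apply: eval_inj; rewrite !rmorphM rmorphXn /= peval_var exprnP gtz0_abs.
have [Q PQ] := restrictE i P; exists Q; rewrite {1}PQ.
suff -> : restrict i P = 0 by rewrite add0r.
have /eqP := congr1 (restrict i) E; rewrite !rmorphM rmorphXn /= restrict_var eqxx.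
rewrite expr0n absz_eq0 gt_eqF // mul0r mulf_eq0 => /orP[/eqP //|/eqP B1].
by move: B0; rewrite -wall_restrict B1 rmorph0 ltxx.
Qed.

Lemma has_order0_poly i P Q : has_order i 0 (eval P) -> P <> xvar (inl i) * Q.
Proof.
move=> [A [B [A0 B0 PE]]] PQ; move: PE; rewrite expr0z mul1r -rmorphM => /eval_inj E.
by move: A0; rewrite -E PQ !rmorphM /= wall_var eqxx !mul0r ltxx.
Qed.

Definition laurent f := exists P (e : I -> int), f = eval P / \prod_i v (inl i) ^ e i.

Lemma prod_neq0 (e : I -> int) : \prod_i v (inl i) ^ e i != 0.
Proof. by apply/prodf_neq0 => i _; rewrite expfz_neq0 ?v_neq0. Qed.

Lemma laurent_poly P : laurent (eval P).
Proof.
exists P, (fun=> 0); rewrite big1 ?divr1 // => i _; exact: expr0z.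
Qed.

Lemma laurentM f g : laurent f -> laurent g -> laurent (f * g).
Proof.
move=> [P [e ->]] [Q [d ->]]; exists (P * Q), (fun i => e i + d i).
rewrite rmorphM /= mulrACA -invfM -big_split; congr (_ / _).
by apply: eq_bigr => i _; rewrite expfzDr ?v_neq0.
Qed.

Lemma laurentN f : laurent f -> laurent (- f).
Proof. by move=> [P [e ->]]; exists (- P), e; rewrite rmorphN mulNr. Qed.

Lemma laurentD f g : laurent f -> laurent g -> laurent (f + g).
Proof.
move=> [P [e ->]] [Q [d ->]].
(* Both fractions are brought to the larger of the two exponents. *)
pose mono (k : I -> nat) := \prod_i xvar (inl i) ^+ k i.
exists (P * mono (fun i => `|Num.max (e i) (d i) - e i|%N)
      + Q * mono (fun i => `|Num.max (e i) (d i) - d i|%N)), (fun i => Num.max (e i) (d i)).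
have monoE (a b : I -> int) : (forall i, a i <= b i) ->
    eval (mono (fun i => `|b i - a i|%N)) / \prod_i v (inl i) ^ b i
    = (\prod_i v (inl i) ^ a i)^-1.
  move=> ab; apply: (mulIf (prod_neq0 b)); rewrite divfK ?prod_neq0 //.
  apply: (mulfI (prod_neq0 a)); rewrite mulVKf ?prod_neq0 // rmorph_prod -big_split.
  apply: eq_bigr => i _; rewrite rmorphXn /= peval_var exprnP gez0_abs ?subr_ge0 //.
  by rewrite -expfzDr ?v_neq0 // subrKC.
rewrite rmorphD !rmorphM /= mulrDl -!mulrA !monoE // => i.
  by rewrite le_max lexx orbT.
by rewrite le_max lexx.
Qed.

Lemma laurent_var r : laurent (v r).
Proof. by rewrite -(peval_var iota v r); apply: laurent_poly. Qed.

Lemma laurent_varV i : laurent (v (inl i))^-1.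
Proof.
exists 1, (fun j => (j == i)%:Z); rewrite rmorph1 mul1r (bigD1 i) //= eqxx expr1z.
by rewrite big1 ?mulr1 // => j /negPf ->; rewrite expr0z.
Qed.

Lemma laurent_const c : laurent (iota c).
Proof. by rewrite -(peval_const iota v); apply: laurent_poly. Qed.

(** Along x_i the numerator P of a Laurent expression with exponents e has order
    e i - c i.  This is not negative, and as long as it is positive a factor x_i
    can be removed from P. *)
Lemma laurent_denominator f (c : I -> int) : laurent f ->
  (forall i, has_order i (- c i) f) ->
  exists P, f = eval P / \prod_i v (inl i) ^ c i /\ forall i Q, P <> xvar (inl i) * Q.
Proof.
move=> [P [e fE]] fc.
have ordP P' e' i : f = eval P' / \prod_i v (inl i) ^ e' i ->
    has_order i (e' i - c i) (eval P').
  move=> fE'; have -> : eval P' = f * \prod_i v (inl i) ^ e' i.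
    by rewrite fE' divfK ?prod_neq0.
  rewrite addrC; apply: has_orderM => //.
  have -> : e' i = \sum_j (j == i)%:Z * e' j.
    rewrite (bigD1 i) //= eqxx mul1r big1 ?addr0 // => j /negPf ->.
    by rewrite mul0r.
  by apply: has_order_prod => j; apply/has_orderXz/has_order_var.
have [k] := ubnP (\sum_i `|(e i - c i)%R|)%N; elim: k => // k IH in P e fE *.
case: (pickP (fun i => e i != c i)) => [i ei | ec]; last first.
  have {}ec i : e i = c i by apply/eqP; rewrite -[_ == _]negbK [_ != _]ec.
  move=> _; exists P; split=> [|i Q]; first by rewrite fE; under eq_bigr do rewrite ec.
  by apply: has_order0_poly; have := ordP P e i fE; rewrite ec subrr.
have eci : 0 < e i - c i.
  by rewrite lt_def subr_eq0 ei (has_order_poly_ge0 (ordP P e i fE)).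
have [Q PQ] := has_order_poly_gt0 (ordP P e i fE) eci.
move=> lek; pose e' j := e j - (j == i)%:Z; apply: (IH Q e'); last first.
  rewrite -ltnS; apply: leq_trans lek; rewrite ltnS (bigD1 i) //= [leqRHS](bigD1 i) //= -addSn.
  apply: leq_add; last first.
    by apply: eq_leq; apply: eq_bigr => j /negPf ji; rewrite /e' ji subr0.
  by rewrite /e' eqxx /=; lia.
rewrite fE PQ rmorphM /= peval_var.
have -> : \prod_j v (inl j) ^ e j = v (inl i) * \prod_j v (inl j) ^ e' j.
  rewrite (bigD1 i) //= [in RHS](bigD1 i) //= mulrA /e' eqxx; congr (_ * _).
    by rewrite -{2}[v (inl i)]expr1z -expfzDr ?v_neq0 // subrKC.
  by apply: eq_bigr => j /negPf ->; rewrite subr0.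
by rewrite invfM mulrACA divff ?v_neq0 // mul1r.
Qed.

(** The sign is allowed for because the functions of the table are considered up
    to sign. *)
Lemma has_order_unique i d e f : has_order i d f ->
  has_order i e f \/ has_order i e (- f) -> d = e.
Proof.
(* After division by the smaller power of x_i, only one of the two
   representations of f vanishes at the point of the wall. *)
have lt_absurd d' e' f' (s : bool) :
    d' < e' -> has_order i d' f' -> has_order i e' ((-1) ^+ s * f') -> False.
  move=> de [A [B [A0 B0 fE]]] [A' [B' [A'0 B'0 gE]]].
  have k0 : (0 < `|e' - d'|)%N by rewrite absz_gt0 subr_eq0 gt_eqF.
  have E : (-1) ^+ s * A * B' = xvar (inl i) ^+ `|e' - d'|%N * A' * B.
    apply: eval_inj; rewrite !rmorphM !rmorphXn /= rmorphN1 peval_var.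
    apply: (@mulfI _ (v (inl i) ^ d')); first by rewrite expfz_neq0 ?v_neq0.
    have -> : v (inl i) ^ d' * (v (inl i) ^+ `|e' - d'| * eval A' * eval B)
      = v (inl i) ^ e' * eval A' * eval B.
      by rewrite !mulrA exprnP gez0_abs ?subr_ge0 ?ltW // -expfzDr ?v_neq0 // subrKC.
    rewrite -gE; transitivity ((-1) ^+ s * (f' * eval B) * eval B'); last by ring.
    by rewrite fE; ring.
  have /eqP := congr1 (wall i) E; rewrite !rmorphM !rmorphXn /= rmorphN1 wall_var eqxx.
  rewrite expr0n eqn0Ngt k0 !mul0r !mulf_eq0 signr_eq0 /=.
  by rewrite !gt_eqF.
move=> fd fe; have {fe}[s fe] : exists s : bool, has_order i e ((-1) ^+ s * f).
  case: fe => fe; [exists false | exists true]; first by rewrite expr0 mul1r.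
  by rewrite expr1 mulN1r.
case: (ltgtP d e) => // de; first by case: (lt_absurd _ _ _ s de fd fe).
by case: (lt_absurd _ _ _ s de fe); rewrite mulrA -signr_addb addbb mul1r.
Qed.
End Denominators.

(** * Root systems *)

Section Roots.
Variables (m : nat) (E : seq (nat * nat)).

Definition root_row (s : seq nat) : 'rV[int]_m := \row_i (nth 0%N s i)%:Z.

Definition adjacent_nodes (i j : nat) : bool :=
  ((i.+1, j.+1) \in E) || ((j.+1, i.+1) \in E).

Definition neighbour_sum (s : seq nat) (i : nat) : nat :=
  sumn [seq nth 0%N s j | j <- iota 0 m & adjacent_nodes i j].

Definition reflect_digits (i : nat) (s : seq nat) : seq nat :=
  set_nth 0%N s i (neighbour_sum s i - nth 0%N s i)%N.

Definition simple_digits (i : nat) : seq nat := mkseq (fun j => (j == i) : nat) m.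

(** Every reflection of s is again a string of the list, except that the simple
    root of i is sent to its opposite by the reflection in i. *)
Definition closed_root (pos : seq (seq nat)) (s : seq nat) : bool :=
  all (fun i => (s == simple_digits i) ||
         (nth 0%N s i <= neighbour_sum s i)%N && (reflect_digits i s \in pos)) (iota 0 m).

(** Some reflection of s is smaller and reflects back to s, unless s is simple. *)
Definition reached_root (pos : seq (seq nat)) (s : seq nat) : bool :=
  has (fun i => (s == simple_digits i) ||
         let s' := reflect_digits i s in
         [&& s' \in pos, (sumn s' < sumn s)%N, (nth 0%N s' i <= neighbour_sum s' i)%N
           & reflect_digits i s' == s]) (iota 0 m).

Definition check_roots (pos : seq (seq nat)) : bool :=
  [&& all (fun i => ~~ adjacent_nodes i i && (simple_digits i \in pos)) (iota 0 m), uniq pos,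
      all (fun s => (size s == m) && (0 < sumn s)%N) pos,
      all (closed_root pos) pos & all (reached_root pos) pos].

Lemma root_row_inj s t : size s = m -> size t = m -> root_row s = root_row t -> s = t.
Proof.
move=> sm tm st; apply: (@eq_from_nth _ 0%N) => [|i]; rewrite sm // => im.
by have /rowP/(_ (Ordinal im)) := st; rewrite !mxE /= => -[].
Qed.

Lemma root_row_simple (i : 'I_m) : root_row (simple_digits i) = simple_root i.
Proof.
apply/rowP => j; rewrite !mxE nth_mkseq //=.
by rewrite -val_eqE; case: eqP.
Qed.

Lemma neighbour_sumE s (i : 'I_m) :
  neighbour_sum s i = (\sum_(j < m | adjacent E i j) nth 0 s j)%N.
Proof.
rewrite /neighbour_sum sumnE big_map big_filter.
have -> : iota 0 m = index_iota 0 m by rewrite /index_iota subn0.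
by rewrite big_mkord.
Qed.

Lemma reflection_row s (i : 'I_m) : ~~ adjacent_nodes i i -> size s = m ->
  (nth 0%N s i <= neighbour_sum s i)%N ->
  reflection E i (root_row s) = root_row (reflect_digits i s).
Proof.
move=> ii sm le_si.
have -> : reflection E i (root_row s) = root_row s -
    ((nth 0%N s i)%:Z *+ 2 - (neighbour_sum s i)%:Z) *: simple_root i.
  congr (_ - _ *: _); rewrite (bigD1 i) //= /cartan eqxx !mxE mulr_natl.
  congr (_ + _); rewrite neighbour_sumE (big_morph Posz PoszD (erefl _)).
  rewrite -sumrN [LHS](bigID (adjacent E i)) /= addrC big1 => [|j /andP[ji /negPf ij]].
    rewrite add0r; apply: eq_big => [j|j /andP[ji ij]].
      by case: eqP => // ->; rewrite [adjacent _ _ _](negPf ii).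
    by rewrite eq_sym (negPf ji) ij !mxE mulN1r.
  by rewrite eq_sym (negPf ji) ij mul0r.
apply/rowP => j; rewrite !mxE nth_set_nth /= ?eqxx /=.
rewrite -val_eqE; case: eqP => [->|_] /=; last by rewrite mulr0 subr0.
by rewrite mulr1 -subzn // mulr2n; ring.
Qed.

Lemma reflectionN i (v : 'rV[int]_m) : reflection E i (- v) = - reflection E i v.
Proof.
rewrite /reflection [RHS]opprD; congr (_ + _); congr (- _).
rewrite -scaleNr -sumrN; congr (_ *: _).
by apply: eq_bigr => j _; rewrite mxE mulrN.
Qed.

Section Check.
Variable pos : seq (seq nat).
Hypothesis ok : check_roots pos.

Lemma pos_size s : s \in pos -> size s = m.
Proof. by case/and5P: ok => _ _ /allP h _ _ /h /andP[/eqP]. Qed.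

Lemma adj_irr (i : 'I_m) : ~~ adjacent_nodes i i.
Proof.
case/and5P: ok => /allP h _ _ _ _; have := h i; rewrite mem_iota ltn_ord.
by case/(_ isT)/andP.
Qed.

Lemma pos_simple (i : 'I_m) : simple_digits i \in pos.
Proof.
case/and5P: ok => /allP h _ _ _ _; have := h i; rewrite mem_iota ltn_ord.
by case/(_ isT)/andP.
Qed.

Lemma pos_root s : s \in pos -> dynkin_root E (root_row s).
Proof.
have [k] := ubnP (sumn s); elim: k s => // k IH s sk spos.
case/and5P: (ok) => _ _ _ _ /allP /(_ s spos); rewrite /reached_root => /hasP; case=> i.
rewrite mem_iota add0n => /= im.
have -> : i = Ordinal im :> nat by [].
case/orP => [/eqP-> | /and4P[s'pos lt_s's le_s' /eqP ss']].
  by rewrite root_row_simple; apply: root_simple.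
rewrite -ss' -reflection_row ?adj_irr ?(pos_size s'pos) //.
apply: root_reflection; apply: IH => //.
by apply: leq_trans lt_s's _; rewrite -ltnS.
Qed.

(** The strings and their opposites form a set that contains the simple roots and
    is stable under reflections. *)
Lemma root_pos (v : 'rV[int]_m) : dynkin_root E v ->
  exists2 s, s \in pos & v = root_row s \/ v = - root_row s.
Proof.
elim=> [i|i u _ [s spos vs]].
  by exists (simple_digits i); [apply: pos_simple | left; rewrite root_row_simple].
case/and5P: (ok) => _ _ _ /allP /(_ s spos) + _; rewrite /closed_root => /allP/(_ i).
rewrite mem_iota ltn_ord => /(_ isT) /orP[/eqP si | /andP[le_si rpos]].
  have si' : reflection E i (root_row s) = - root_row s.
    rewrite si root_row_simple; apply/rowP => j; rewrite !mxE.
    rewrite (bigD1 i) //= /cartan eqxx !mxE !eqxx big1 => [|l /negPf li].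
      by case: eqP => _; rewrite /= ?mulr0 ?subr0.
    by rewrite !mxE li andbF mulr0.
  by exists s => //; case: vs => ->; [right | left]; rewrite ?reflectionN si' ?opprK.
exists (reflect_digits i s) => //.
have E' := reflection_row (adj_irr i) (pos_size spos) le_si.
by case: vs => ->; [left | right]; rewrite ?reflectionN E'.
Qed.

Lemma almost_positiveP (v : 'rV[int]_m) : almost_positive_root E v <->
  (exists i, v = - simple_root i) \/ exists2 s, s \in pos & v = root_row s.
Proof.
split=> [[[rv v0] | [i ->]] | [[i ->] | [s spos ->]]].
- have [s spos [-> | vs]] := root_pos rv; first by right; exists s.
  case/and5P: (ok) => _ _ /allP /(_ s spos) /andP[/eqP sm s0] _ _.
  suff: sumn s = 0%N by move=> s0'; rewrite s0' in s0.
  apply/eqP; rewrite sumnE sum_nat_seq_eq0; apply/(all_nthP 0%N) => i im /=.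
  rewrite sm in im; have := v0 (Ordinal im); rewrite vs !mxE /=.
  by case: (nth _ _ _).
- by left; exists i.
- by right; exists i.
- by left; split=> [|i]; [apply: pos_root | rewrite mxE].
Qed.

End Check.
End Roots.

(** * Atlases of exchange relations *)

Section Columns.
Implicit Types (c d : column) (l z w : label).

Lemma coef_add l c d : coef l (add_column c d) = (coef l c + coef l d)%ZZ.
Proof.
elim: c d => [|[l1 e] c IHc] //; elim=> [|[l2 e'] d IHd] /=; first by lia.
case: Pos.compare_spec => [-> | _ | _] /=; last first.
- rewrite IHd /=. by case: Pos.eqb; case: Pos.eqb; lia.
- by rewrite IHc /=; case: Pos.eqb; case: Pos.eqb; lia.
case: Z.eqb_spec => [e0|_] /=; rewrite IHc; case: Pos.eqb; lia.
Qed.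

Lemma coef_opp l c : coef l (opp_column c) = Z.opp (coef l c).
Proof. by elim: c => //= -[l' e] c -> /=; case: Pos.eqb; lia. Qed.

Lemma coef_notin l c : l \notin map fst c -> coef l c = 0%ZZ.
Proof.
elim: c => //= -[l' e] c IH; rewrite inE negb_or => /andP[ll' /IH ->] /=.
by case: Pos.eqb_spec ll' => // ->; rewrite eqxx.
Qed.

Lemma coef_uniq l e c : uniq (map fst c) -> List.In (l, e) c -> coef l c = e.
Proof.
elim: c => //= -[l' e'] c IH /= /andP[l'c uc] [[<- <-] | lc].
  by rewrite Pos.eqb_refl coef_notin //; lia.
have lmem : l \in map fst c.
  elim: c lc {IH uc l'c} => //= x c IH [-> | /IH]; rewrite inE ?eqxx // => ->.
  by rewrite orbT.
case: Pos.eqb_spec => [ll'|_]; last exact: IH.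
by rewrite -ll' lmem in l'c.
Qed.

Lemma in_column l c : l \in map fst c -> exists e, List.In (l, e) c.
Proof.
elim: c => //= -[l' e] c IH; rewrite inE => /orP[/eqP -> | /IH[e' lc]].
  by exists e; left.
by exists e'; right.
Qed.

Lemma coef_in l c : coef l c <> 0%ZZ -> l \in map fst c.
Proof. by move=> lc; apply: contra_notT lc => /coef_notin. Qed.

Lemma coef_scaled b l c : uniq (map fst c) ->
  coef l (scaled_column b c) = mutated_entry (coef l c) b.
Proof.
have e0 : mutated_entry 0 b = 0%ZZ by rewrite /mutated_entry; case: ifP.
have drop (x : column) : coef l [seq y <- x | ~~ Z.eqb y.2 0] = coef l x.
  elim: x => //= -[l' e] x IH /=; case: Z.eqb_spec => [->|_] /=; rewrite IH //.
  by case: Pos.eqb; lia.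
rewrite /scaled_column drop; elim: c => [|[l' e] c IH] //= /andP[l'c uc].
case: Pos.eqb_spec => [ll'|_]; rewrite IH //.
by rewrite ll' coef_notin // e0 !Z.add_0_r.
Qed.

Lemma coef_mutate l z w cz cy : uniq (map fst cz) ->
  coef l (mutate_column z w cz cy) =
  let b := coef z cy in
  if Z.eqb b 0 then coef l cy else
  (coef l cy + mutated_entry (coef l cz) b
   + (if Pos.eqb l w then - b else 0) + (if Pos.eqb l z then - b else 0))%ZZ.
Proof.
move=> uz; rewrite /mutate_column /=; case: Z.eqb => //.
rewrite coef_add /mutation_increment coef_add coef_scaled // coef_add /=.
by do 2!case: Pos.eqb; lia.
Qed.

Lemma eq_columnP c d : reflect (c = d) (eq_column c d).
Proof.
apply: (iffP idP) => [|->]; last first.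
  by elim: d => //= x d IH; rewrite /eq_column /= Pos.eqb_refl Z.eqb_refl.
elim: c d => [|[l e] c IH] [|[l' e'] d] //= /andP[/andP[/Pos.eqb_eq -> /Z.eqb_eq ->]].
by move=> /IH ->.
Qed.

Lemma sorted_uniq_labels c : sorted Pos.ltb (map fst c) -> uniq (map fst c).
Proof.
apply: sorted_uniq => [a b c' | a].
  by move=> /Pos.ltb_lt ab /Pos.ltb_lt bc; apply/Pos.ltb_lt; lia.
exact: Pos.ltb_irrefl.
Qed.

Definition int_coef l c : int := int_of_Z (coef l c).

Lemma int_mutated_entry e b :
  int_of_Z (mutated_entry e b) = mutated_int (int_of_Z e) (int_of_Z b).
Proof.
have gt0 x : (0 < int_of_Z x) = Z.ltb 0 x by lia.
have lt0 x : (int_of_Z x < 0) = Z.ltb x 0 by lia.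
have mulE : int_of_Z (Z.mul e b) = int_of_Z e * int_of_Z b by rewrite -rmorphM.
rewrite mutated_intE /mutated_entry !gt0 !lt0 -mulE.
case: (Z.ltb_spec 0 b) => [b0 | b0].
  rewrite (_ : Z.ltb b 0 = false) ?andbF ?andbT; last by lia.
  by case: ifP.
rewrite andbF; case: (Z.ltb_spec e 0) => [e0|_] //=.
case: (Z.ltb_spec b 0) => b0'; first by lia.
by rewrite (_ : b = 0%ZZ) ?Z.mul_0_r //; lia.
Qed.

End Columns.

Section Maps.

Lemma mem_labels_upto k l : (l \in labels_upto k) = (Pos.to_nat l <= k)%N.
Proof.
apply/mapP/idP => [[j] | lk].
  by rewrite mem_iota add0n => /andP[_ jk] ->; rewrite SuccNat2Pos.id_succ.
exists (Pos.to_nat l).-1; last by lia.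
by rewrite mem_iota; lia.
Qed.

(** Labels count from 1. *)
Lemma get_numbered T (x0 : T) xs l :
  get x0 (numbered xs) l = nth x0 xs (Pos.to_nat l).-1.
Proof.
rewrite /get /numbered /labels_upto.
suff H k : (k <= (Pos.to_nat l).-1)%N -> odflt x0 (PositiveMap.find l
    (foldr (fun x M => PositiveMap.add x.1 x.2 M) (PositiveMap.empty T)
      (zip [seq Pos.of_succ_nat i | i <- iota k (size xs)] xs)))
    = nth x0 xs ((Pos.to_nat l).-1 - k) by rewrite H // subn0.
elim: xs k => [|x xs IH] k kl /=; first by rewrite PositiveMap.gempty nth_nil.
have [lk | lk] := eqVneq l (Pos.of_succ_nat k).
  by rewrite lk PositiveMap.gss SuccNat2Pos.id_succ subnn.
rewrite PositiveMap.gso; last exact/eqP.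
have kl' : (k < (Pos.to_nat l).-1)%N.
  rewrite ltn_neqAle kl andbT; apply: contraNneq lk => ->; apply/eqP; lia.
by rewrite IH // subnS -[(_ - k)%N in RHS]prednK ?subn_gt0.
Qed.

End Maps.

(** [sound_rels] and [sound_buckets] hold by construction for a generated atlas,
    the other fields are evaluated. *)
Record sound_atlas (d : atlas) : Prop := SoundAtlas {
  sound_nmut : (0 < nmut d)%N;
  sound_rels : forall z r, List.In r (rels d z) ->
    exists x, r = mk_rel (nmut d) (compats d) z x;
  sound_buckets : forall y z q, List.In q (bucket d y z) -> List.In q.2 (rels d y);
  sound_check_compat : check_compat d;
  sound_check_rels : check_rels d;
  sound_check_buckets : check_buckets d;
  sound_check_pairs : check_pairs d }.

Section Atlas.
Variable d : atlas.
Hypothesis d_sound : sound_atlas d.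
Let nmut_gt0 := sound_nmut d_sound.
Let regular := sound_rels d_sound.
Let bucket_sound := sound_buckets d_sound.
Let compat_ok := sound_check_compat d_sound.
Let rels_ok := sound_check_rels d_sound.
Let buckets_ok := sound_check_buckets d_sound.
Let pairs_ok := sound_check_pairs d_sound.
Notation mutable_label := (is_mutable (nmut d)).

Lemma mutable_labelE l : mutable_label l = (Pos.to_nat l <= nmut d)%N.
Proof. by rewrite /is_mutable; lia. Qed.

Lemma forall_mutableP P : forall_mutable d P -> forall l, mutable_label l -> P l.
Proof. by move=> /allP h l ml; apply: h; rewrite mem_labels_upto -mutable_labelE. Qed.

Lemma forall_relsP P : forall_rels d P ->
  forall z r, mutable_label z -> List.In r (rels d z) -> P z r.
Proof.
by move=> h z r mz rz; have /List.forallb_forall := forall_mutableP h mz; apply.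
Qed.

Lemma admissibleP z w c : admissible d z w c ->
  exists r, [/\ List.In r (rels d z), partner r = w & col r = c].
Proof.
by move=> /List.existsb_exists[r [rz /andP[/Pos.eqb_eq ? /eq_columnP ?]]]; exists r.
Qed.

Lemma supp_spec z r a : List.In r (rels d z) -> PositiveSet.In a (supp r) ->
  a = z \/ mutable_label a /\ a \in map fst (col r).
Proof.
move=> /regular[x ->] /=; elim: x.2 => [/PositiveSet.singleton_spec|y c IH /=]; first by left.
case: ifP => [my /PositiveSet.add_spec[-> | /IH] | _ /IH].
- by right; rewrite inE eqxx.
- by case=> [|[ma ac]]; [left | right; rewrite inE ac orbT].
- by case=> [|[ma ac]]; [left | right; rewrite inE ac orbT].
Qed.

(** Labels compatible with z and with the mutable part of its column lie in the
    stored intersection. *)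
Lemma common_spec z r a : List.In r (rels d z) -> PositiveSet.In a (compat d z) ->
  (forall y, mutable_label y -> y \in map fst (col r) -> PositiveSet.In a (compat d y)) ->
  PositiveSet.In a (common r).
Proof.
move=> /regular[x ->] az /=; elim: x.2 => [//|y c IH] /= h.
have /IH {}IH : forall y', mutable_label y' -> y' \in map fst c -> PositiveSet.In a (compat d y').
  by move=> y' my' y'c; apply: h => //; rewrite inE y'c orbT.
case: ifP => // my; apply/PositiveSet.inter_spec; split=> //.
by apply: h => //; rewrite inE eqxx.
Qed.

Lemma supp_col z r r' : List.In r (rels d z) -> List.In r' (rels d z) -> col r = col r' ->
  supp r = supp r'.
Proof. by move=> /regular[x ->] /regular[x' ->] /= ->. Qed.

Lemma compat_refl a : mutable_label a -> PositiveSet.In a (compat d a).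
Proof. by move=> /(forall_mutableP compat_ok)/andP[/PositiveSet.mem_spec]. Qed.

Lemma compat_sym a b : mutable_label a -> mutable_label b ->
  PositiveSet.In b (compat d a) -> PositiveSet.In a (compat d b).
Proof.
move=> ma mb; have /andP[_ /forall_mutableP/(_ b mb)] := forall_mutableP compat_ok ma.
by case/orP => [/negP h /PositiveSet.mem_spec // | /PositiveSet.mem_spec].
Qed.

Lemma rel_spec z r : mutable_label z -> List.In r (rels d z) ->
  [/\ mutable_label (partner r), ~ PositiveSet.In (partner r) (compat d z),
      uniq (map fst (col r)),
      exists r', [/\ List.In r' (rels d (partner r)), partner r' = z
                   & col r' = opp_column (col r)]
    & forall a, PositiveSet.In a (common r) -> a <> z ->
        PositiveSet.In a (compat d (partner r))].
Proof.
move=> mz rz; have /and5P[mw wz sr _] := forall_relsP rels_ok mz rz.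
move=> /andP[/admissibleP rev /PositiveSet.subset_spec sub]; split=> //.
- by move=> /PositiveSet.mem_spec h; rewrite h in wz.
- exact: sorted_uniq_labels.
by move=> a ar az; apply: sub; apply/PositiveSet.remove_spec.
Qed.

Lemma col_neq0 z r l : mutable_label z -> List.In r (rels d z) ->
  l \in map fst (col r) -> coef l (col r) <> 0%ZZ.
Proof.
move=> mz rz /in_column[e le]; have [_ _ ur _ _] := rel_spec mz rz.
have /and5P[_ _ _ nz _] := forall_relsP rels_ok mz rz.
rewrite (coef_uniq ur le) => e0.
by elim: (col r) nz le => //= x c IH /andP[x0 /IH IHc] [xE|/IHc //]; rewrite xE /= e0 in x0.
Qed.

(** The form in which the check of pairs is used: the columns of z and y in one
    seed, a mutation at z, and the resulting column of y, which the atlas knows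
    again as a relation at y. *)
Lemma pair_spec z r y r2 : mutable_label z -> mutable_label y ->
  List.In r (rels d z) -> List.In r2 (rels d y) ->
  coef z (col r2) <> 0%ZZ -> coef y (col r) = Z.opp (coef z (col r2)) ->
  (forall a b, PositiveSet.In a (supp r) -> PositiveSet.In b (supp r2) ->
     PositiveSet.In b (compat d a)) ->
  PositiveSet.In z (supp r) ->
  exists r', List.In r' (rels d y) /\
    col r' = mutate_column z (partner r) (col r) (col r2).
Proof.
move=> mz my rz ry b0 eb sup zr; set b := coef z (col r2) in b0 eb *.
have [_ _ ur _ _] := rel_spec mz rz; have [_ _ ur2 _ _] := rel_spec my ry.
have [e ye] : exists e, List.In (y, e) (col r) by apply/in_column/coef_in; lia.
have eE : Z.opp e = b by rewrite -(coef_uniq ur ye) eb Z.opp_involutive.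
have [e2 ze2] : exists e, List.In (z, e) (col r2) by apply/in_column/coef_in.
have {}ze2 : List.In (z, b) (col r2) by rewrite /b (coef_uniq ur2 ze2).
have /List.forallb_forall/(_ _ ze2) := forall_relsP buckets_ok my ry.
rewrite mz /= => /List.existsb_exists[q [qB /andP[/Z.eqb_eq qb /eq_columnP qr2]]].
have /List.forallb_forall/(_ _ ye) := forall_relsP pairs_ok mz rz.
rewrite my /= eE => /List.forallb_forall/(_ _ qB).
rewrite qb Z.eqb_refl /= => /orP[/negP[] | ].
  apply/PositiveSet.subset_spec => a; rewrite (supp_col (bucket_sound qB) ry qr2) => ar2.
  apply: (common_spec rz) => [|y' my' y'r]; first exact: sup.
  apply: sup ar2; have [x rE] := regular rz; rewrite rE /= in y'r *.
  elim: x.2 y'r => //= y1 c IH; rewrite inE => /orP[/eqP <- | /IH].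
    by rewrite my'; apply/PositiveSet.add_spec; left.
  by case: ifP => // _ ?; apply/PositiveSet.add_spec; right.
move=> /List.existsb_exists[q' [/bucket_sound q'B /eq_columnP q'E]].
exists q'.2; split=> //; rewrite q'E qr2 /mutate_column -/b.
by case: Z.eqb_spec.
Qed.

End Atlas.

(** * Mutation of labelled seeds *)

Section SeedStates.
Variables (C : numFieldType) (F : fieldType) (iota : {rmorphism C -> F}).
Variables (I J : finType) (d : atlas) (val : label -> F) (froz : J -> label).
Implicit Types (s : seed F I J) (lab : I -> label) (cols : I -> column).
Notation mutable_label := (is_mutable (nmut d)).
Notation cmonomial := (column_monomial 1 *%R val).

Hypothesis froz_inj : injective froz.
Hypothesis froz_frozen : forall j, mutable_label (froz j) = false.

Definition row_label lab (r : I + J) : label :=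
  match r with inl i => lab i | inr j => froz j end.

(** The label lab i names the variable i of the seed, and cols i lists its
    column. *)
Definition represents s lab cols :=
  [/\ forall i, mutable s i = val (lab i), forall j, frozen s j = val (froz j)
    & forall r i, exchange s r i = int_coef (row_label lab r) (cols i)].

(** The part of the invariant that concerns labels only. *)
Record coherent lab cols : Prop := Coherent {
  coherent_mutable : forall i, mutable_label (lab i);
  coherent_inj : injective lab;
  coherent_compat : forall i j, PositiveSet.In (lab j) (compat d (lab i));
  coherent_rel : forall i, exists2 r, List.In r (rels d (lab i)) & col r = cols i;
  coherent_supp : forall i l, coef l (cols i) <> 0%ZZ -> exists r, l = row_label lab r }.

Lemma row_label_inj lab : (forall i, mutable_label (lab i)) -> injective lab ->
  injective (row_label lab).
Proof.
move=> ml il [i|j] [i'|j'] //= => [/il -> | E | E | /froz_inj -> ] //.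
- by have := ml i; rewrite E froz_frozen.
- by have := ml i'; rewrite -E froz_frozen.
Qed.

(** Factors equal to 1 may be dropped or added. *)
Lemma big_uniq_support (g : label -> F) (s t : seq label) : uniq s -> uniq t ->
  (forall l, g l != 1 -> (l \in s) = (l \in t)) ->
  \prod_(l <- s) g l = \prod_(l <- t) g l.
Proof.
move=> us ut st.
have keep (u : seq label) : \prod_(l <- u) g l = \prod_(l <- [seq l <- u | g l != 1]) g l.
  by rewrite big_filter [LHS](bigID (fun l => g l != 1)) /= [X in _ * X]big1 ?mulr1 //
    => l; rewrite negbK => /eqP.
rewrite keep [RHS]keep; apply/perm_big/uniq_perm; rewrite ?filter_uniq // => l.
by rewrite !mem_filter; case: eqP => //= /eqP gl; apply: st.
Qed.

Lemma cmonomialE c : cmonomial c =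
  \prod_(x <- c) (if 0 < int_of_Z x.2 then val x.1 ^ int_of_Z x.2 else 1).
Proof.
elim: c => [|[l e] c IH]; first by rewrite big_nil.
rewrite big_cons -IH /= (_ : 0 < int_of_Z e = Z.ltb 0 e); last by lia.
case: Z.ltb_spec => e0; last by rewrite mul1r.
have -> : int_of_Z e = Pos.to_nat (Z.to_pos e) :> int by lia.
rewrite -exprnP; elim/Pos.peano_ind: (Z.to_pos e) => [|p IHp].
  by rewrite /= expr1.
by rewrite Pos.iter_succ IHp Pos2Nat.inj_succ exprS mulrA.
Qed.

Lemma cmonomial_rows c lab : uniq (map fst c) -> injective (row_label lab) ->
  (forall l, coef l c <> 0%ZZ -> exists r, l = row_label lab r) ->
  \prod_(r | 0 < int_coef (row_label lab r) c)
    val (row_label lab r) ^ int_coef (row_label lab r) c = cmonomial c.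
Proof.
move=> uc il supp.
pose g l := if 0 < int_coef l c then val l ^ int_coef l c else 1.
have -> : cmonomial c = \prod_(l <- map fst c) g l.
  rewrite cmonomialE big_map;
  have : forall x, List.In x c -> int_coef x.1 c = int_of_Z x.2.
    by move=> [l e] /(coef_uniq uc) <-.
  elim: {1 3 4}c => [|x c' IH] eqx; first by rewrite !big_nil.
  rewrite !big_cons IH => [|y yc]; last by apply: eqx; right.
  by rewrite /g eqx //; left.
rewrite big_mkcond /= -(big_map (row_label lab) xpredT g).
apply: big_uniq_support => //; first by rewrite map_inj_uniq // index_enum_uniq.
move=> l gl; have lc : coef l c <> 0%ZZ.
  by move=> l0; move: gl; rewrite /g /int_coef l0 eqxx.
rewrite coef_in //; have [r ->] := supp l lc.
by rewrite map_f ?mem_index_enum.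
Qed.

Hypothesis d_sound : sound_atlas d.
Hypothesis rel_val : forall z r, mutable_label z -> List.In r (rels d z) ->
  val z * val (partner r) = cmonomial (col r) + cmonomial (opp_column (col r)).

Definition mutated_labels lab z w : I -> label := fun i => if i == z then w else lab i.
Definition mutated_columns lab cols z w : I -> column := fun i =>
  if i == z then opp_column (cols z) else mutate_column (lab z) w (cols z) (cols i).

Section Mutation.
Variables (s : seed F I J) (lab : I -> label) (cols : I -> column) (z : I) (r : rel).
Hypotheses (s_basis : good_basis iota s) (s_rep : represents s lab cols).
Hypotheses (s_coh : coherent lab cols).
Hypotheses (rz : List.In r (rels d (lab z))) (r_col : col r = cols z).
Let w := partner r.
Let lab' := mutated_labels lab z w.
Let cols' := mutated_columns lab cols z w.

Let ml i : mutable_label (lab i) := coherent_mutable s_coh i.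

Lemma uniq_cols i : uniq (map fst (cols i)).
Proof.
have [r' r'i <-] := coherent_rel s_coh i.
by have [_ _ ur _ _] := rel_spec d_sound (ml i) r'i.
Qed.

(** The new label is not compatible with the one that it replaces, while the labels
    of a seed are compatible. *)
Lemma partner_new q : row_label lab q <> w.
Proof.
have [mw wz _ _ _] := rel_spec d_sound (ml z) rz.
case: q => [i|j] /= E; last by have := mw; rewrite -/w -E froz_frozen.
by apply: wz; rewrite -/w -E; apply: coherent_compat s_coh _ _.
Qed.

Lemma coef_partner i : coef w (cols i) = 0%ZZ.
Proof.
apply/eqP/negPn/negP => /eqP /(coherent_supp s_coh)[q /esym].
exact: partner_new.
Qed.

Lemma int_coef_skew i j : int_coef (lab i) (cols j) = - int_coef (lab j) (cols i).
Proof.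
have [_ _ bE] := s_rep; have [_ sk] := s_basis.
by rewrite -!(bE (inl _)); apply: sk.
Qed.

Lemma coef_skew i j : coef (lab i) (cols j) = Z.opp (coef (lab j) (cols i)).
Proof. by have := int_coef_skew i j; rewrite /int_coef; lia. Qed.

Lemma coef_diag : coef (lab z) (cols z) = 0%ZZ.
Proof. by have := coef_skew z z; lia. Qed.

Lemma row_label_neq q : q <> inl z -> row_label lab q <> lab z.
Proof.
move=> qz E; apply: qz.
by apply: (row_label_inj (fun i => ml i) (coherent_inj s_coh)); rewrite E.
Qed.

Lemma row_label_mutated q : q <> inl z -> row_label lab' q = row_label lab q.
Proof.
by case: q => //= i iz; rewrite /lab' /mutated_labels; case: eqP => // E; case: iz; rewrite E.
Qed.

Lemma mutable_support l i : mutable_label l -> l \in map fst (cols i) ->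
  exists j, l = lab j.
Proof.
have [r' r'i r'E] := coherent_rel s_coh i; move=> mll; rewrite -r'E.
move=> /(col_neq0 d_sound (ml i) r'i); rewrite r'E.
move=> /(coherent_supp s_coh)[[j | j] lE]; first by exists j.
by rewrite lE /= froz_frozen in mll.
Qed.

Lemma entry_z0 b : mutated_entry 0 b = 0%ZZ.
Proof. by rewrite /mutated_entry; case: ifP. Qed.

(** The exchange relation of the seed is the relation of the atlas, and mutation of
    matrices is mutation of columns; the row z of the matrix is renamed to the
    new label w, whose entry in the old columns is zero. *)
Lemma mutate_represents : represents (mutate z s) lab' cols'.
Proof.
have [mE fE bE] := s_rep; have [ind _] := s_basis; split=> //= [i | q i].
- rewrite /lab' /mutated_labels; case: eqP => // _.
  have vz : val (lab z) != 0.
    by rewrite -mE; apply: (independent_neq0 (inl z) ind).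
  have xE q : extended_cluster s q = val (row_label lab q).
    by case: q => [i'|j] /=; rewrite ?mE ?fE.
  rewrite mE; apply: (mulIf vz); rewrite divfK // [RHS]mulrC (rel_val (ml z) rz) r_col.
  have il : injective (row_label lab).
    exact: (row_label_inj (fun i => ml i) (coherent_inj s_coh)).
  congr (_ + _); rewrite -(cmonomial_rows _ il) ?uniq_cols //.
  + by apply: eq_big => [q | q _]; rewrite bE ?xE.
  + exact: coherent_supp s_coh z.
  + apply: eq_big => [q | q _]; rewrite bE ?xE /int_coef coef_opp; last first.
      by congr (_ ^ _); rewrite -rmorphN.
    by lia.
  + by rewrite /opp_column -map_comp; apply: uniq_cols.
  + by move=> l; rewrite coef_opp => lc; apply: (coherent_supp s_coh (i := z)); lia.
- rewrite /cols' /mutated_columns !bE; case: (eqVneq i z) => [-> | iz].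
    rewrite orbT /int_coef coef_opp.
    case: (eqVneq q (inl z)) => [-> /= | /eqP qz]; last by rewrite row_label_mutated // rmorphN.
    by rewrite coef_diag /lab' /mutated_labels eqxx coef_partner.
  rewrite orbF /int_coef coef_mutate ?uniq_cols //=.
  case: (eqVneq q (inl z)) => [-> /= | /eqP qz].
    rewrite /lab' /mutated_labels eqxx !coef_partner entry_z0 Pos.eqb_refl.
    case: Z.eqb_spec => [-> // | _].
    case: Pos.eqb_spec => [E | _]; first by case: (@partner_new (inl z)).
    by rewrite -rmorphN; congr int_of_Z; lia.
  rewrite row_label_mutated //= -!/(mutated_int _ _) -!int_mutated_entry.
  case: Z.eqb_spec => [-> | _].
    by rewrite /mutated_entry /=; case: ifP => // _; rewrite ?Z.mul_0_r addr0.
  case: Pos.eqb_spec => [/partner_new // | _].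
  case: Pos.eqb_spec => [/(row_label_neq qz) // | _].
  by rewrite -rmorphD; congr int_of_Z; lia.
Qed.

(** The new label is compatible with the others because they are compatible with
    everything in the relation at z; the new columns are in the atlas by
    [pair_spec], whose hypothesis on entries is skew-symmetry. *)
Lemma mutate_coherent : coherent lab' cols'.
Proof.
have [mw wz ur [r' [r'w r'z r'col]] prop] := rel_spec d_sound (ml z) rz.
have comp_w i : i != z -> PositiveSet.In (lab i) (compat d w).
  move=> iz; apply: prop; last first.
    by move=> /(coherent_inj s_coh) E; rewrite E eqxx in iz.
  apply: (common_spec d_sound rz); first exact: coherent_compat s_coh _ _.
  move=> y my; rewrite r_col => yz.
  have [i' ->] := mutable_support my yz.
  exact: coherent_compat s_coh _ _.
split.
- by move=> i; rewrite /lab' /mutated_labels; case: eqP.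
- move=> i j; rewrite /lab' /mutated_labels; case: eqP => [->|_]; case: eqP => [->|_] //.
  + by move=> E; case: (@partner_new (inl j)).
  + by move=> E; case: (@partner_new (inl i)).
  + exact: coherent_inj s_coh _ _.
- move=> i j; rewrite /lab' /mutated_labels.
  case: (eqVneq i z) => [_|iz]; case: (eqVneq j z) => [_|jz].
  + exact: compat_refl d_sound _ mw.
  + exact: comp_w.
  + by apply: (compat_sym d_sound) => //; apply: comp_w.
  + exact: coherent_compat s_coh _ _.
- move=> i; rewrite /lab' /cols' /mutated_labels /mutated_columns.
  case: (eqVneq i z) => [_|iz]; first by exists r' => //; rewrite r'col r_col.
  have [r2 r2i r2col] := coherent_rel s_coh i.
  have [c0 | /eqP c0] := eqVneq (coef (lab z) (cols i)) 0%ZZ.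
    by exists r2 => //; rewrite r2col /mutate_column c0.
  have [] := @pair_spec d d_sound
    (lab z) r (lab i) r2 => //.
  + by rewrite r2col.
  + by rewrite r2col r_col coef_skew.
  + move=> a b /(supp_spec d_sound rz) az /(supp_spec d_sound r2i) bi.
    have [ia ->] : exists j, a = lab j.
      by case: az => [-> | [ma]]; [exists z | rewrite r_col; apply: mutable_support].
    have [ib ->] : exists j, b = lab j.
      by case: bi => [-> | [mb]]; [exists i | rewrite r2col; apply: mutable_support].
    exact: coherent_compat s_coh _ _.
  + have [x rE] := sound_rels d_sound rz; rewrite rE /=; elim: x.2 => [|y c IH] /=.
      exact/PositiveSet.singleton_spec.
    by case: ifP => // _; apply/PositiveSet.add_spec; right.
  by move=> r3 [r3i r3E]; exists r3 => //; rewrite r3E r2col r_col.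
- move=> i l; rewrite /cols' /mutated_columns; case: (eqVneq i z) => [_|iz].
    rewrite coef_opp => lc; have [|q lq] := @coherent_supp _ _ s_coh z l; first by lia.
    exists q; rewrite row_label_mutated // => qz.
    by move: lc; rewrite lq qz coef_diag.
  rewrite coef_mutate ?uniq_cols //=.
  case: (eqVneq l w) => [-> _ | lw].
    by exists (inl z); rewrite /= /lab' /mutated_labels eqxx.
  suff H : l <> lab z -> coef l (cols i) <> 0%ZZ \/ coef l (cols z) <> 0%ZZ ->
      exists q, l = row_label lab' q.
    have [lz | /eqP lz] := eqVneq l (lab z).
      rewrite lz coef_diag entry_z0 Pos.eqb_refl.
      case: Z.eqb_spec => [c0 | _]; first by rewrite c0.
      by case: Pos.eqb_spec => [E|_]; [case: (@partner_new (inl z)) | lia].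
    case: Z.eqb_spec => _ h; apply: H => //; first by left.
    case: (Z.eq_dec (coef l (cols i)) 0) => [li|]; last by left.
    right=> lz0; apply: h; rewrite li lz0 entry_z0.
    case: Pos.eqb_spec => [E|_]; first by rewrite E eqxx in lw.
    by case: Pos.eqb_spec => [/lz|].
  move=> lz lc; have [q lq] : exists q, l = row_label lab q.
    by case: lc => /(coherent_supp s_coh).
  exists q; rewrite row_label_mutated // => qz.
  by apply: lz; rewrite lq qz.
Qed.

End Mutation.
End SeedStates.

(** * Reachable seeds *)

Section Reachable.
Variables (C : numFieldType) (F : fieldType) (iota : {rmorphism C -> F}).
Variables (I J : finType) (d : atlas) (val : label -> F) (froz : J -> label).
Notation mutable_label := (is_mutable (nmut d)).
Notation cmonomial := (column_monomial 1 *%R val).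
Hypothesis froz_inj : injective froz.
Hypothesis froz_frozen : forall j, mutable_label (froz j) = false.
Hypothesis d_sound : sound_atlas d.
Hypothesis rel_val : forall z r, mutable_label z -> List.In r (rels d z) ->
  val z * val (partner r) = cmonomial (col r) + cmonomial (opp_column (col r)).

Notation represents := (represents val froz).
Notation coherent := (coherent d froz).

Definition valid (s : seed F I J) lab cols :=
  [/\ good_basis iota s, represents s lab cols & coherent lab cols].

Lemma valid_mutate s lab cols z r : valid s lab cols ->
  List.In r (rels d (lab z)) -> col r = cols z ->
  valid (mutate z s) (mutated_labels lab z (partner r))
    (mutated_columns lab cols z (partner r)).
Proof.
move=> [bs rs cs] rz rE; split; first exact: good_basis_mutate.
- exact: mutate_represents bs rs cs rz rE.
- exact: mutate_coherent bs rs cs rz rE.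
Qed.

Variables (s0 : seed F I J) (st0 : state) (N : nat) (pos : I -> nat).
Hypothesis pos_inj : injective pos.
Hypothesis pos_lt : forall i, (pos i < N)%N.
Hypothesis pos_onto : forall p, (p < N)%N -> exists i, pos i = p.
Hypotheses (st0_size1 : size st0.1 = N) (st0_size2 : size st0.2 = N).

Definition labels_of (st : state) (i : I) : label := nth 1%positive st.1 (pos i).
Definition columns_of (st : state) (i : I) : column := nth [::] st.2 (pos i).
Definition valid_state (s : seed F I J) (st : state) :=
  [/\ size st.1 = N, size st.2 = N & valid s (labels_of st) (columns_of st)].

Hypothesis s0_valid : valid s0 (labels_of st0) (columns_of st0).

(** Coherence provides a relation of the atlas for the mutation in any
    direction. *)
Theorem mutation_equivalent_valid s : mutation_equivalent s0 s ->
  exists lab cols, valid s lab cols.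
Proof.
elim=> [|z s' _ [lab [cols v]]]; first by exists (labels_of st0), (columns_of st0).
have [_ _ cs] := v; have [r rz rE] := coherent_rel cs z.
by exists (mutated_labels lab z (partner r)), (mutated_columns lab cols z (partner r));
  apply: valid_mutate.
Qed.

Lemma valid_state_mutate s st x : valid_state s st -> (x.1 < size st.1)%N ->
  admissible d (nth 1%positive st.1 x.1) x.2 (nth [::] st.2 x.1) ->
  exists z, valid_state (mutate z s) (mutate_state st x).
Proof.
case: x => p w [sz1 sz2 v] /=; rewrite sz1 => pN /admissibleP[r [rz rw rE]].
have [z zp] := pos_onto pN; exists z.
have := valid_mutate (z := z) v; rewrite /labels_of /columns_of zp => /(_ r rz rE).
rewrite rw => v'; split.
- by rewrite /= size_set_nth sz1; apply/maxn_idPr.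
- by rewrite /= size_set_nth size_map sz2; apply/maxn_idPr.
suff [-> ->] : labels_of (mutate_state st (p, w)) = mutated_labels (labels_of st) z w /\
  columns_of (mutate_state st (p, w)) = mutated_columns (labels_of st) (columns_of st) z w.
  by [].
split; apply/funext => i; rewrite /labels_of /columns_of /mutated_labels /mutated_columns
  /mutate_state /= nth_set_nth /= -zp.
  by rewrite (inj_eq pos_inj).
rewrite (inj_eq pos_inj); case: eqP => // _.
by rewrite (nth_map [::]) // sz2.
Qed.

(** The seeds along the route are seeds in the sense of mutation, so each label met
    on the way names a cluster variable. *)
Lemma route_valid s st xs : mutation_equivalent s0 s -> valid_state s st ->
  check_route d st xs ->
  (forall l, l \in st.1 ++ map snd xs -> exists s' lab cols i,
     [/\ mutation_equivalent s0 s', valid s' lab cols & lab i = l]) /\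
  (exists s', mutation_equivalent s0 s' /\ valid_state s' (foldl mutate_state st xs)).
Proof.
elim: xs s st => [|x xs IH] s st es vs /=.
  move=> _; split=> [l|]; last by exists s.
  rewrite cats0 => lst; have [sz1 sz2 v] := vs.
  have [i ip] := @pos_onto (index l st.1) ltac:(by rewrite -sz1 index_mem).
  exists s, (labels_of st), (columns_of st), i; split=> //.
  by rewrite /labels_of ip nth_index.
move=> /and3P[xst ax chk]; have [z vz] := valid_state_mutate vs xst ax.
have [vis fin] := IH _ _ (mutation_step z es) vz chk; split=> // l.
rewrite mem_cat inE => /orP[lst | lxs].
  have [sz1 sz2 v] := vs.
  have [i ip] := @pos_onto (index l st.1) ltac:(by rewrite -sz1 index_mem).
  exists s, (labels_of st), (columns_of st), i; split=> //.
  by rewrite /labels_of ip nth_index.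
apply: vis; rewrite mem_cat; case/orP: lxs => [/eqP -> | ->]; last by rewrite orbT.
apply/orP; left; apply/(nthP 1%positive); exists x.1.
  by rewrite /= size_set_nth leq_max ltnSn.
by rewrite /= nth_set_nth /= eqxx.
Qed.

End Reachable.

(** * Exchange relations hold for the functions *)

Lemma get_add (T : Type) (x0 v : T) M k l :
  get x0 (PositiveMap.add k v M) l = if l == k then v else get x0 M l.
Proof.
rewrite /get; case: eqP => [-> | kl]; first by rewrite PositiveMap.gss.
by rewrite PositiveMap.gso.
Qed.

Section GeneratedAtlas.
Variables (n : nat) (negs : seq expr) (poss : seq (seq nat * expr)) (walk : seq nat).
Local Notation d := (mk_atlas n negs poss walk).

Lemma mk_atlas_rels z r : List.In r (rels d z) ->
  exists x, r = mk_rel (nmut d) (compats d) z x.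
Proof.
rewrite /rels /get /= PositiveMap.gmapi; case: PositiveMap.find => [s|] //=.
by move=> /List.in_map_iff[x [<- _]]; exists x.
Qed.

(** Filing relations under their labels creates no new relation. *)
Lemma bucket_relations_sound nm (R : relmap) y z q :
  List.In q (get [::] (get (PositiveMap.empty _) (bucket_relations nm R) y) z) ->
  List.In q.2 (get [::] R y).
Proof.
pose sound (B : bucketmap) := forall y z q,
  List.In q (get [::] (get (PositiveMap.empty _) B y) z) -> List.In q.2 (get [::] R y).
suff: sound (bucket_relations nm R) by apply.
have foldlP (T : Type) (f : bucketmap -> T -> bucketmap) (s : seq T) B :
    sound B -> (forall B x, List.In x s -> sound B -> sound (f B x)) -> sound (foldl f B s).
  elim: s B => [//|x s IH] B /= sB sf; apply: IH.
    by apply: sf => //; left.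
  by move=> B' x' x's; apply: sf; right.
rewrite /bucket_relations; apply: (foldlP) => [y' z' q'|B y' _ sB].
  by rewrite /get PositiveMap.gempty /= PositiveMap.gempty.
apply: (foldlP) => // {B sB}B r ry' sB; apply: (foldlP) => // {B sB}B x _ sB.
rewrite /insert_bucket; case: ifP => // _ y1 z1 q1; rewrite get_add.
case: eqP => [-> | _]; last exact: sB.
by rewrite get_add; case: eqP => [_ [<- // | ] | _]; apply: sB.
Qed.

Lemma mk_atlas_buckets y z q : List.In q (bucket d y z) -> List.In q.2 (rels d y).
Proof. exact: bucket_relations_sound. Qed.

End GeneratedAtlas.

Section RelationValues.
Variables (C : numFieldType) (n : nat) (es : seq expr) (d : atlas).
Hypothesis n_ok : (3 < n <= 8)%N.
Hypothesis es_ok : all (well_labelled n) es.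
Hypothesis d_sound : sound_atlas d.
Hypothesis identities : check_identities d es.

Definition expr_of (l : label) : expr := nth EOne es (Pos.to_nat l).-1.
Definition val_of (l : label) : fracRing C 3 n := plucker_fun C n (expr_of l).

Lemma column_monomial_morph (T U : Type) (f : T -> U) (one : T) mul (mul' : U -> U -> U)
    (v : label -> T) c : (forall a b, f (mul a b) = mul' (f a) (f b)) ->
  f (column_monomial one mul v c) = column_monomial (f one) mul' (f \o v) c.
Proof.
move=> fM; elim: c => //= -[l e] c <- /=; case: ifP => // _.
by rewrite (Pos.iter_swap_gen _ _ _ (mul (v l)) (mul' (f (v l)))) // => a; apply: fM.
Qed.

Lemma get_pols l : get pone (numbered (map pol_of es)) l = pol_of (expr_of l).
Proof.
rewrite get_numbered /expr_of.
have [lt | ge] := ltnP (Pos.to_nat l).-1 (size es); first by rewrite (nth_map EOne).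
by rewrite !nth_default ?size_map.
Qed.

Lemma pol_of_monomial c : pol_of (column_monomial EOne EMul expr_of c) =
  column_monomial pone pmul (get pone (numbered (map pol_of es))) c.
Proof.
rewrite (@column_monomial_morph _ _ pol_of EOne EMul pmul) //; congr column_monomial.
by apply/funext => l; rewrite get_pols.
Qed.

Lemma plucker_fun_monomial c : plucker_fun C n (column_monomial EOne EMul expr_of c) =
  column_monomial 1 *%R val_of c.
Proof. by rewrite (@column_monomial_morph _ _ (plucker_fun C n) EOne EMul *%R). Qed.

Lemma well_labelled_expr_of l : well_labelled n (expr_of l).
Proof.
have [lt | ge] := ltnP (Pos.to_nat l).-1 (size es).
  exact: all_nthP es_ok _ lt.
by rewrite /expr_of nth_default.
Qed.

Lemma well_labelled_monomial c : well_labelled n (column_monomial EOne EMul expr_of c).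
Proof.
elim: c => //= -[l e] c IH /=; case: ifP => // _.
elim/Pos.peano_ind: (Z.to_pos e) => [|p IHp] /=; first by rewrite well_labelled_expr_of.
by rewrite Pos.iter_succ /= well_labelled_expr_of.
Qed.

Lemma opp_columnK c : opp_column (opp_column c) = c.
Proof. by elim: c => //= -[l e] c -> /=; rewrite Z.opp_involutive. Qed.

(** Only one of a relation and its reverse is verified, the one whose new label is
    not the smaller of the two. *)
Lemma relation_value z r : is_mutable (nmut d) z -> List.In r (rels d z) ->
  val_of z * val_of (partner r) =
  column_monomial 1 *%R val_of (col r) + column_monomial 1 *%R val_of (opp_column (col r)).
Proof.
wlog zw : z r / Pos.ltb (partner r) z = false => [hwlog|] mz rz.
  case E : (Pos.ltb (partner r) z); last exact: hwlog.
  have [mw _ _ [r' [r'w r'z r'col]] _] := rel_spec d_sound mz rz.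
  have zw : Pos.ltb (partner r') (partner r) = false.
    by rewrite r'z; apply/Pos.ltb_ge; move/Pos.ltb_lt: E; lia.
  have := hwlog _ _ zw mw r'w; rewrite r'z r'col opp_columnK.
  by rewrite mulrC addrC.
have := forall_relsP d_sound identities mz rz; rewrite zw /=.
rewrite !get_pols -!pol_of_monomial.
set M := column_monomial _ _ _ (col r); set N := column_monomial _ _ _ (opp_column _).
move=> /(@plucker_identity C n (EMul (expr_of z) (expr_of (partner r))) (EAdd M N) n_ok).
rewrite plucker_funM plucker_funD !plucker_fun_monomial; apply.
  by apply/andP; split; apply: well_labelled_expr_of.
by apply/andP; split; apply: well_labelled_monomial.
Qed.

End RelationValues.

(** * Independence of minors *)

Section Vanishing.
Variables (C : numFieldType) (k : nat).
Implicit Types (P : {mpoly C[k]}) (c : 'I_k -> C) (s : seq 'I_k).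

Definition specialize s c : {mpoly C[k]} -> {mpoly C[k]} :=
  mmap (@mpolyC _ C) (fun j => if j \in s then (c j)%:MP else 'X_j).

HB.instance Definition _ s c := GRing.RMorphism.copy (specialize s c)
  (mmap (@mpolyC _ C) (fun j => if j \in s then (c j)%:MP else 'X_j)).

Lemma specializeX s c j : specialize s c 'X_j = if j \in s then (c j)%:MP else 'X_j.
Proof. by rewrite /specialize mmapX mmap1U. Qed.
Lemma specializeC s c a : specialize s c a%:MP = a%:MP.
Proof. by rewrite /specialize mmapC. Qed.

(** The non-zero integers are infinitely many roots. *)
Lemma poly_inf_roots (R : idomainType) (phi : {rmorphism C -> R}) (p : {poly R}) :
  (forall t, t != 0 -> p.[phi t] = 0) -> p = 0.
Proof.
move=> p0; pose r := [seq phi (i.+1)%:R | i <- iota 0 (size p)].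
apply: (@roots_geq_poly_eq0 _ _ r); last by rewrite size_map size_iota.
- by apply/allP => _ /mapP[i _ ->]; rewrite /root p0 // pnatr_eq0.
rewrite map_inj_uniq ?iota_uniq // => i j /fmorph_inj /eqP.
by rewrite eqr_nat eqSS => /eqP.
Qed.

Definition substitute i (x : {mpoly C[k]}) : {mpoly C[k]} -> {mpoly C[k]} :=
  mmap (@mpolyC k C) (fun j => if j == i then x else 'X_j).
HB.instance Definition _ i x := GRing.RMorphism.copy (substitute i x)
  (mmap (@mpolyC k C) (fun j => if j == i then x else 'X_j)).

Definition univariate i : {mpoly C[k]} -> {poly {mpoly C[k]}} :=
  mmap (polyC \o @mpolyC k C) (fun j => if j == i then 'X else ('X_j)%:P).
HB.instance Definition _ i := GRing.RMorphism.copy (univariate i)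
  (mmap (polyC \o @mpolyC k C) (fun j => if j == i then 'X else ('X_j)%:P)).

Lemma horner_univariate i x P : (univariate i P).[x] = substitute i x P.
Proof.
elim/mpoly_subring_ind: P => [a|j|p p' IH IH'|p p' IH IH'].
- by rewrite /univariate /substitute !mmapC hornerC.
- rewrite /univariate /substitute !mmapX !mmap1U.
  by case: eqP => _; rewrite ?hornerX ?hornerC.
- rewrite (rmorphD (univariate i)) (rmorphD (substitute i x)) hornerD.
  exact: congr2 IH IH'.
- rewrite (rmorphM (univariate i)) (rmorphM (substitute i x)) hornerM.
  exact: congr2 IH IH'.
Qed.

Lemma substitute_id i P : substitute i 'X_i P = P.
Proof.
elim/mpoly_subring_ind: P => [a|j|p p' IH IH'|p p' IH IH'].
- by rewrite /substitute mmapC.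
- by rewrite /substitute mmapX mmap1U; case: eqP => // ->.
- rewrite (rmorphD (substitute i _)); exact: congr2 IH IH'.
- rewrite (rmorphM (substitute i _)); exact: congr2 IH IH'.
Qed.

Lemma specialize_eq0 i P :
  (forall t, t != 0 -> specialize [:: i] (fun=> t) P = 0) -> P = 0.
Proof.
move=> P0; have q0 : univariate i P = 0.
  apply: (@poly_inf_roots _ (@mpolyC k C)) => t t0; rewrite horner_univariate -(P0 t t0).
  rewrite /specialize /substitute /mmap; apply: eq_bigr => m _; congr (_ * _).
  by rewrite /mmap1; apply: eq_bigr => j _; rewrite inE.
by rewrite -(substitute_id i P) -horner_univariate q0 horner0.
Qed.

(** The variables are replaced by constants one at a time: a polynomial in one
    variable over a domain has finitely many roots. *)
Lemma mpoly_eq0_torus P : (forall c, (forall i, c i != 0) -> P.@[c] = 0) -> P = 0.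
Proof.
move=> P0.
suff H s : (forall c, (forall i, c i != 0) -> specialize s c P = 0) -> P = 0.
  apply: (H (enum 'I_k)) => c c0.
  rewrite -(mpolyC0 k) -(P0 c c0).
  elim/mpoly_subring_ind: P {P0 H} => [a|j|p p' IH IH'|p p' IH IH'].
  - by rewrite specializeC mevalC.
  - by rewrite specializeX mem_enum mevalXU.
  - rewrite (rmorphD (specialize _ _)) mevalD mpolyCD; exact: congr2 IH IH'.
  - rewrite (rmorphM (specialize _ _)) mevalM mpolyCM; exact: congr2 IH IH'.
elim: s => [|i s IH] h.
  rewrite -(h (fun=> 1)) => [|i]; last exact: oner_neq0.
  elim/mpoly_subring_ind: P {P0 h} => [a|j|p p' IH IH'|p p' IH IH'].
  - by rewrite specializeC.
  - by rewrite specializeX.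
  - rewrite (rmorphD (specialize _ _)); exact: congr2 IH IH'.
  - rewrite (rmorphM (specialize _ _)); exact: congr2 IH IH'.
apply: IH => c c0; apply: (@specialize_eq0 i) => t t0.
pose c' j := if j == i then (if i \in s then c i else t) else c j.
rewrite -(h c') => [|j]; last by rewrite /c'; do 2?case: ifP.
elim/mpoly_subring_ind: P {P0 h} => [a|j|p p' IH IH'|p p' IH IH'].
- by rewrite !specializeC.
- rewrite !specializeX inE /c'; have [-> | ji] := eqVneq j i.
    by case: ifP => /= js; rewrite ?specializeC // specializeX inE eqxx.
  by rewrite /=; case: ifP => js; rewrite ?specializeC // specializeX inE (negPf ji).
- rewrite !(rmorphD (specialize _ _)); exact: congr2 IH IH'.
- rewrite !(rmorphM (specialize _ _)); exact: congr2 IH IH'.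
Qed.
End Vanishing.

Section PluckerIndependence.
Variables (C : numFieldType) (n : nat) (T : finType) (a : T -> seq nat).
Hypothesis a3 : forall t, exists x y z, [/\ a t = [:: x; y; z], (0 < x <= n)%N, (0 < y <= n)%N & (0 < z <= n)%N].

Definition minor_at (v : 'M[C]_(3, n)) (s : seq nat) : C :=
  det3 (entry v) (nth 0%N s 0) (nth 0%N s 1) (nth 0%N s 2).

Definition to_plucker : {mpoly C[#|T|]} -> pluckerPoly C 3 n :=
  mmap (@mpolyC _ C) (fun j => delta_poly C 3 n (a (enum_val j))).
HB.instance Definition _ := GRing.RMorphism.copy to_plucker
  (mmap (@mpolyC _ C) (fun j => delta_poly C 3 n (a (enum_val j)))).

Lemma to_pluckerC c : to_plucker c%:MP = c%:MP. Proof. exact: mmapC. Qed.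
Lemma to_pluckerX j : to_plucker 'X_j = delta_poly C 3 n (a (enum_val j)).
Proof. by rewrite /to_plucker mmapX mmap1U. Qed.

(** A relation between the minors vanishes at all their common values, hence on the
    whole torus. *)
Lemma plucker_independent :
  (forall c : T -> C, (forall t, c t != 0) ->
     exists v, forall t, minor_at v (a t) = c t) ->
  algebraically_independent (@const_fun C 3 n) (fun t => Delta C 3 n (a t)).
Proof.
move=> section P P0.
pose x t := Delta C 3 n (a t).
have QE : coord_fun (to_plucker P) = peval (@const_fun C 3 n) x P.
  elim/mpoly_subring_ind: P {P0} => [c|j|p p' IH IH'|p p' IH IH'].
  - by rewrite to_pluckerC peval_const.
  - rewrite to_pluckerX coord_fun_delta_poly.
    by rewrite -{2}(enum_valK j) -/(pvarX _ _) peval_var.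
  - rewrite (rmorphD to_plucker) (rmorphD (@coord_fun C 3 n)) (rmorphD (peval _ _)).
    exact: congr2 IH IH'.
  - rewrite (rmorphM to_plucker) (rmorphM (@coord_fun C 3 n)) (rmorphM (peval _ _)).
    exact: congr2 IH IH'.
have /eqP/coord_fun_eq0P Q0 : coord_fun (to_plucker P) = 0 by rewrite QE.
apply: mpoly_eq0_torus => c c0.
have [v vE] := section (fun t => c (enum_rank t)) (fun t => c0 _).
rewrite -(Q0 v); elim/mpoly_subring_ind: P {P0 QE Q0} => [b|j|p p' IH IH'|p p' IH IH'].
- by rewrite to_pluckerC mevalC /at_matrix mevalC.
- rewrite to_pluckerX mevalXU -{1}(enum_valK j) -vE /minor_at.
  have [y1 [y2 [y3 [-> h1 h2 h3]]]] := a3 (enum_val j).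
  by rewrite at_matrix_delta3.
- rewrite (rmorphD to_plucker) (rmorphD (at_matrix v)) mevalD IH IH'; reflexivity.
- rewrite (rmorphM to_plucker) (rmorphM (at_matrix v)) mevalM IH IH'; reflexivity.
Qed.
End PluckerIndependence.

(** * Matrices with given initial minors *)

Section Sections.
Variable C : numFieldType.

Definition of_columns n (cols : seq (C * C * C)) : 'M[C]_(3, n) :=
  \matrix_(i, j) let x := nth (0, 0, 0) cols j in nth 0 [:: x.1.1; x.1.2; x.2] i.

Definition column_entry (cols : seq (C * C * C)) (i j : nat) : C :=
  let x := nth (0, 0, 0) cols j.-1 in nth 0 [:: x.1.1; x.1.2; x.2] i.

Lemma entry_of_columns n cols i j : (i < 3)%N -> (0 < j <= n)%N ->
  entry (of_columns n cols) i j = column_entry cols i j.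
Proof.
case: j => // j i3 jn; rewrite /entry (big_pred1 (Ordinal jn)); last first.
  by move=> j'; rewrite eqSS; apply: (val_eqE j' (Ordinal jn)).
by rewrite mxE inordK.
Qed.

Lemma minor_of_columns n cols x y z :
  (0 < x <= n)%N -> (0 < y <= n)%N -> (0 < z <= n)%N ->
  minor_at (of_columns n cols) [:: x; y; z] = det3 (column_entry cols) x y z.
Proof. by move=> hx hy hz; rewrite /minor_at /= /det3 !entry_of_columns. Qed.

Definition initial_rows (n : nat) : seq (seq nat) :=
  [seq Iset 3 n i j | i <- iota 1 2, j <- iota 1 (n - 3).-1] ++
  [seq sort leq (run n r.+1%:Z 3) | r <- iota 0 n].

Variable g : seq nat -> C.
Hypothesis g0 : forall s, g s != 0.

Definition interpolates n (v : 'M[C]_(3, n)) : Prop :=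
  {in initial_rows n, forall s, minor_at v s = g s}.

Lemma initial_rows6 : initial_rows 6 =
  [:: [:: 3; 5; 6]; [:: 1; 3; 6]; [:: 3; 4; 6]; [:: 2; 3; 6];
      [:: 1; 2; 3]; [:: 2; 3; 4]; [:: 3; 4; 5]; [:: 4; 5; 6]; [:: 1; 5; 6]; [:: 1; 2; 6]]%N.
Proof. by vm_compute. Qed.

Lemma initial_rows7 : initial_rows 7 =
  [:: [:: 4; 6; 7]; [:: 1; 4; 7]; [:: 1; 3; 7]; [:: 4; 5; 7]; [:: 3; 4; 7]; [:: 1; 3; 4];
      [:: 1; 2; 3]; [:: 2; 3; 4]; [:: 3; 4; 5]; [:: 4; 5; 6]; [:: 5; 6; 7];
      [:: 1; 6; 7]; [:: 1; 2; 7]]%N.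
Proof. by vm_compute. Qed.

Lemma initial_rows8 : initial_rows 8 =
  [:: [:: 5; 7; 8]; [:: 1; 5; 8]; [:: 1; 4; 8]; [:: 1; 2; 4]; [:: 5; 6; 8]; [:: 4; 5; 8];
      [:: 1; 4; 5]; [:: 1; 3; 4];
      [:: 1; 2; 3]; [:: 2; 3; 4]; [:: 3; 4; 5]; [:: 4; 5; 6]; [:: 5; 6; 7];
      [:: 6; 7; 8]; [:: 1; 7; 8]; [:: 1; 2; 8]]%N.
Proof. by vm_compute. Qed.

Ltac each_row vs :=
  let sL := fresh "sL" in
  move=> sL;
  repeat (move: sL; rewrite in_cons => /predU1P[-> | sL];
    first (rewrite minor_of_columns // /det3 /column_entry /=; vs; field; rewrite ?g0 //));
  by rewrite in_nil in sL.

(** Three columns are multiples of the basis vectors; the remaining initial minors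
    are then used one after the other, each being an affine function of one new
    entry with a coefficient that is already known not to vanish.  The other two
    cases are similar. *)
Lemma interpolation6 : exists v, @interpolates 6 v.
Proof.
pose c a b c := g [:: a; b; c]%N.
pose v11 := - (c 1 3 6 / c 3 5 6).
pose v10 := c 1 5 6.
pose v41 := c 3 4 6 / c 3 5 6.
pose v42 := - (c 3 4 5 / c 3 5 6).
pose v40 := c 4 5 6.
pose v21 := - (c 2 3 6 / c 3 5 6).
pose v22 := (c 2 3 4 + v21 * c 3 5 6 * v42) / (c 3 5 6 * v41).
pose v20 := - ((c 1 2 6 - v10 * v21) / v11).
pose v12 := - ((c 1 2 3 - v11 * v22 * c 3 5 6) / (v21 * c 3 5 6)).
exists (of_columns 6 [:: (v10, v11, v12); (v20, v21, v22); (c 3 5 6, 0, 0); (v40, v41, v42); (0, 1, 0); (0, 0, 1)]) => s.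
rewrite initial_rows6; each_row ltac:(rewrite /v12 /v20 /v22 /v21 /v40 /v42 /v41 /v10 /v11 /c).
Qed.

Lemma interpolation7 : exists v, @interpolates 7 v.
Proof.
pose c a b c := g [:: a; b; c]%N.
pose v12 := c 1 3 4 / c 3 4 7.
pose v11 := - (c 1 3 7 / c 3 4 7).
pose v10 := c 1 4 7.
pose v60 := - (c 4 6 7).
pose v50 := - (c 4 5 7).
pose v52 := c 3 4 5 / c 3 4 7.
pose v62 := - ((c 4 5 6 - v52 * v60) / v50).
pose v61 := (c 1 6 7 + v11 * v60) / v10.
pose v51 := - ((c 5 6 7 - v50 * v61) / v60).
pose v22 := c 2 3 4 / c 3 4 7.
pose v21 := - ((c 1 2 3 - v11 * v22 * c 3 4 7) / (v12 * c 3 4 7)).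
pose v20 := - ((c 1 2 7 - v10 * v21) / v11).
exists (of_columns 7 [:: (v10, v11, v12); (v20, v21, v22); (c 3 4 7, 0, 0); (0, 1, 0); (v50, v51, v52); (v60, v61, v62); (0, 0, 1)]) => s.
rewrite initial_rows7; each_row ltac:(rewrite /v20 /v21 /v22 /v51 /v61 /v62 /v52 /v50 /v60 /v10 /v11 /v12 /c).
Qed.

(** The minors 234, 124 and 123 give the coordinates x, y, z of column 2 with
    respect to columns 1, 3, 4; the minor 128 then determines the remaining entry
    of column 3. *)
Lemma interpolation8 : exists v, @interpolates 8 v.
Proof.
pose c a b c := g [:: a; b; c]%N.
pose v10 := c 1 5 8.
pose v11 := - (c 1 4 8 / c 4 5 8).
pose v12 := c 1 4 5 / c 4 5 8.
pose v60 := - (c 5 6 8).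
pose v62 := c 4 5 6 / c 4 5 8.
pose v70 := - (c 5 7 8).
pose v71 := (c 1 7 8 + v11 * v70) / v10.
pose v61 := - ((c 6 7 8 - v60 * v71) / v70).
pose v72 := - ((c 5 6 7 - v62 * v70) / v60).
pose v32 := c 3 4 5 / c 4 5 8.
pose v31 := - ((c 1 3 4 - v11 * v32 * c 4 5 8) / (v12 * c 4 5 8)).
pose y := c 1 2 4 / c 1 3 4.
pose z := - (c 1 2 3 / c 1 3 4).
pose v30 := (v10 * v31 - (c 1 2 8 - z * c 1 4 8) / y) / v11.
pose x := c 2 3 4 / c 1 3 4.
pose v20 := x * v10 + y * v30 + z * c 4 5 8.
pose v21 := x * v11 + y * v31.
pose v22 := x * v12 + y * v32.
exists (of_columns 8 [:: (v10, v11, v12); (v20, v21, v22); (v30, v31, v32); (c 4 5 8, 0, 0); (0, 1, 0); (v60, v61, v62); (v70, v71, v72); (0, 0, 1)]) => s.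
rewrite initial_rows8; each_row ltac:(rewrite /v22 /v21 /v20 /x /v30 /z /y /v31 /v32 /v72 /v61 /v71 /v70 /v62 /v60 /v12 /v11 /v10 /c).
Qed.

End Sections.

(** * Denominators *)

Section DenominatorCheck.
Variables (C : numFieldType) (F : fieldType) (iota : {rmorphism C -> F}).
Variables (d : atlas) (m n : nat) (roots : seq (seq nat)) (es : seq expr).
Variables (D : nat -> nat -> nat -> F) (val : label -> F).
Notation nmut := (nmut d).
Notation mutable_label := (is_mutable nmut).
Hypothesis d_sound : sound_atlas d.
Hypothesis roots_size : (size roots = nmut - m)%N.
Hypothesis m_nmut : (m <= nmut)%N.
Hypothesis D_rot : forall a b c, D a b c = D b c a.
Hypothesis val_expr : forall l,
  val l = interp 1 -%R (fun x y => x - y) +%R *%R D (nth EOne es (Pos.to_nat l).-1).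
Hypothesis rel_val : forall z r, mutable_label z -> List.In r (rels d z) ->
  val z * val (partner r) =
  column_monomial 1 *%R val (col r) + column_monomial 1 *%R val (opp_column (col r)).
Hypothesis roots_pos : all (fun s => 0 < sumn s)%N roots.
Hypothesis ok : check_denominators d m n roots es.

(** The Dynkin cluster and the boundary minors. *)
Definition basis_label (r : 'I_m + 'I_n) : label :=
  Pos.of_succ_nat (match r with inl i => i : nat | inr j => (nmut + j)%N end).

Notation v := (fun r => val (basis_label r)).
Hypothesis iv : algebraically_independent iota v.
Notation cmonomial := (column_monomial 1 *%R val).
Notation dv := (get [::] (numbered (degree_vectors m n roots))).
Notation ht := (get 0%N (numbered (heights m n roots))).
Notation laurent := (laurent iota v).
Notation has_order := (has_order iota v).

Definition graded (l : label) : Prop :=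
  laurent (val l) /\ forall i : 'I_m, has_order i (- int_of_Z (nth 0%ZZ (dv l) i)) (val l).

Lemma laurent_monomial c : (forall x, List.In x c -> laurent (val x.1)) ->
  laurent (cmonomial c).
Proof.
elim: c => [|x c IH] h /=; first by rewrite -(rmorph1 iota); apply: laurent_const.
have {}IH : laurent (cmonomial c) by apply: IH => y yc; apply: h; right.
case: ifP => // _; have lx : laurent (val x.1) by apply: h; left.
elim/Pos.peano_ind: (Z.to_pos x.2) => [|p IHp] /=; first exact: laurentM.
by rewrite Pos.iter_succ; apply: laurentM.
Qed.

(** [exponent] is the tropical evaluation of a monomial. *)
Lemma order_monomial i c :
  (forall x, List.In x c -> has_order i (- int_of_Z (nth 0%ZZ (dv x.1) i)) (val x.1)) ->
  has_order i (- int_of_Z (exponent dv i c)) (cmonomial c).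
Proof.
elim: c => [|x c IH] h /=; first by rewrite oppr0; apply: has_order1.
have {}IH : has_order i (- int_of_Z (exponent dv i c)) (cmonomial c).
  by apply: IH => y yc; apply: h; right.
case: Z.ltb_spec => // x0; have lx := h x (or_introl erefl).
rewrite -{1}(Z2Pos.id x.2 x0); elim/Pos.peano_ind: (Z.to_pos x.2) => [|p IHp].
  rewrite [Pos.iter _ _ _]/=.
  rewrite (_ : - int_of_Z _ = - int_of_Z (nth 0%ZZ (dv x.1) i) - int_of_Z (exponent dv i c)).
    exact: has_orderM.
  by rewrite -opprD -rmorphD; congr (- int_of_Z _); lia.
rewrite Pos.iter_succ (_ : - int_of_Z _ = - int_of_Z (nth 0%ZZ (dv x.1) i) -
  int_of_Z (Z.add (Z.mul (Z.pos p) (nth 0%ZZ (dv x.1) i)) (exponent dv i c))).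
  exact: has_orderM.
by rewrite -opprD -rmorphD; congr (- int_of_Z _); lia.
Qed.

Lemma height0_basis l : (Pos.to_nat l <= nmut + n)%N -> ht l = 0%N ->
  exists r, l = basis_label r.
Proof.
move=> ln; rewrite get_numbered /heights nth_cat size_nseq.
case: ltnP => [lm _ | ml].
  by exists (inl (Ordinal lm)); rewrite /basis_label /=; lia.
rewrite nth_cat size_map roots_size; case: ltnP => [lr | rl _].
  rewrite (nth_map [::]) ?roots_size // => h0.
  have /(all_nthP [::])/(_ ((Pos.to_nat l).-1 - m)%N) := roots_pos.
  by rewrite roots_size => /(_ lr); rewrite h0.
have jn : ((Pos.to_nat l).-1 - nmut < n)%N by lia.
by exists (inr (Ordinal jn)); rewrite /basis_label /=; lia.
Qed.

Lemma basis_graded r : graded (basis_label r).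
Proof.
split=> [|i]; first exact: (laurent_var _ _ r).
suff -> : - int_of_Z (nth 0%ZZ (dv (basis_label r)) i) = (r == inl i)%:Z.
  exact: has_order_var.
rewrite get_numbered /degree_vectors /basis_label SuccNat2Pos.id_succ /= nth_cat size_map size_iota.
case: r => [k | j].
  rewrite ltn_ord (nth_map 0%N) ?size_iota // nth_iota // add0n.
  rewrite (nth_map 0%N) ?size_iota // nth_iota // add0n.
  by rewrite -[inl k == inl i]/(k == i) -val_eqE /=; case: eqP.
rewrite ifF; last by lia.
rewrite nth_cat size_map roots_size ifF; last by lia.
by rewrite nth_nseq; case: ifP => _; rewrite ?nth_nil // nth_nseq; case: ifP.
Qed.

(** Induction on the height, along the relations found by [check_denominators].
    Positivity is what makes the exponents come out exactly: the order of the sum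
    of the two monomials is the minimum of their orders. *)
Lemma label_graded l : (Pos.to_nat l <= nmut + n)%N -> graded l.
Proof.
have [k] := ubnP (ht l); elim: k l => // k IH l lk ln.
have [h0 | h1] := eqVneq (ht l) 0%N.
  by have [r ->] := height0_basis ln h0; apply: basis_graded.
have ml : mutable_label l.
  rewrite mutable_labelE //; case: leqP => // lN; case/negP: h1.
  rewrite get_numbered /heights nth_cat size_nseq ifF; last by lia.
  by rewrite nth_cat size_map roots_size ifF ?nth_nseq ?if_same //; lia.
pose desc := descends m (nmut + n) dv ht l.
(* What a descending relation gives by the induction hypothesis. *)
have descP r : List.In r (rels d l) -> desc r ->
    [/\ graded (partner r), forall x, List.In x (col r) -> graded x.1
     & forall i : 'I_m, has_order i (- int_of_Z (nth 0%ZZ (dv l) i)) (val l)].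
  move=> rl /and3P[wl /List.forallb_forall cl /allP tl].
  have [mw _ _ _ _] := rel_spec d_sound ml rl.
  have gw : graded (partner r).
    apply: IH; first exact: leq_trans wl _.
    by move: mw; rewrite mutable_labelE //; lia.
  have gc x : List.In x (col r) -> graded x.1.
    move=> /cl /andP[xN xl]; apply: IH; first exact: leq_trans xl _.
    have nm0 : (0 < nmut)%N := sound_nmut d_sound.
    move/Pos.leb_le/Pos2Nat.inj_le: xN; rewrite Nat2Pos.id => [/ssrnat.leP //|].
    by apply/eqP; rewrite -lt0n addn_gt0 nm0.
  split=> // i.
  have wv : val (partner r) != 0 by apply: (has_order_neq0 iv (gw.2 i)).
  have vE : val l = (cmonomial (col r) + cmonomial (opp_column (col r))) / val (partner r).
    by rewrite -(rel_val ml rl) mulfK.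
  have o1 := @order_monomial i (col r) (fun x xc => (gc x xc).2 i).
  have o2 : has_order i (- int_of_Z (exponent dv i (opp_column (col r))))
      (cmonomial (opp_column (col r))).
    apply: order_monomial => x /List.in_map_iff[y [<- yc]] /=.
    exact: (gc y yc).2.
  have := has_orderM iv (has_orderD iv o1 o2) (has_orderV iv (gw.2 i)).
  rewrite -vE (_ : _ + _ = - int_of_Z (nth 0%ZZ (dv l) i)) //.
  have := tl i; rewrite mem_iota ltn_ord => /(_ isT) /Z.eqb_eq.
  by lia.
have := forall_mutableP d_sound ok ml; rewrite (negPf h1) -/desc.
case: ifP => [/List.existsb_exists[r [rl rm]] _ | _ /andP[known /List.existsb_exists[r [rl dr]]]].
  move: rm; case: ifP => // wm dr; have [gw gc go] := descP r rl dr.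
  split=> //.
  have [i wE] : exists i : 'I_m, partner r = basis_label (inl i).
    have wm' : ((Pos.to_nat (partner r)).-1 < m)%N by lia.
    by exists (Ordinal wm'); rewrite /basis_label /=; lia.
  have wv : val (partner r) != 0.
    by rewrite wE; apply: (v_neq0 iv (inl i)).
  rewrite (_ : val l = (cmonomial (col r) + cmonomial (opp_column (col r))) / val (partner r)).
    rewrite wE; apply: laurentM => //; last exact: (laurent_varV iota v i).
    apply: laurentD => //; apply: laurent_monomial => x; first by move=> /gc[].
    by move=> /List.in_map_iff[y [<- yc]] /=; case: (gc y yc).
  by rewrite -(rel_val ml rl) mulfK.
have [_ _ go] := descP r rl dr; split=> //.
rewrite val_expr; move: known; rewrite (get_numbered EOne es l).
elim: (nth EOne es _) => [|a b c|e IHe|e IHe f IHf|e IHe f IHf|e IHe f IHf] /=.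
- by move=> _; rewrite -(rmorph1 iota); apply: laurent_const.
- move=> /hasP[y]; rewrite mem_labels_upto => yN /andP[yl].
  have [gy _] : graded y by apply: IH => //; apply: leq_trans yl _.
  rewrite (get_numbered EOne) /is_minor; move: gy; rewrite val_expr.
  case: (nth EOne es _) => // a' b' c' /= gy.
  rewrite !inE => /or3P[] /eqP[aE bE cE]; move: gy; rewrite aE bE cE //.
    by rewrite -D_rot.
  by rewrite D_rot.
- by move=> /IHe; apply: laurentN.
- by move=> /andP[/IHe le /IHf lf]; apply: laurentD => //; apply: laurentN.
- by move=> /andP[/IHe le /IHf lf]; apply: laurentD.
- by move=> /andP[/IHe le /IHf lf]; apply: laurentM.
Qed.

End DenominatorCheck.

(** * Generation of the field *)

Section FractionField.

Lemma fraction_quotient (R : idomainType) (f : {fraction R}) :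
  exists a b : R, FracField.tofrac b != 0 /\ f * FracField.tofrac b = FracField.tofrac a.
Proof.
elim/quotW: f => r; exists (frac r).1, (frac r).2; split.
  by rewrite tofrac_eq0 denom_ratioP.
rewrite -[X in X * _](congr1 _ (Ratio_numden r)); unlock FracField.tofrac.
rewrite -[LHS]FracField.pi_mul /FracField.mulf !numden_Ratio ?oner_neq0 ?denom_ratioP //.
rewrite mulr1; apply/eqmodP; rewrite /= FracField.equivfE.
by rewrite !numden_Ratio ?oner_neq0 ?denom_ratioP // mulr1 mulrC.
Qed.

Variables (C : numFieldType) (k n : nat).

Lemma kelt_increasing (K : ksubset k n) (i j : 'I_k) :
  (i < j)%N -> (kelt K i < kelt K j)%N.
Proof.
move=> ij; have sK : sorted ltn (map (@nat_of_ord n) (enum (val K))).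
  have sN : sorted ltn (map (@nat_of_ord n) (enum 'I_n)) by rewrite val_enum_ord iota_ltn_sorted.
  rewrite sorted_map; rewrite sorted_map in sN.
  rewrite {1}/enum_mem; apply: sorted_filter => [x y z|]; first exact: ltn_trans.
  by move: sN; rewrite {1}/enum_mem filter_predT.
have x0 := kelt K i.
have lt_size l : (nat_of_ord (cast_ord (esym (eqP (valP K))) l) < size (map (@nat_of_ord n) (enum (val K))))%N.
  by rewrite size_map -cardE.
have := sorted_ltn_nth ltn_trans 0%N sK _ _ (lt_size i) (lt_size j) ij.
have eE l : kelt K l = nth 0%N (map (@nat_of_ord n) (enum (val K))) (cast_ord (esym (eqP (valP K))) l) :> nat.
  by rewrite (nth_map x0) -?cardE // -enum_val_nth.
by rewrite -!eE.
Qed.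

Lemma coordinate_delta (K : ksubset k n) :
  coord_fun ('X_(enum_rank K) : pluckerPoly C k n) =
  Delta C k n [seq (kelt K j).+1 | j <- enum 'I_k].
Proof.
rewrite -coord_fun_delta_poly; apply/eqP; rewrite -subr_eq0 -raddfB /=.
apply/coord_fun_eq0P => v; rewrite rmorphB /=.
rewrite (at_matrix_delta_poly v (f := kelt K)) => [|j]; last first.
  by rewrite (nth_map j) ?size_enum_ord // nth_ord_enum.
by rewrite /at_matrix mevalXU enum_rankK subrr.
Qed.

(** The field of fractions of a quotient of a polynomial ring is generated by the
    images of the variables, and these are minors. *)
Lemma generating_minors (T : finType) (x : T -> fracRing C k n) :
  (forall K : ksubset k n,
     rational_in (@const_fun C k n) x (Delta C k n [seq (kelt K j).+1 | j <- enum 'I_k])) ->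
  generating (@const_fun C k n) x.
Proof.
move=> h; have coord (p : pluckerPoly C k n) : rational_in (@const_fun C k n) x (coord_fun p).
  elim/mpoly_subring_ind: p => [c|i|p q IHp IHq|p q IHp IHq].
  - exact: rational_const.
  - by rewrite -(enum_valK i) coordinate_delta; apply: h.
  - by rewrite (rmorphD (@coord_fun C k n)); apply: rationalD.
  - by rewrite (rmorphM (@coord_fun C k n)); apply: rationalM.
move=> f; have [a [b [b0 fE]]] := fraction_quotient f.
rewrite -(mulfK b0 f) fE; apply: rationalM; last apply: rationalV.
  by rewrite -[a]reprK; apply: coord.
by rewrite -[b]reprK; apply: coord.
Qed.
End FractionField.

Section Reindexing.
Variables (C : numFieldType) (F : fieldType) (iota : {rmorphism C -> F}).

Definition rename (S T : finType) (h : S -> T) : {mpoly C[#|S|]} -> {mpoly C[#|T|]} :=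
  mmap (@mpolyC _ C) (fun i => pvarX C (h (enum_val i))).
HB.instance Definition _ (S T : finType) (h : S -> T) := GRing.RMorphism.copy (rename h)
  (mmap (@mpolyC _ C) (fun i => pvarX C (h (enum_val i)))).

Lemma renameC (S T : finType) (h : S -> T) c : rename h c%:MP = c%:MP.
Proof. exact: mmapC. Qed.
Lemma renameX (S T : finType) (h : S -> T) s : rename h (pvarX C s) = pvarX C (h s).
Proof. by rewrite /rename mmapX mmap1U enum_rankK. Qed.

Lemma peval_rename (S T : finType) (h : S -> T) (x : T -> F) P :
  peval iota x (rename h P) = peval iota (x \o h) P.
Proof.
elim/mpoly_subring_ind: P => [c|i|p q IH IH'|p q IH IH'].
- by rewrite renameC !peval_const.
- by rewrite -(enum_valK i) -/(pvarX _ _) renameX !peval_var.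
- rewrite (rmorphD (rename h)) !rmorphD; exact: congr2 IH IH'.
- rewrite (rmorphM (rename h)) !rmorphM; exact: congr2 IH IH'.
Qed.

Lemma renameK (S T : finType) (h : S -> T) h' : cancel h h' -> cancel (rename h) (rename h').
Proof.
move=> hK P; elim/mpoly_subring_ind: P => [c|i|p q IH IH'|p q IH IH'].
- by rewrite !renameC.
- by rewrite -(enum_valK i) -/(pvarX _ _) !renameX hK.
- rewrite (rmorphD (rename h)) (rmorphD (rename h')); exact: congr2 IH IH'.
- rewrite (rmorphM (rename h)) (rmorphM (rename h')); exact: congr2 IH IH'.
Qed.

Lemma independent_reindex (S T : finType) (x : T -> F) (h : S -> T) (h' : T -> S) :
  cancel h h' -> algebraically_independent iota x ->
  algebraically_independent iota (x \o h).
Proof.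
move=> hK ix P; rewrite -peval_rename => /ix hP0.
by rewrite -(renameK hK P) hP0 rmorph0.
Qed.
End Reindexing.

Section OutOfRange.
Variables (C : numFieldType) (k n : nat).

Lemma delta_out a : ~~ all (fun x => 0 < x <= n)%N (take k a) -> (k <= size a)%N ->
  Delta C k n a = 0.
Proof.
move=> /allPn[x /(nthP 0%N)[j]]; rewrite size_take_min => /leq_trans/(_ (geq_minl _ _)) jk.
rewrite nth_take // => <- out _; apply: big1 => K _; apply: big_pred0 => s.
apply/forallP => /(_ (Ordinal jk)) /= /eqP jE; move: out.
by rewrite jE ltnS leq0n ltn_ord.
Qed.
End OutOfRange.

(** * Checks on the initial seed and on the table *)

Section InitialChecks.
Variables (d : atlas) (n : nat) (es : seq expr).
Local Notation K := (n - 3).-1.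

(** The entry of the initial exchange matrix in a row given by its set of labels
    and in the column of the pair (i, j). *)
Definition initial_entry (row : seq nat) (i j : nat) : int :=
  if row \in [:: Iset 3 n i.+1 j; Iset 3 n i.-1 j] then (-1) ^+ (i + j)
  else if row \in [:: Iset 3 n i j.+1; Iset 3 n i j.-1] then - (-1) ^+ (i + j)
  else 0.

(** The boundary minor whose labels start at j + 1. *)
Definition frozen_label (j : nat) : label := Pos.of_succ_nat (nmut d + j).
Definition row_labels : seq label := (origin d).1 ++ mkseq frozen_label n.
Definition expr_row (e : expr) : seq nat := if e is EPl a b c then [:: a; b; c] else [::].

Definition check_shape : bool :=
  [&& (nmut d + n)%N == size es, size (origin d).1 == (2 * K)%N, size (origin d).2 == (2 * K)%N,
      uniq (initial_rows n), all (well_labelled n) es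
    & all (fun s => (size s == 3) && all (fun a => 0 < a <= n)%N s) (initial_rows n)].

Definition check_initial_labels : bool :=
  [&& uniq (origin d).1, all (is_mutable (nmut d)) (origin d).1,
      all (fun a => all (fun b => PositiveSet.mem b (compat d a)) (origin d).1) (origin d).1
    & all (fun q => expr_row (expr_of es (nth 1%positive row_labels q)) == nth [::] (initial_rows n) q)
        (iota 0 (2 * K + n))].

Definition check_initial_columns : bool :=
  all (fun p =>
    [&& List.existsb (fun r => eq_column (col r) (nth [::] (origin d).2 p))
          (rels d (nth 1%positive (origin d).1 p)),
        all (fun x => x.1 \in row_labels) (nth [::] (origin d).2 p)
      & all (fun q => initial_entry (nth [::] (initial_rows n) q) (p %/ K).+1 (p %% K).+1
                      == int_coef (nth 1%positive row_labels q) (nth [::] (origin d).2 p))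
          (iota 0 (2 * K + n))]) (iota 0 (2 * K)).

Definition check_skew : bool :=
  all (fun p => all (fun q =>
    initial_entry (nth [::] (initial_rows n) p) (q %/ K).+1 (q %% K).+1 ==
    - initial_entry (nth [::] (initial_rows n) q) (p %/ K).+1 (p %% K).+1)
    (iota 0 (2 * K))) (iota 0 (2 * K)).

Definition check_visited : bool :=
  all (fun l => l \in (origin d).1 ++ map snd (route d)) (labels_upto (nmut d)).

(** All minors with increasing labels are in the table or on the boundary. *)
Definition check_minors : bool :=
  all (fun a => all (fun b => all (fun c => has (fun e => expr_row e == [:: a; b; c]) es)
    (iota b.+1 (n - b))) (iota a.+1 (n - a))) (iota 1 n).

(** The route ends at a seed formed by the first m labels, which are the opposite
    simple roots. *)
Definition check_dynkin (m : nat) (E : seq (nat * nat)) : bool :=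
  let st := foldl mutate_state (origin d) (route d) in
  let at_node i := index (Pos.of_succ_nat i) st.1 in
  (m == (2 * K)%N) &&
  all (fun i => (at_node i < m)%N && all (fun j =>
    adjacent_nodes E i j ==
      ~~ Z.eqb (coef (Pos.of_succ_nat i) (nth [::] st.2 (at_node j))) 0) (iota 0 m)) (iota 0 m).
End InitialChecks.

Definition check_atlas (d : atlas) (n : nat) (es : seq expr) : bool :=
  [&& (5 < n <= 8)%N, (0 < nmut d)%N, check_compat d, check_rels d, check_buckets d,
      check_pairs d & check_identities d es].

Definition check_start (d : atlas) (n : nat) (es : seq expr) : bool :=
  [&& check_shape d n es, check_initial_labels d n es, check_initial_columns d n,
      check_skew n, check_route d (origin d) (route d), check_visited d & check_minors n es].

Definition check_table (d : atlas) (m n : nat) (E : seq (nat * nat)) (negs : seq expr)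
    (poss : seq (seq nat * expr)) : bool :=
  [&& check_dynkin d n m E, check_roots m E (map fst poss),
      check_denominators d m n (map fst poss) (exprs n negs poss),
      size negs == m & all (fun e => ~~ Z.ltb (value n 0 e) 0) negs].

(** * The correspondence for a checked table *)

Definition plucker_table (C : numFieldType) m n (negs : seq expr) (poss : seq (seq nat * expr)) :=
  @mk_table C m n (map (plucker_fun C n) negs) [seq (p.1, plucker_fun C n p.2) | p <- poss].

Section CheckedTable.
Variables (C : numFieldType) (n : nat) (d : atlas) (es : seq expr).
Hypothesis d_rels : forall z r, List.In r (rels d z) ->
  exists x, r = mk_rel (nmut d) (compats d) z x.
Hypothesis d_buckets : forall y z q, List.In q (bucket d y z) -> List.In q.2 (rels d y).
Hypothesis atlas_ok : check_atlas d n es.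
Hypothesis start_ok : check_start d n es.
Hypothesis interpolation : forall g : seq nat -> C, (forall s, g s != 0) ->
  exists v, interpolates g (n := n) v.
Local Notation K := (n - 3).-1.
Local Notation iota := (@const_fun C 3 n).
Local Notation seed0 := (initial_seed C 3 n).
Local Notation val := (val_of C n es).
Local Notation froz := (fun j : 'I_n => frozen_label d j).
Local Notation row_set := (@Defs.row_set 3 n).
Local Notation rows := (initial_rows n).

Lemma n_gt5 : (5 < n)%N.
Proof. by case/andP: atlas_ok => /andP[]. Qed.

Lemma n_ok : (3 < n <= 8)%N.
Proof. by case/andP: atlas_ok => /andP[n5 ->] _; rewrite andbT (ltn_trans _ n5). Qed.

Lemma atlas_sound : sound_atlas d.
Proof. by case/and5P: atlas_ok => _ ? ? ? /and3P[? ? _]; split. Qed.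

Lemma es_ok : all (well_labelled n) es.
Proof. by case/andP: start_ok => /and5P[_ _ _ _ /andP[]]. Qed.

Lemma val_rel z r : is_mutable (nmut d) z -> List.In r (rels d z) ->
  val z * val (partner r) =
  column_monomial 1 *%R val (col r) + column_monomial 1 *%R val (opp_column (col r)).
Proof.
apply: (relation_value C n_ok es_ok atlas_sound).
by case/and5P: atlas_ok => _ _ _ _ /and3P[].
Qed.

Lemma froz_inj : injective froz.
Proof. by move=> i j /SuccNat2Pos.inj/addnI/val_inj. Qed.

Lemma froz_frozen j : is_mutable (nmut d) (froz j) = false.
Proof. by rewrite (mutable_labelE atlas_sound) SuccNat2Pos.id_succ ltnNge leq_addr. Qed.

(** The position of a pair in the row-major enumeration used for the initial
    state. *)
Definition grid_index (c : grid 3 n) : nat := (c.1 * K + c.2)%N.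
Definition row_index (r : grid 3 n + 'I_n) : nat :=
  match r with inl c => grid_index c | inr j => (2 * K + j)%N end.

Lemma grid_index_div c : (grid_index c %/ K)%N = c.1.
Proof.
have c2 := ltn_ord c.2; rewrite /grid_index divnMDl ?divn_small ?addn0 //.
exact: leq_ltn_trans c2.
Qed.

Lemma grid_index_mod c : (grid_index c %% K)%N = c.2.
Proof. by rewrite /grid_index modnMDl modn_small. Qed.

Lemma grid_index_lt c : (grid_index c < 2 * K)%N.
Proof.
have c1 : (c.1 <= 1)%N := ltn_ord c.1; have c2 := ltn_ord c.2.
by rewrite /grid_index mul2n -addnn -addnS leq_add // -[leqRHS]mul1n leq_mul2r c1 orbT.
Qed.

Lemma grid_index_inj : injective grid_index.
Proof.
move=> [c1 c2] [c1' c2'] cc'; congr pair; apply: val_inj.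
  by rewrite -[LHS](grid_index_div (c1, c2)) cc' grid_index_div.
by rewrite -[LHS](grid_index_mod (c1, c2)) cc' grid_index_mod.
Qed.

Lemma grid_index_onto p : (p < 2 * K)%N -> exists c, grid_index c = p.
Proof.
move=> pK; have K0 : (0 < K)%N by have := n_gt5; lia.
have h1 : (p %/ K < 3.-1)%N by rewrite ltn_divLR.
have h2 : (p %% K < K)%N by rewrite ltn_mod.
by exists (Ordinal h1, Ordinal h2); rewrite /grid_index /= -divn_eq.
Qed.

Lemma row_index_lt r : (row_index r < 2 * K + n)%N.
Proof.
by case: r => [c|j] /=; [rewrite ltn_addr ?grid_index_lt | rewrite ltn_add2l].
Qed.

Lemma row_index_inj : injective row_index.
Proof.
move=> [c|j] [c'|j'] /=; first by move=> /grid_index_inj ->.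
- by move=> cj; have := grid_index_lt c; rewrite cj ltnNge leq_addr.
- by move=> cj; have := grid_index_lt c'; rewrite -cj ltnNge leq_addr.
- by move=> /addnI/val_inj ->.
Qed.

Lemma row_index_onto q : (q < 2 * K + n)%N -> exists r, row_index r = q.
Proof.
have [qK _ | Kq qn] := ltnP q (2 * K).
  by have [c cq] := grid_index_onto qK; exists (inl c).
have jn : (q - 2 * K < n)%N by lia.
by exists (inr (Ordinal jn)); rewrite /= subnKC.
Qed.

Lemma size_rows : size rows = (2 * K + n)%N.
Proof. by rewrite size_cat size_allpairs !size_map !size_iota. Qed.

Lemma row_setE r : row_set r = nth [::] rows (row_index r).
Proof.
rewrite nth_cat size_allpairs !size_iota.
case: r => [c|j]; last first.
  rewrite ltnNge leq_addr addKn /=.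

  rewrite (nth_map 0%N); last by rewrite size_iota.
  by rewrite nth_iota.
rewrite grid_index_lt /= cats0 /grid_index nth_cat size_map size_iota.
have c2 := ltn_ord c.2; case: c c2 => -[[|[|//]] i1] c2 /= c2K.
  rewrite mul0n add0n c2K (nth_map 0%N); last by rewrite size_iota.
  by rewrite nth_iota.
rewrite mul1n ltnNge leq_addr addKn /= (nth_map 0%N); last by rewrite size_iota.
by rewrite nth_iota.
Qed.

Lemma row_set_inj : injective row_set.
Proof.
move=> r r'; rewrite !row_setE => /eqP.
have ur : uniq rows by case/andP: start_ok => /and5P[_ _ _ -> _].
by rewrite nth_uniq ?size_rows ?row_index_lt // => /eqP/row_index_inj.
Qed.

Lemma row_set3 r : exists x y z,
  [/\ row_set r = [:: x; y; z], (0 < x <= n)%N, (0 < y <= n)%N & (0 < z <= n)%N].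
Proof.
have /(all_nthP [::])/(_ (row_index r)) : all (fun s => (size s == 3) && all (fun a => 0 < a <= n)%N s) rows.
  by case/andP: start_ok => /and5P[_ _ _ _ /andP[]].
rewrite size_rows row_index_lt -row_setE => /(_ isT).
case: (row_set r) => [|x [|y [|z [|//]]]] //= /and4P[hx hy hz _].
by exists x, y, z.
Qed.

Lemma row_labelE r : row_label froz (labels_of grid_index (origin d)) r =
  nth 1%positive (row_labels d n) (row_index r).
Proof.
have sz : size (origin d).1 = (2 * K)%N by case/andP: start_ok => /and5P[_ /eqP].
rewrite /row_labels nth_cat sz; case: r => [c|j] /=; first by rewrite grid_index_lt.
by rewrite ltnNge leq_addr addKn nth_mkseq.
Qed.

Lemma extended_cluster0 r : extended_cluster seed0 r = Delta C 3 n (row_set r).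
Proof. by case: r. Qed.

Lemma val_row_label r : Delta C 3 n (row_set r) =
  val (row_label froz (labels_of grid_index (origin d)) r).
Proof.
have [x [y [z [rE _ _ _]]]] := row_set3 r.
case/and3P: start_ok => _ /and4P[_ _ _ /allP/(_ (row_index r))] + _.
rewrite mem_iota add0n row_index_lt -row_setE -row_labelE => /(_ isT) /eqP.
rewrite rE /val_of; case: expr_of => //= a b c [-> -> ->]; reflexivity.
Qed.

(** The sets of labels of distinct initial minors differ, so prescribing values of
    minors is the same as prescribing values for the rows of the seed. *)
Lemma initial_independent : algebraically_independent iota (extended_cluster seed0).
Proof.
apply: (@eq_independent _ _ _ _ _ (fun r => Delta C 3 n (row_set r))) => [r|].
  by rewrite extended_cluster0.
apply: (plucker_independent row_set3) => c c0.
(* A row that is not in the seed may get any non-zero value. *)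
pose g s := if [pick r | row_set r == s] is Some r then c r else 1.
have g0 s : g s != 0 by rewrite /g; case: pickP => // _; apply: oner_neq0.
have [v vE] := interpolation g0; exists v => r.
rewrite vE; last by rewrite row_setE mem_nth // size_rows row_index_lt.
by rewrite /g; case: pickP => [r' /eqP/row_set_inj -> //|/(_ r)]; rewrite eqxx.
Qed.

Lemma initial_exchangeE (r : grid 3 n + 'I_n) (c : grid 3 n) : initial_exchange r c =
  initial_entry n (nth [::] rows (row_index r)) (grid_index c %/ K).+1 (grid_index c %% K).+1.
Proof. by rewrite -row_setE grid_index_div grid_index_mod. Qed.

Lemma initial_skew : skew seed0.
Proof.
case/and5P: start_ok => _ _ _ /allP sk _ i j.
have inK c : grid_index c \in seq.iota 0 (2 * K) by rewrite mem_iota grid_index_lt.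
have /allP/(_ _ (inK j))/eqP := sk _ (inK i).
by rewrite -!(initial_exchangeE (inl _)).
Qed.

Lemma initial_valid : valid iota d val froz seed0
  (labels_of grid_index (origin d)) (columns_of grid_index (origin d)).
Proof.
split; first by split; [apply: initial_independent | apply: initial_skew].
- case/and3P: start_ok => _ _ /andP[/allP cols _].
  split=> [c|j|r c].
  + exact: (val_row_label (inl c)).
  + exact: (val_row_label (inr j)).
  have /cols/and3P[_ _ /allP/(_ (row_index r))] : grid_index c \in seq.iota 0 (2 * K).
    by rewrite mem_iota grid_index_lt.
  rewrite mem_iota add0n row_index_lt row_labelE -initial_exchangeE => /(_ isT) /eqP.
  exact.
have [/eqP sz1 /eqP sz2] : size (origin d).1 == (2 * K)%N /\ size (origin d).2 == (2 * K)%N.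
  by case/andP: start_ok => /and5P[_ -> -> _ _].
case/and3P: start_ok => _ /and4P[u0 /allP m0 /allP c0 _] /andP[/allP cols _].
have memO c : labels_of grid_index (origin d) c \in (origin d).1.
  by rewrite mem_nth // sz1 grid_index_lt.
split=> [c|c c'|c c'|c|c l].
- exact/m0/memO.
- by move=> /eqP; rewrite nth_uniq ?sz1 ?grid_index_lt // => /eqP/grid_index_inj.
- by apply/PositiveSet.mem_spec; have /allP := c0 _ (memO c); apply.
- have /cols/and3P[/List.existsb_exists[r [rz /eq_columnP rE]] _ _] :
    grid_index c \in seq.iota 0 (2 * K) by rewrite mem_iota grid_index_lt.
  by exists r.
move=> /coef_in/mapP[x xc ->].
have /cols/and3P[_ /allP/(_ x xc) + _] : grid_index c \in seq.iota 0 (2 * K).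
  by rewrite mem_iota grid_index_lt.
move=> /(nthP 1%positive)[q qn <-].
have /row_index_onto[r <-] : (q < 2 * K + n)%N.
  by move: qn; rewrite size_cat size_mkseq sz1.
by exists r; rewrite row_labelE.
Qed.

Local Notation reached l := (exists s lab cols i,
  [/\ mutation_equivalent seed0 s, valid iota d val froz s lab cols & lab i = l]).

Lemma initial_route :
  (forall l, l \in (origin d).1 ++ map snd (route d) -> reached l) /\
  exists s, mutation_equivalent seed0 s /\
    valid_state iota d val froz (2 * K) grid_index s
      (foldl mutate_state (origin d) (route d)).
Proof.
have [/eqP sz1 /eqP sz2] : size (origin d).1 == (2 * K)%N /\ size (origin d).2 == (2 * K)%N.
  by case/andP: start_ok => /and5P[_ -> -> _ _].
apply: (route_valid froz_inj froz_frozen atlas_sound val_rel grid_index_inj grid_index_lt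
  grid_index_onto (mutation_refl seed0)).
  by split=> //; apply: initial_valid.
by case/and5P: start_ok => _ _ _ _ /andP[].
Qed.

Lemma mutable_reached l : is_mutable (nmut d) l -> reached l.
Proof.
move=> ml; apply: initial_route.1.
case/and5P: start_ok => _ _ _ _ /and3P[_ /allP vis _]; apply: vis.
by rewrite mem_labels_upto -(mutable_labelE atlas_sound).
Qed.

Lemma reachable_valid s : mutation_equivalent seed0 s ->
  exists lab cols, valid iota d val froz s lab cols.
Proof.
exact: (mutation_equivalent_valid froz_inj froz_frozen atlas_sound val_rel initial_valid).
Qed.

Lemma val_rational l : (Pos.to_nat l <= nmut d + n)%N ->
  rational_in iota (extended_cluster seed0) (val l).
Proof.
move=> ln; case ml : (is_mutable (nmut d) l).
  have [s [lab [cols [i [es0 [_ [sE _ _] _] <-]]]]] := mutable_reached ml.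
  by rewrite -sE; apply: (rational_equivalent _ es0 (inl i)).
have jn : ((Pos.to_nat l).-1 - nmut d < n)%N.
  by move/negbT: ml; rewrite (mutable_labelE atlas_sound); lia.
have -> : l = froz (Ordinal jn).
  by move/negbT: ml; rewrite /frozen_label /= (mutable_labelE atlas_sound); lia.
rewrite -(val_row_label (inr (Ordinal jn))) -extended_cluster0.
exact: rational_var.
Qed.

(** All minors are cluster variables or coefficients, and elements of reachable
    seeds are rational functions of the initial ones. *)
Lemma initial_generating : generating iota (extended_cluster seed0).
Proof.
apply: generating_minors => M.
have -> : [seq (kelt M j).+1 | j <- enum 'I_3] =
    [:: (kelt M ord0).+1; (kelt M (lift ord0 ord0)).+1; (kelt M (lift ord0 (lift ord0 ord0))).+1].
  by rewrite 3!enum_ordSl enum_ord0.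
set x := kelt M _; set y := kelt M _; set z := kelt M _.
have xy : (x < y)%N by apply: kelt_increasing.
have yz : (y < z)%N by apply: kelt_increasing.
have zn := ltn_ord z.
case/and5P: start_ok => /and5P[/eqP size_es _ _ _ _] _ _ _ /and3P[_ _ /allP minors].
have /minors/allP/(_ y.+1) : x.+1 \in seq.iota 1 n by rewrite mem_iota; lia.
rewrite mem_iota => /(_ ltac:(lia)) /allP/(_ z.+1).
rewrite mem_iota => /(_ ltac:(lia)) /(has_nthP EOne)[q q_es /eqP qE].
have := @val_rational (Pos.of_succ_nat q); rewrite SuccNat2Pos.id_succ size_es.
move=> /(_ q_es); rewrite /val_of /expr_of SuccNat2Pos.id_succ.
by case: nth qE => //= a b c [-> -> ->].
Qed.

Lemma reachable_seed s : mutation_equivalent seed0 s -> seed_from iota seed0 s.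
Proof.
have [bs _ _] := initial_valid; move=> ss; split=> //.
apply: good_basis_is_seed; first exact: good_basis_equivalent ss.
exact: generating_equivalent bs initial_generating ss.
Qed.

(** One direction is coherence of reachable seeds, the other one the route. *)
Lemma cluster_variableP f :
  cluster_variable iota seed0 f <-> exists2 l, is_mutable (nmut d) l & f = val l.
Proof.
split=> [[s [_ ss] [i ->]] | [l ml ->]].
  have [lab [cols [_ [sE _ _] cs]]] := reachable_valid ss.
  by exists (lab i); [apply: coherent_mutable cs i | rewrite sE].
have [s [lab [cols [i [ss [_ [sE _ _] _] <-]]]]] := mutable_reached ml.
by exists s; [apply: reachable_seed | exists i; rewrite sE].
Qed.

Variables (m : nat) (E : seq (nat * nat)) (negs : seq expr) (poss : seq (seq nat * expr)).
Hypothesis es_def : es = exprs n negs poss.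
Hypothesis nmut_def : nmut d = (size negs + size poss)%N.
Hypothesis table_ok : check_table d m n E negs poss.
Local Notation table := (plucker_table C m n negs poss).
Local Notation roots := (map fst poss).
Local Notation node_label := Pos.of_succ_nat.
Local Notation dv := (get [::] (numbered (degree_vectors m n roots))).

Lemma size_negs : size negs = m.
Proof. by case/and5P: table_ok => _ _ _ /eqP. Qed.

Lemma nmutE : nmut d = (m + size poss)%N.
Proof. by rewrite nmut_def size_negs. Qed.

Lemma roots_ok : check_roots m E roots.
Proof. by case/and5P: table_ok. Qed.

Definition map_inl (S T J : Type) (f : S -> T) (r : S + J) : T + J :=
  match r with inl s => inl (f s) | inr j => inr j end.

Lemma dynkin_state : exists s (node : 'I_m -> grid 3 n),
  [/\ mutation_equivalent seed0 s, good_basis iota s, bijective node,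
      forall r : 'I_m + 'I_n, extended_cluster s (map_inl node r) =
                val (basis_label d r)
    & forall i j, adjacent E i j <-> principal s (node i) (node j) != 0].
Proof.
have [_ [s [ss [sz1 sz2 [bs [sE fE bE] cs]]]]] := initial_route.
move: sz1 sz2 sE bE cs; set st := foldl _ _ _ => sz1 sz2 sE bE cs.
case/and5P: table_ok => /andP[/eqP mK /allP at_ok] _ _ _ _.
pose at_node (i : nat) := index (node_label i) st.1.
have at_lt (i : 'I_m) : (at_node i < 2 * K)%N.
  have /at_ok/andP[lt_m _] : (i : nat) \in seq.iota 0 m by rewrite mem_iota add0n ltn_ord.
  exact: leq_trans lt_m (eq_leq mK).
have /fin_all_exists[node nodeE] (i : 'I_m) : exists c, grid_index c = at_node i.
  exact: grid_index_onto.
have labE i : labels_of grid_index st (node i) = node_label i.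
  by rewrite /labels_of nodeE nth_index // -index_mem sz1; apply: at_lt.
have node_inj : injective node.
  by move=> i j ij; apply: val_inj; apply: SuccNat2Pos.inj; rewrite -!labE ij.
exists s, node; split=> //.
- by apply: inj_card_bij => //; rewrite card_prod !card_ord mK.
- by case=> [i|j] /=; rewrite ?sE ?labE ?fE.
move=> i j; rewrite /principal bE /= labE /columns_of nodeE.
have /at_ok/andP[_ /allP/(_ j)] : (i : nat) \in seq.iota 0 m by rewrite mem_iota add0n ltn_ord.
rewrite mem_iota ltn_ord => /(_ isT) /eqP; rewrite -/st -/(at_node j) => adj.
rewrite -[adjacent E i j]/(adjacent_nodes E i j) adj /int_coef.
by case: Z.eqb_spec => [-> | c0]; [rewrite eqxx | split=> // _; lia].
Qed.

Lemma basis_independent :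
  algebraically_independent iota (fun r : 'I_m + 'I_n => val (basis_label d r)).
Proof.
have [s [node [_ [ind _] [g gK nodeK] sE _]]] := dynkin_state.
have hK : cancel (@map_inl _ _ 'I_n node) (map_inl g) by case=> [i|j] //=; rewrite gK.
apply: eq_independent (independent_reindex hK ind) => r; exact: sE.
Qed.

(** If some label is not the number of a column, both sides vanish. *)
Lemma delta_rot a b c : Delta C 3 n [:: a; b; c] = Delta C 3 n [:: b; c; a].
Proof.
have [abc | out] := boolP [&& 0 < a <= n, 0 < b <= n & 0 < c <= n]%N.
  apply/eqP; rewrite -subr_eq0.
  apply/(@plucker_fun_eq0P C n (ESub (EPl a b c) (EPl b c a))) => [/=|v].
    by case/and3P: abc => -> -> ->.
  by rewrite /= /det3; ring.
by rewrite !delta_out //= !andbT; move: out; do 3!case: (_ <= _)%N => //=; do 3!case: (_ <= _)%N.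
Qed.

Lemma all_graded l : (Pos.to_nat l <= nmut d + n)%N ->
  graded iota d m n roots val l.
Proof.
have rs : size roots = (nmut d - m)%N by rewrite size_map nmutE addKn.
have mn : (m <= nmut d)%N by rewrite nmutE leq_addr.
have rp : all (fun s => 0 < sumn s)%N roots.
  by case/and5P: roots_ok => _ _ + _ _; apply: sub_all => s /andP[].
apply: (label_graded atlas_sound rs mn delta_rot _ val_rel rp _ basis_independent) => //.
by rewrite es_def; case/and5P: table_ok.
Qed.

Lemma unzip1_table : unzip1 table =
  [seq - simple_root i | i <- enum 'I_m] ++ [seq root_row m s | s <- roots].
Proof.
rewrite /plucker_table /mk_table /unzip1 map_cat -[map fst (zip _ _)]/(unzip1 _) unzip1_zip; last first.
  by rewrite size_map size_enum_ord size_map size_negs.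
by rewrite /unzip1 -!map_comp; reflexivity.
Qed.

Lemma unzip2_table : unzip2 table = [seq plucker_fun C n e | e <- negs ++ map snd poss].
Proof.
rewrite /plucker_table /mk_table [LHS]map_cat -[X in X ++ _ = _]/(unzip2 (zip _ _)) unzip2_zip; last first.
  by rewrite [leqRHS]size_map size_enum_ord size_map size_negs.
by rewrite map_cat -!map_comp; reflexivity.
Qed.

Lemma size_table : size (unzip1 table) = nmut d.
Proof. rewrite unzip1_table size_cat nmutE; congr addn; first by rewrite size_map size_enum_ord.
by rewrite !size_map. Qed.

Lemma root_entry q (i : 'I_m) : (q < nmut d)%N ->
  nth 0 (unzip1 table) q 0 i = int_of_Z (nth 0%ZZ (dv (node_label q)) i).
Proof.
move=> qN; rewrite get_numbered SuccNat2Pos.id_succ /= unzip1_table /degree_vectors.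
rewrite !nth_cat [size (map _ (enum _))]size_map size_enum_ord !size_map size_iota.
have [qm | mq] := ltnP q m.
  rewrite (nth_map (Ordinal qm)) ?size_enum_ord // (nth_map 0%N) ?size_iota // nth_iota //.
  rewrite (nth_map 0%N) ?size_iota // nth_iota // !mxE eqxx /= !add0n.
  rewrite (_ : nth _ _ _ = Ordinal qm); last by rewrite (nth_ord_enum _ (Ordinal qm)).
  by rewrite -val_eqE /= eq_sym; case: eqP.
have qp : (q - m < size poss)%N by move: qN; rewrite nmutE; lia.
rewrite qp !(nth_map [::]) ?size_map // mxE.
have [ii|ii] := ltnP i (size (nth [::] roots (q - m))).
  by rewrite (nth_map 0%N) //; lia.
by rewrite (nth_default 0%N ii) nth_default ?size_map.
Qed.

Lemma table_uniq : uniq (unzip1 table).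
Proof.
have [/andP[_ ur] _] : uniq roots && uniq roots /\ True.
  by case/and5P: roots_ok => _ -> _ _ _.
rewrite unzip1_table cat_uniq; apply/and3P; split.
- rewrite map_inj_uniq ?enum_uniq // => i j /oppr_inj /rowP/(_ i).
  by rewrite !mxE !eqxx /= eq_sym; case: eqP.
- apply/hasPn => _ /mapP[s _ ->]; apply/negP => /mapP[i _ /rowP/(_ i)].
  by rewrite !mxE !eqxx.
rewrite map_inj_in_uniq // => s t sr tr /root_row_inj; apply; exact: (pos_size roots_ok).
Qed.

Lemma table_roots : indexed_by_roots E table.
Proof.
split=> [|alpha]; first exact: table_uniq.
rewrite unzip1_table mem_cat (almost_positiveP roots_ok); split.
  case/orP => /mapP[x xi ->]; first by left; exists x.
  by right; exists x.
case=> [[i ->] | [s sr ->]]; apply/orP; first by left; apply: map_f; rewrite mem_enum.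
by right; apply: map_f.
Qed.

Lemma root_index alpha : almost_positive_root E alpha ->
  exists2 q, (q < nmut d)%N & alpha = nth 0 (unzip1 table) q.
Proof.
move=> /(table_roots.2 alpha)/(nthP 0)[q]; rewrite size_table => qN <-.
by exists q.
Qed.

Lemma indexed_root q : (q < nmut d)%N -> almost_positive_root E (nth 0 (unzip1 table) q).
Proof. by move=> qN; apply/table_roots.2; rewrite mem_nth ?size_table. Qed.

Lemma tabulated_nth q : (q < nmut d)%N ->
  tabulated table (nth 0 (unzip1 table) q) = plucker_fun C n (nth EOne (negs ++ map snd poss) q).
Proof.
move=> qN; rewrite /tabulated index_uniq ?size_table ?table_uniq // unzip2_table.
by rewrite (nth_map EOne) // size_cat size_map -nmut_def.
Qed.

Lemma val_normalized q : (q < nmut d)%N ->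
  val (node_label q) = plucker_fun C n (normalized n (nth EOne (negs ++ map snd poss) q)).
Proof.
move=> qN; rewrite /val_of /expr_of SuccNat2Pos.id_succ /= es_def /exprs nth_cat.
have qs : (q < size (negs ++ map snd poss))%N by rewrite size_cat size_map -nmut_def.
by rewrite size_map qs (nth_map EOne).
Qed.

Lemma tabulated_val q : (q < nmut d)%N ->
  eq_up_to_sign (tabulated table (nth 0 (unzip1 table) q)) (val (node_label q)).
Proof.
move=> qN; rewrite tabulated_nth // val_normalized // /normalized.
by case: ifP => _; [right; rewrite plucker_funN opprK | left].
Qed.

Lemma simple_root_nth (i : 'I_m) : - simple_root i = nth 0 (unzip1 table) i.
Proof.
rewrite unzip1_table nth_cat size_map size_enum_ord ltn_ord.
by rewrite (nth_map i) ?size_enum_ord // nth_ord_enum.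
Qed.

(** No sign appears since the functions attached to the opposite simple roots are
    already positive on the polygon. *)
Lemma tabulated_simple (i : 'I_m) : tabulated table (- simple_root i) = val (node_label i).
Proof.
have iN : (i < nmut d)%N by rewrite nmutE ltn_addr.
rewrite simple_root_nth tabulated_nth // val_normalized // nth_cat size_negs ltn_ord.
case/and5P: table_ok => _ _ _ _ /(all_nthP EOne)/(_ i).
by rewrite size_negs ltn_ord => /(_ isT) /negPf; rewrite /normalized => ->.
Qed.

Lemma tabulated_order q (i : 'I_m) : (q < nmut d)%N ->
  has_order iota (fun r : 'I_m + 'I_n => val (basis_label d r)) i
    (- nth 0 (unzip1 table) q 0 i) (val (node_label q)).
Proof.
move=> qN; rewrite root_entry //; apply: (all_graded _).2.
by rewrite SuccNat2Pos.id_succ ltn_addr.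
Qed.

(** The orders along the walls recover the root. *)
Lemma table_injective q q' : (q < nmut d)%N -> (q' < nmut d)%N ->
  eq_up_to_sign (tabulated table (nth 0 (unzip1 table) q))
                (tabulated table (nth 0 (unzip1 table) q')) ->
  nth 0 (unzip1 table) q = nth 0 (unzip1 table) q'.
Proof.
move=> qN q'N qq'; apply/rowP => i; apply: oppr_inj.
have vv : eq_up_to_sign (val (node_label q)) (val (node_label q')).
  case: (tabulated_val qN) qq' => ->; case: (tabulated_val q'N) => -> [] => qq'.
  - by left.
  - by right.
  - by right.
  - by left; rewrite qq' opprK.
  - by right; rewrite -qq' opprK.
  - by left; apply: oppr_inj.
  - by left; apply: oppr_inj.
  - by right; apply: oppr_inj.
apply: (has_order_unique basis_independent (tabulated_order i qN)).
by case: vv => ->; [left | right; rewrite opprK]; apply: tabulated_order.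
Qed.

Theorem table_correspondence : root_correspondence E table.
Proof.
split.
- exact: table_roots.
- split=> [alpha /root_index[q qN ->] | alpha beta | f].
  + exists (val (node_label q)); last exact: tabulated_val.
    by apply/cluster_variableP; exists (node_label q) => //;
       rewrite (mutable_labelE atlas_sound) SuccNat2Pos.id_succ.
  + by move=> /root_index[q qN ->] /root_index[q' q'N ->]; apply: table_injective.
  + case/cluster_variableP => l; rewrite (mutable_labelE atlas_sound) => lN ->.
    have qN : ((Pos.to_nat l).-1 < nmut d)%N by lia.
    exists (nth 0 (unzip1 table) (Pos.to_nat l).-1); first exact: indexed_root.
    by have := tabulated_val qN; rewrite (_ : node_label _ = l) //; lia.
- have [s [node [ss bs bij sE adj]]] := dynkin_state.
  exists s; first exact: reachable_seed.
  exists node => //; split=> // i; left.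
  by rewrite tabulated_simple; apply: esym (sE (inl i)).
move=> alpha /root_index[q qN ->].
have [qg _] : graded iota d m n roots val (node_label q).
  by apply: all_graded; rewrite SuccNat2Pos.id_succ ltn_addr.
have [P [PE Pnd]] := laurent_denominator basis_independent qg (fun i => tabulated_order i qN).
have varE (r : 'I_m + 'I_n) : val (basis_label d r) =
    match r with inl i => tabulated table (- simple_root i) | inr j => frozen seed0 j end.
  case: r => [i|j]; first by rewrite tabulated_simple.
  exact: esym (val_row_label (inr j)).
have prodE : \prod_i val (@basis_label d m n (inl i)) ^ nth 0 (unzip1 table) q 0 i =
    \prod_i tabulated table (- simple_root i) ^ nth 0 (unzip1 table) q 0 i.
  by apply: eq_bigr => i _; rewrite -tabulated_simple.
rewrite prodE (eq_peval _ _ varE) in PE.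
have [-> | ->] := tabulated_val qN; first by exists P.
exists (- P); split; first by rewrite rmorphN /= mulNr -PE.
by move=> i Q PQ; apply: (Pnd i (- Q)); rewrite mulrN -PQ opprK.
Qed.

End CheckedTable.

(** * The tables *)

Section Tables.
Variable C : numFieldType.

(** Both sides unfold to the same list. *)
Lemma table_D4E : table_D4 C = plucker_table C 4 6 negs_D4 poss_D4.
Proof. reflexivity. Qed.
Lemma table_E6E : table_E6 C = plucker_table C 6 7 negs_E6 poss_E6.
Proof. reflexivity. Qed.
Lemma table_E8E : table_E8 C = plucker_table C 8 8 negs_E8 poss_E8.
Proof. reflexivity. Qed.
End Tables.

Definition check_all m n E negs poss walk : bool :=
  let d := mk_atlas n negs poss walk in
  let es := exprs n negs poss in
  [&& check_atlas d n es, check_start d n es & check_table d m n E negs poss].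

(** What remains for a given table is one evaluation and the interpolation of the
    initial minors. *)
Lemma checked_correspondence (C : numFieldType) m n E negs poss walk :
  (forall g : seq nat -> C, (forall s, g s != 0) -> exists v, interpolates g (n := n) v) ->
  check_all m n E negs poss walk -> root_correspondence E (plucker_table C m n negs poss).
Proof.
move=> interpolation /and3P[atlas_ok start_ok table_ok].
exact: (table_correspondence (@mk_atlas_rels _ _ _ _) (@mk_atlas_buckets _ _ _ _)
  atlas_ok start_ok interpolation erefl erefl table_ok).
Qed.

Lemma checks_D4 : check_all 4 6 D4 negs_D4 poss_D4 walk_D4.
Proof. by vm_compute. Qed.
Lemma checks_E6 : check_all 6 7 E6 negs_E6 poss_E6 walk_E6.
Proof. by vm_compute. Qed.
Lemma checks_E8 : check_all 8 8 E8 negs_E8 poss_E8 walk_E8.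
Proof. by vm_compute. Qed.

Theorem proposition9 (R : realType) :
  [/\ root_correspondence D4 (table_D4 R[i]),
      root_correspondence E6 (table_E6 R[i])
    & root_correspondence E8 (table_E8 R[i])].
Proof.
rewrite table_D4E table_E6E table_E8E; split.
- exact: checked_correspondence (@interpolation6 _) checks_D4.
- exact: checked_correspondence (@interpolation7 _) checks_E6.
- exact: checked_correspondence (@interpolation8 _) checks_E8.
Qed.
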